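(* Let $g\ge 0$ and $s\ge 1$, and let $\delta^1=\{\delta^1_1,\dots,\delta^1_s\}$ and $\delta^2=\{\delta^2_1,\dots,\delta^2_s\}$ be collections of nonnegative integers with $\sum_{i=1}^s\delta^1_i=\sum_{i=1}^s\delta^2_i=:m$ and $2g-2+s+\left[\frac{m+1}{2}\right]>0$. Let $\Sigma_{g,\delta^1}$ and $\Sigma_{g,\delta^2}$ be the bordered Riemann surfaces of genus $g$ with $s$ boundary components carrying, respectively, $\delta^1_i$ and $\delta^2_i$ marked points on the $i$th boundary component, so that they differ only by the distribution of marked points among the boundary components. Then the Poisson algebras of geodesic functions of $\Sigma_{g,\delta^1}$ and $\Sigma_{g,\delta^2}$ are isomorphic, and an isomorphism is provided by pending-edge flips (combined, where necessary, with flips of inner edges).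
   Context: Spines. A spine of $\Sigma_{g,\delta}$ is a connected fatgraph (graph with a cyclic ordering of the half-edges at each vertex) all of whose vertices are three-valent or one-valent (pending vertices), embedded in the surface so that its faces correspond one-to-one to the $s$ boundary components, the face of the $i$th component containing exactly $\delta_i$ pending vertices. An edge ending at a pending vertex is a pending edge; all other edges are inner. To every edge $\alpha$ one associates a real (shear) coordinate $Z_\alpha$. Poisson structure. The bracket on functions of the $Z_\alpha$ is $\sum_v\sum_{i=1}^3 \frac{\partial}{\partial Z_{v_i}}\wedge\frac{\partial}{\partial Z_{v_{i+1}}}$, where $v$ runs over the three-valent vertices and $v_1,v_2,v_3$ (indices mod 3) are the cyclically ordered edges incident to $v$. Geodesic functions. Put $$X_Z=\begin{pmatrix}0&-e^{Z/2}\\ e^{-Z/2}&0\end{pmatrix},\quad R=\begin{pmatrix}1&1\\-1&0\end{pmatrix},\quad L=\begin{pmatrix}0&1\\-1&-1\end{pmatrix},\quad F=\begin{pmatrix}0&1\\-1&0\end{pmatrix}.$$ To a closed path $\gamma$ without backtracking in the spine, except that whenever it enters a pending edge it is inverted at the pending vertex and returns along this edge, one associates the product $P_\gamma$ (written from right to left along the path) containing $X_{Z_\alpha}$ for each passage of an inner edge $\alpha$, $X_{Z}FX_{Z}$ for each visit to a pending edge with coordinate $Z$, and $L$ or $R$ for each left or right turn at a three-valent vertex. The geodesic function is $G_\gamma=\operatorname{tr}P_\gamma$. The Poisson algebra of geodesic functions is the Poisson algebra generated by all the $G_\gamma$ with the bracket $\sum_v\sum_{i=1}^3 \frac{\partial}{\partial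 Z_{v_i}}\wedge\frac{\partial}{\partial Z_{v_{i+1}}}$ on functions of the shear coordinates $Z_\alpha$ (sum over the three-valent vertices $v$ with cyclically ordered incident edges $v_1,v_2,v_3$, indices mod 3). Flip of an inner edge. Let $Z$ be an inner edge with distinct endpoints whose neighbouring edges are, in cyclic order around $Z$, $A,B,C,D$. The flip contracts $Z$ and expands it in the other way (Whitehead move) and, with $\phi(x)=\log(1+e^x)$, changes coordinates by $(A,B,C,D,Z)\mapsto(A+\phi(Z),B-\phi(-Z),C+\phi(Z),D-\phi(-Z),-Z)$, contributions being added when some of these edges coincide. Flip of a pending edge. Let a pending edge with coordinate $Z$ be attached at a three-valent vertex whose other edges have coordinates $Y_1,Y_2$, so that moving from $Y_1$ one turns left into the pending edge and right into $Y_2$. The flip moves the pending edge to the other side (from $Y_1$ one then turns right into the pending edge and left into $Y_2$) and changes coordinates by $e^{\tilde Z}=e^{-Z}$, $e^{\tilde Y_1}=e^{Y_1}(1+e^{-2Z})^{-1}$, $e^{\tilde Y_2}=e^{Y_2}(1+e^{2Z})$, all others being unchanged. *)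

(* Defs.v *)
From mathcomp Require Import all_boot all_order all_algebra all_fingroup.
From mathcomp Require Import all_classical all_reals all_analysis.
Set Implicit Arguments.
Unset Strict Implicit.
Unset Printing Implicit Defensive.
Import Order.TTheory GRing.Theory Num.Theory.
Import numFieldNormedType.Exports.
Local Open Scope classical_set_scope.
Local Open Scope ring_scope.

(* An edge e has the two half-edges (e, false) and (e, true).  A half-edge is
   also read as the edge oriented away from the vertex carrying the half-edge,
   hence towards the vertex carrying the opposite half-edge. *)
Definition halfedge (E : finType) : finType := (E * bool)%type.

Definition opp_fun (E : finType) (h : halfedge E) : halfedge E := (h.1, ~~ h.2).

Lemma opp_fun_inj (E : finType) : injective (@opp_fun E).
Proof. by move=> [e b] [e' b'] [-> /negb_inj ->]. Qed.

Definition opp (E : finType) : {perm halfedge E} := perm (@opp_fun_inj E).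

(* A fatgraph with edge set E is the permutation sending each half-edge to the
   next one, counterclockwise, at the same vertex: its orbits are the vertices,
   and an orbit of size 1 is a one-valent vertex.  The orbits of the "turn
   left" permutation are the faces (each boundary walk keeps its face on the
   left).  One-valent and three-valent orbits, and connectedness, are required
   in [spine] below. *)
Definition fatgraph (E : finType) := {perm halfedge E}.

Section Fatgraph.
Context {E : finType}.
Implicit Types (G : fatgraph E) (h k : halfedge E).

Definition left_turn G : {perm halfedge E} := (opp E * G^-1)%g.
Definition right_turn G : {perm halfedge E} := (opp E * G)%g.

(* [pending_end G h]: h is attached to a one-valent vertex. *)
Definition pending_end G h : bool := G h == h.

Definition fg_connected G : Prop :=
  forall h k, connect (fun x y => (y == G x) || (y == opp E x)) h k.

(* G is a spine of the surface of genus g with s boundary components, the i-th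
   one carrying d i marked points.  A surface is determined by these numbers,
   so the embedding amounts to Euler's formula V - E + s = 2 - 2g and to the
   bijection b from boundary components to faces. *)
Definition spine (g s : nat) (d : 'I_s -> nat) G : Prop :=
  [/\ forall h, (#|porbit G h| == 1%N) || (#|porbit G h| == 3%N),
      fg_connected G,
      (#|porbits G| + s + 2 * g = #|E| + 2)%N
    & exists b : 'I_s -> {set halfedge E},
        [/\ injective b,
            [set b i | i : 'I_s]%SET = porbits (left_turn G)
          & forall i, #|[set h in b i | pending_end G h]%SET| = d i]].

(* Closed paths, as cyclic sequences of oriented edges.  At a three-valent
   vertex left_turn and right_turn give the two non-backtracking
   continuations; at a one-valent vertex both give the reversed edge. *)
Definition path_step G h k : bool := (k == left_turn G h) || (k == right_turn G h).

Definition closed_path G (p : seq (halfedge E)) : Prop :=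
  (p != [::]) && path.cycle (path_step G) p.

End Fatgraph.

Section Coordinates.
Context {R : realType}.

Definition mx2 (a b c d : R) : 'M[R]_2 :=
  \matrix_(i < 2, j < 2)
    if i == 0 then (if j == 0 then a else b) else (if j == 0 then c else d).

Definition X_mx (z : R) : 'M[R]_2 := mx2 0 (- expR (z / 2)) (expR (- z / 2)) 0.
Definition R_mx : 'M[R]_2 := mx2 1 1 (-1) 0.
Definition L_mx : 'M[R]_2 := mx2 0 1 (-1) (-1).
Definition F_mx : 'M[R]_2 := mx2 0 1 (-1) 0.

Definition phi (x : R) : R := ln (1 + expR x).

Section OneGraph.
Context {E : finType}.
Implicit Types (G : fatgraph E) (f : (E -> R) -> R) (Z : E -> R).

Definition turn_mx G (h k : halfedge E) : 'M[R]_2 :=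
  if pending_end G (opp E h) then F_mx
  else if k == left_turn G h then L_mx else R_mx.

(* A visit to a pending edge is the passage h to the one-valent vertex followed
   by the passage opp h, which contribute X_Z F X_Z.  foldl multiplies on the
   left, so the product is written from right to left along p. *)
Definition path_mx G (p : seq (halfedge E)) Z : 'M[R]_2 :=
  foldl (fun M hk => turn_mx G hk.1 hk.2 *m X_mx (Z hk.1.1) *m M)
        1%:M (zip p (rot 1 p)).

Definition geodesic_function G (p : seq (halfedge E)) : (E -> R) -> R :=
  fun Z => \tr (path_mx G p Z).

Definition pderiv (e : E) f : (E -> R) -> R :=
  fun Z => derive1 (fun t : R => f [eta Z with e |-> t]) (Z e).

Definition pwedge (a b : E) f1 f2 : (E -> R) -> R :=
  fun Z => pderiv a f1 Z * pderiv b f2 Z - pderiv b f1 Z * pderiv a f2 Z.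

Definition bracket G f1 f2 : (E -> R) -> R :=
  fun Z => \sum_(v in porbits G | #|v| == 3%N)
             \sum_(h in v) pwedge h.1 (G h).1 f1 f2 Z.

Definition poisson_subalgebra G (A : set ((E -> R) -> R)) : Prop :=
  [/\ forall c : R, A (cst c),
      forall f1 f2, A f1 -> A f2 -> A (f1 \+ f2),
      forall f1 f2, A f1 -> A f2 -> A (f1 \* f2)
    & forall f1 f2, A f1 -> A f2 -> A (bracket G f1 f2)].

(* [smallest C S] is the intersection of the sets satisfying C that contain S. *)
Definition geodesic_algebra G : set ((E -> R) -> R) :=
  smallest (poisson_subalgebra G) [set geodesic_function G p | p in closed_path G].

(* The edge of h joins the distinct three-valent vertices with counterclockwise
   orders (h, b, a) and (opp h, d, c); thus a, b, c, d are met in this order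
   clockwise around it, and a left turn leads from a to b and from c to d.  The
   flipped edge joins the vertices (h, a, d) and (opp h, c, b). *)
Definition inner_flip (h : halfedge E) G G' : Prop :=
  let h' := opp E h in
  let b := G h in let a := G b in
  let d := G h' in let c := G d in
  [/\ [/\ ~~ pending_end G h, ~~ pending_end G h' & h' \notin porbit G h],
      [/\ G' h = a, G' a = d & G' d = h],
      [/\ G' h' = c, G' c = b & G' b = h']
    & forall x, x \notin [:: h; a; b; h'; c; d] -> G' x = G x].

Definition inner_flip_map (h : halfedge E) G Z : E -> R :=
  let z := Z h.1 in
  let h' := opp E h in
  let b := G h in let a := G b in
  let d := G h' in let c := G d in
  fun e =>
    if e == h.1 then - z
    else Z e + phi z *+ (e == a.1) - phi (- z) *+ (e == b.1)
             + phi z *+ (e == c.1) - phi (- z) *+ (e == d.1).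

(* h is the end of a pending edge at its three-valent vertex, with
   counterclockwise order (h, y1, y2): coming from y1 the left turn leads to h
   and the right turn to y2. *)
Definition pending_flip (h : halfedge E) G G' : Prop :=
  let y1 := G h in let y2 := G y1 in
  [/\ pending_end G (opp E h), ~~ pending_end G h,
      [/\ G' h = y2, G' y2 = y1 & G' y1 = h]
    & forall x, x \notin [:: h; y1; y2] -> G' x = G x].

(* When y1 and y2 are the two ends of one loop, both contributions are added. *)
Definition pending_flip_map (h : halfedge E) G Z : E -> R :=
  let z := Z h.1 in
  let y1 := G h in let y2 := G y1 in
  fun e =>
    if e == h.1 then - z
    else Z e - phi (- (2 * z)) *+ (e == y1.1) + phi (2 * z) *+ (e == y2.1).

Inductive flips G : fatgraph E -> ((E -> R) -> (E -> R)) -> Prop :=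
| flips_nil : flips G G id
| flips_inner G1 G2 psi h :
    flips G G1 psi -> inner_flip h G1 G2 -> flips G G2 (inner_flip_map h G1 \o psi)
| flips_pending G1 G2 psi h :
    flips G G1 psi -> pending_flip h G1 G2 -> flips G G2 (pending_flip_map h G1 \o psi).

End OneGraph.

Section TwoGraphs.
Context {E1 E2 : finType}.

Definition fatgraph_iso (G1 : fatgraph E1) (G2 : fatgraph E2)
    (theta : halfedge E2 -> halfedge E1) : Prop :=
  [/\ bijective theta,
      forall h, theta (opp E2 h) = opp E1 (theta h)
    & forall h, theta (G2 h) = G1 (theta h)].

Definition relabel (theta : halfedge E2 -> halfedge E1) (Z : E1 -> R) : E2 -> R :=
  fun e => Z (theta (e, false)).1.

(* psi is the change of shear coordinates of a finite sequence of flips leading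
   from G1 to a copy of G2, which is then identified with G2. *)
Definition flip_chain (G1 : fatgraph E1) (G2 : fatgraph E2)
    (psi : (E1 -> R) -> (E2 -> R)) : Prop :=
  exists G psi0 theta,
    [/\ flips G1 G psi0, fatgraph_iso G G2 theta & psi = relabel theta \o psi0].

Definition poisson_isomorphism (G1 : fatgraph E1) (G2 : fatgraph E2)
    (Phi : ((E1 -> R) -> R) -> ((E2 -> R) -> R)) : Prop :=
  let A1 := geodesic_algebra G1 in
  [/\ set_bij A1 (geodesic_algebra G2) Phi,
      forall c : R, Phi (cst c) = cst c,
      forall f1 f2, A1 f1 -> A1 f2 -> Phi (f1 \+ f2) = Phi f1 \+ Phi f2,
      forall f1 f2, A1 f1 -> A1 f2 -> Phi (f1 \* f2) = Phi f1 \* Phi f2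
    & forall f1 f2, A1 f1 -> A1 f2 ->
        Phi (bracket G1 f1 f2) = bracket G2 (Phi f1) (Phi f2)].

End TwoGraphs.
End Coordinates.

(* Main.v *)
Require Import Defs.
From mathcomp Require Import all_boot all_order all_algebra all_fingroup.
From mathcomp Require Import all_classical all_reals all_analysis.
From mathcomp Require Import zify ring lra.
Require Import Defs.
Set Implicit Arguments.
Unset Strict Implicit.
Unset Printing Implicit Defensive.

(** Two facts give the theorem: every flip induces a Poisson isomorphism of the
    algebras of geodesic functions, and any two spines with the same genus, the
    same number of boundary components and the same total number of marked
    points are joined by flips.

    Flips act on the algebras ([inner_flip_poisson], [pending_flip_poisson]).
    Fix a flip and cut the closed paths at the half-edges that do not belong to
    the flipped edge.  Each passage through the region of the flip has a unique
    partner passage in the flipped graph, and the two matrices agree once the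
    shift of each neighbouring coordinate is split between the two ends of its
    edge ([flip_matrices], [transfer_closed_path]).  Hence composing with the
    change of coordinates maps the generators of one algebra onto those of the
    other.  The bracket is preserved by the chain rule and an identity between
    the wedges at the vertices of the region ([inner_wedge_sum],
    [pending_wedge_sum]).  A pending edge with coordinate Z crosses like an edge
    with coordinate 2 Z ([X_F_X]), so the same matrix identities serve both
    kinds of flips.

    Flips connect the spines ([flip_connected]).  Cut the surface along the
    edges outside a spanning tree of the three-valent vertices: what is left is
    a polygon, and the leaves of the tree, read in cyclic order, form a word in
    which every letter either is paired with its opposite or is pending
    ([has_word]).  Inner flips give the tree any shape ([reshape_shape]), so
    the cyclic word is all that matters.  A pending flip exchanges a pending
    letter with a neighbour ([has_word_pending]): this is what lets marked
    points travel from one boundary component to another.  Trading an edge of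
    the tree for a paired letter a cuts and pastes the polygon: the two arcs
    between a and its opposite may be rotated independently
    ([has_word_chord]).  As in the classification of surfaces, these moves bring
    every word to the form

      (a a') ... (a a')  (a b a' b') ... (a b a' b')  p ... p

    ([reach_normal_word]).  The pending letters are counted by the marked
    points, the blocks (a a') by the faces minus one ([card_faces]), the rest by
    the number of edges; and graphs with the same normal word and trees of the
    same shape are isomorphic ([spanning_iso]).  Flips are invertible and can be
    carried along isomorphisms, so two graphs with the same normal form are
    joined by flips. *)

(** * Half-edges and cubic fatgraphs *)
Section Basics.
Context {E : finType}.
Implicit Types (G : fatgraph E) (x y h : halfedge E).

Lemma oppE x : opp E x = (x.1, ~~ x.2).
Proof. by rewrite permE. Qed.

Lemma oppK : involutive (opp E).
Proof. by move=> [e b]; rewrite !oppE /= negbK. Qed.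

Lemma opp_fst x : (opp E x).1 = x.1.
Proof. by rewrite oppE. Qed.

Lemma opp_neq x : opp E x != x.
Proof. by case: x => e b; rewrite oppE xpair_eqE eqxx /=; case: b. Qed.

Lemma opp_eq x y : (opp E x == y) = (x == opp E y).
Proof. by rewrite -{1}[y]oppK (inj_eq perm_inj). Qed.

Lemma same_edge x y : (x.1 == y.1) = (x == y) || (x == opp E y).
Proof.
case: x y => [e b] [e' b']; rewrite oppE !xpair_eqE /=.
by case: eqP => // _; case: b b' => [] [].
Qed.

(** The vertices of such a fatgraph are one-valent or three-valent; this equation is
    much easier to transport than the sizes of orbits. *)
Definition cubic G : Prop := forall h, G (G (G h)) = h.

Lemma cubic_of_porbit G :
  (forall h, (#|porbit G h| == 1%N) || (#|porbit G h| == 3%N)) -> cubic G.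
Proof.
move=> HG h; have := iter_porbit G h.
by case/orP: (HG h) => /eqP -> //= e; rewrite !e.
Qed.

Section Cubic.
Variables (G : fatgraph E) (cG : cubic G).

Lemma cubicV x : (G^-1)%g x = G (G x).
Proof. by rewrite -{1}[x]cG permK. Qed.

Lemma left_turnE x : left_turn G x = G (G (opp E x)).
Proof. by rewrite permM cubicV. Qed.

Lemma right_turnE x : right_turn G x = G (opp E x).
Proof. by rewrite permM. Qed.

Lemma porbit_cubic x y : (y \in porbit G x) = (y \in [:: x; G x; G (G x)]).
Proof.
apply/porbitP/idP => [[i ->]|].
  elim: i => [|i]; first by rewrite perm1 inE eqxx.
  rewrite expgSr permM !inE; case/or3P=> /eqP ->.
  - by rewrite eqxx orbT.
  - by rewrite eqxx !orbT.
  - by rewrite cG eqxx.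
rewrite !inE => /or3P [] /eqP ->.
- by exists 0%N; rewrite perm1.
- by exists 1%N; rewrite expg1.
- by exists 2%N; rewrite expgS expg1 permM.
Qed.

Lemma cubic_uniq x : G x != x -> uniq [:: x; G x; G (G x)].
Proof.
move=> nx; rewrite /= !inE negb_or -andbA andbT eq_sym nx /=.
have e y : G y = y -> G (G y) = y by move=> ?; congruence.
apply/andP; split; apply/eqP => hx.
  by move: nx; rewrite {1}hx cG eqxx.
by move/perm_inj: hx => hx; move: nx; rewrite -hx eqxx.
Qed.

End Cubic.

Definition cyc3 (x y z : halfedge E) : {perm halfedge E} :=
  (tperm x y * tperm x z)%g.

Lemma cyc3P x y z : uniq [:: x; y; z] ->
  [/\ cyc3 x y z x = y, cyc3 x y z y = z, cyc3 x y z z = x &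
      forall t, t \notin [:: x; y; z] -> cyc3 x y z t = t].
Proof.
rewrite /= !inE negb_or andbT => /andP [/andP [xy xz] yz].
rewrite /cyc3; split; rewrite ?permM.
- by rewrite tpermL tpermD // eq_sym.
- by rewrite tpermR tpermL.
- by rewrite (tpermD xz yz) tpermR.
- move=> t; rewrite !inE !negb_or => /and3P [tx ty tz].
  by rewrite permM !tpermD // eq_sym.
Qed.

(** The order is that of [inner_flip], which lists the half-edges h, a, b, h', c, d. *)
Definition region (G : fatgraph E) h : seq (halfedge E) :=
  let h' := opp E h in [:: h; G (G h); G h; h'; G (G h'); G h'].

Lemma region_uniq G h : cubic G -> ~~ pending_end G h ->
  ~~ pending_end G (opp E h) -> opp E h \notin porbit G h -> uniq (region G h).
Proof.
move=> cG p1 p2; rewrite porbit_cubic // => ni.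
have u1 := cubic_uniq cG p1; have u2 := cubic_uniq cG p2.
have : uniq ([:: h; G h; G (G h)] ++
             [:: opp E h; G (opp E h); G (G (opp E h))]).
  rewrite cat_uniq u1 u2 andbT -all_predC /= ni /= andbT.
  have k y : y \notin [:: h; G h; G (G h)] -> G y \notin [:: h; G h; G (G h)].
    apply: contra; rewrite !inE => /or3P [] /eqP e.
    - by rewrite (perm_inj (etrans e (esym (cG h)))) eqxx !orbT.
    - by rewrite (perm_inj e) eqxx.
    - by rewrite (perm_inj e) eqxx orbT.
  by rewrite k // k ?k.
move=> u; rewrite (perm_uniq (s2 := [:: h; G h; G (G h)] ++
             [:: opp E h; G (opp E h); G (G (opp E h))])) //.
rewrite /region /= perm_cons -[X in perm_eq X _]/([:: _] ++ [:: _] ++ _).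
by rewrite perm_catCA /= !perm_cons -[X in perm_eq X _]/([:: _] ++ [:: _] ++ _) perm_catCA.
Qed.

End Basics.

(** * Flips of cubic fatgraphs *)
Section Flips.
Context {E : finType}.
Implicit Types (G : fatgraph E) (x y h a b c d : halfedge E).

Lemma closed_notin G (L : seq (halfedge E)) x :
  {subset L <= map G L} -> x \notin L -> G x \notin L.
Proof.
move=> sL; apply: contra => /sL /mapP [y yL /perm_inj ->]; exact: yL.
Qed.

(** An inner flip with its six half-edges named and all the values of both graphs
    spelled out, so that claims about flips reduce to cases on six variables. *)
Definition inner_data h a b c d G G' : Prop :=
  let h' := opp E h in
  [/\ uniq [:: h; a; b; h'; c; d],
      [/\ G h = b, G b = a & G a = h] /\ [/\ G h' = d, G d = c & G c = h'],
      [/\ G' h = a, G' a = d & G' d = h] /\ [/\ G' h' = c, G' c = b & G' b = h']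
    & forall x, x \notin [:: h; a; b; h'; c; d] -> G' x = G x].

Lemma inner_flip_data G G' h : cubic G -> inner_flip h G G' ->
  inner_data h (G (G h)) (G h) (G (G (opp E h))) (G (opp E h)) G G'.
Proof.
move=> cG [[p1 p2 p3] f1 f2 f3].
by split=> //; exact: region_uniq.
Qed.

Lemma inner_data_flip G G' h a b c d : cubic G ->
  inner_data h a b c d G G' -> inner_flip h G G'.
Proof.
move=> cG [u [[e1 e2 e3] [e4 e5 e6]] [[f1 f2 f3] [f4 f5 f6]] fr].
rewrite /inner_flip !(e1, e2, e3, e4, e5, e6); split=> //.
move: u; rewrite /= !inE !negb_or => /and5P [/and5P [n1 n2 n3 n4 n5] /and4P [n6 n7 n8 n9]] /and3P [n10 n11 n12] /andP [n13 n14] /andP [n15 _].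
rewrite /pending_end porbit_cubic // e1 e2 e4 !inE !negb_or.
by rewrite !(eq_sym _ h) n2 [opp E h == a]eq_sym n7 n3 [opp E h == b]eq_sym n10 eq_sym n14.
Qed.

Lemma inner_data_closed G G' h a b c d : inner_data h a b c d G G' ->
  forall x, x \notin [:: h; a; b; opp E h; c; d] -> G x \notin [:: h; a; b; opp E h; c; d].
Proof.
move=> [u [[e1 e2 e3] [e4 e5 e6]] _ _] x; apply: closed_notin.
by move=> y /=; rewrite !(e1, e2, e3, e4, e5, e6) !inE; do !case: (y == _) => //=.
Qed.

Ltac case_region := rewrite ?inE => /or4P [|||/or3P []] /eqP ->.

Lemma inner_data_cubic G G' h a b c d : cubic G -> inner_data h a b c d G G' -> cubic G'.
Proof.
move=> cG D; have cl := inner_data_closed D.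
case: D => [u [[e1 e2 e3] [e4 e5 e6]] [[f1 f2 f3] [f4 f5 f6]] fr] x.
case: (boolP (x \in [:: h; a; b; opp E h; c; d])).
  by case_region; rewrite !(f1, f2, f3, f4, f5, f6).
by move=> nx; rewrite !fr ?cl // ?fr ?cl.
Qed.

Lemma inner_data_fix G G' h a b c d : inner_data h a b c d G G' ->
  forall x, (G' x == x) = (G x == x).
Proof.
case=> [u [[e1 e2 e3] [e4 e5 e6]] [[f1 f2 f3] [f4 f5 f6]] fr] x.
case: (boolP (x \in [:: h; a; b; opp E h; c; d])); last by move=> nx; rewrite fr.
move: u; rewrite /= !inE !negb_or => /and5P [/and5P [n1 n2 n3 n4 n5] /and4P [n6 n7 n8 n9]] /and3P [n10 n11 n12] /andP [n13 n14] /andP [n15 _].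
have ne (y z : halfedge E) : y != z -> ((y == z) = false) * ((z == y) = false).
  by rewrite [z == y]eq_sym => /negbTE ->.
by case_region; rewrite !(f1, f2, f3, f4, f5, f6, e1, e2, e3, e4, e5, e6);
  rewrite !(ne _ _ n1, ne _ _ n2, ne _ _ n3, ne _ _ n4, ne _ _ n5, ne _ _ n6, ne _ _ n7, ne _ _ n8, ne _ _ n9, ne _ _ n10, ne _ _ n11, ne _ _ n12, ne _ _ n13, ne _ _ n14, ne _ _ n15).
Qed.

(** The flipped graph is G preceded by two 3-cycles. *)
Lemma inner_data_ex G h a b c d : uniq [:: h; a; b; opp E h; c; d] ->
  G h = b -> G b = a -> G a = h -> G (opp E h) = d -> G d = c -> G c = opp E h ->
  exists G', inner_data h a b c d G G'.
Proof.
move=> u e1 e2 e3 e4 e5 e6.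
have u0 := u; move: u; rewrite /= !inE !negb_or => /and5P [/and5P [n1 n2 n3 n4 n5] /and4P [n6 n7 n8 n9]] /and3P [n10 n11 n12] /andP [n13 n14] /andP [n15 _].
have ne (y z : halfedge E) : y != z -> ((y == z) = false) * ((z == y) = false).
  by rewrite [z == y]eq_sym => /negbTE ->.
have u1 : uniq [:: h; b; c] by rewrite /= !inE !(ne _ _ n1, ne _ _ n2, ne _ _ n3, ne _ _ n4, ne _ _ n5, ne _ _ n6, ne _ _ n7, ne _ _ n8, ne _ _ n9, ne _ _ n10, ne _ _ n11, ne _ _ n12, ne _ _ n13, ne _ _ n14, ne _ _ n15).
have u2 : uniq [:: a; opp E h; d] by rewrite /= !inE !(ne _ _ n1, ne _ _ n2, ne _ _ n3, ne _ _ n4, ne _ _ n5, ne _ _ n6, ne _ _ n7, ne _ _ n8, ne _ _ n9, ne _ _ n10, ne _ _ n11, ne _ _ n12, ne _ _ n13, ne _ _ n14, ne _ _ n15).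
have [s1 s2 s3 s4] := cyc3P u1; have [t1 t2 t3 t4] := cyc3P u2.
exists (cyc3 h b c * cyc3 a (opp E h) d * G)%g.
have M y : (cyc3 h b c * cyc3 a (opp E h) d * G)%g y =
    G (cyc3 a (opp E h) d (cyc3 h b c y)) by rewrite permM [X in G X]permM.
split=> //.
  have t4' y : y \in [:: h; b; c] -> cyc3 a (opp E h) d y = y.
    by move=> yi; apply: t4; move: yi; rewrite !inE => /or3P [] /eqP ->; rewrite !(ne _ _ n1, ne _ _ n2, ne _ _ n3, ne _ _ n4, ne _ _ n5, ne _ _ n6, ne _ _ n7, ne _ _ n8, ne _ _ n9, ne _ _ n10, ne _ _ n11, ne _ _ n12, ne _ _ n13, ne _ _ n14, ne _ _ n15).
  have s4' y : y \in [:: a; opp E h; d] -> cyc3 h b c y = y.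
    by move=> yi; apply: s4; move: yi; rewrite !inE => /or3P [] /eqP ->; rewrite !(ne _ _ n1, ne _ _ n2, ne _ _ n3, ne _ _ n4, ne _ _ n5, ne _ _ n6, ne _ _ n7, ne _ _ n8, ne _ _ n9, ne _ _ n10, ne _ _ n11, ne _ _ n12, ne _ _ n13, ne _ _ n14, ne _ _ n15).
  split; split; rewrite M.
  - by rewrite s1 t4' ?inE ?eqxx ?orbT.
  - by rewrite s4' ?t1 ?inE ?eqxx.
  - by rewrite s4' ?t3 ?inE ?eqxx ?orbT.
  - by rewrite s4' ?t2 ?inE ?eqxx ?orbT.
  - by rewrite s3 t4' ?inE ?eqxx.
  - by rewrite s2 t4' ?inE ?eqxx ?orbT.
move=> x; rewrite M !inE !negb_or => /and5P [m1 m2 m3 m4 /andP [m5 m6]].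
by rewrite s4 ?t4 // !inE !negb_or ?m1 ?m2 ?m3 ?m4 ?m5.
Qed.

Definition pending_data h y z G G' : Prop :=
  [/\ uniq [:: h; y; z], G (opp E h) = opp E h,
      [/\ G h = y, G y = z & G z = h], [/\ G' h = z, G' z = y & G' y = h]
    & forall x, x \notin [:: h; y; z] -> G' x = G x].

Lemma pending_flip_data G G' h : cubic G -> pending_flip h G G' ->
  pending_data h (G h) (G (G h)) G G'.
Proof.
move=> cG [/eqP p1 p2 f1 fr]; by split=> //; exact: cubic_uniq.
Qed.

Lemma pending_data_flip G G' h y z : pending_data h y z G G' -> pending_flip h G G'.
Proof.
move=> [u p [e1 e2 e3] f fr]; rewrite /pending_flip e1 e2 /pending_end p e1 eqxx; split=> //.
by move: u => /= /andP []; rewrite inE negb_or eq_sym => /andP [].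
Qed.

Lemma pending_data_closed G G' h y z : pending_data h y z G G' ->
  forall x, x \notin [:: h; y; z] -> G x \notin [:: h; y; z].
Proof.
move=> [u _ [e1 e2 e3] _ _] x; apply: closed_notin.
by move=> t /=; rewrite !(e1, e2, e3) !inE; do !case: (t == _) => //=.
Qed.

Lemma pending_data_opp G G' h y z : pending_data h y z G G' ->
  opp E h \notin [:: h; y; z].
Proof.
move=> [u p [e1 e2 e3] _ _].
move: u; rewrite /= !inE !negb_or => /andP [/andP [n1 n2]] /andP [n3 _].
rewrite opp_neq /=; apply/andP; split; apply: contraNneq n3 => eo; move: p; rewrite eo.
  by rewrite e2 => ->.
by rewrite e3 => e; move: n2; rewrite e eqxx.
Qed.

Lemma pending_data_cubic G G' h y z : cubic G -> pending_data h y z G G' -> cubic G'.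
Proof.
move=> cG D; have cl := pending_data_closed D.
case: D => [u p [e1 e2 e3] [f1 f2 f3] fr] x.
case: (boolP (x \in [:: h; y; z])).
  by rewrite !inE => /or3P [] /eqP ->; rewrite !(f1, f2, f3).
by move=> nx; rewrite !fr ?cl // ?fr ?cl.
Qed.

Lemma pending_data_fix G G' h y z : pending_data h y z G G' ->
  forall x, (G' x == x) = (G x == x).
Proof.
case=> [u p [e1 e2 e3] [f1 f2 f3] fr] x.
case: (boolP (x \in [:: h; y; z])); last by move=> nx; rewrite fr.
move: u; rewrite /= !inE !negb_or => /andP [/andP [n1 n2]] /andP [n3 _].
have ne (s t : halfedge E) : s != t -> ((s == t) = false) * ((t == s) = false).
  by rewrite [t == s]eq_sym => /negbTE ->.
by rewrite ?inE => /or3P [] /eqP ->; rewrite !(f1, f2, f3, e1, e2, e3) !(ne _ _ n1, ne _ _ n2, ne _ _ n3).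
Qed.

Lemma pending_data_ex G h y z : uniq [:: h; y; z] -> G (opp E h) = opp E h ->
  G h = y -> G y = z -> G z = h -> exists G', pending_data h y z G G'.
Proof.
move=> u p e1 e2 e3; have [s1 s2 s3 s4] := cyc3P u.
have M x : (cyc3 h y z * G)%g x = G (cyc3 h y z x) by rewrite permM.
exists (cyc3 h y z * G)%g; split=> //; rewrite ?M ?s1 ?s2 ?s3 //.
by move=> x nx; rewrite M s4.
Qed.

Definition flip_step G G' : Prop :=
  (exists h, inner_flip h G G') \/ (exists h, pending_flip h G G').

Inductive flip_path G : fatgraph E -> Prop :=
| flip_path_refl : flip_path G G
| flip_path_step G1 G2 : flip_path G G1 -> flip_step G1 G2 -> flip_path G G2.

Lemma flip_path1 G G' : flip_step G G' -> flip_path G G'.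
Proof. by move=> s; apply: flip_path_step s; apply: flip_path_refl. Qed.

Lemma flip_path_trans G1 G2 G3 : flip_path G1 G2 -> flip_path G2 G3 -> flip_path G1 G3.
Proof. by move=> p; elim=> [|H1 H2 _ IH s] //; apply: flip_path_step IH s. Qed.

Lemma flip_step_cubic G G' : cubic G -> flip_step G G' -> cubic G'.
Proof.
move=> cG [] [h] f; first exact: inner_data_cubic (inner_flip_data cG f).
exact: pending_data_cubic (pending_flip_data cG f).
Qed.

Lemma flip_step_fix G G' : cubic G -> flip_step G G' ->
  forall x, (G' x == x) = (G x == x).
Proof.
move=> cG [] [h] f; first exact: inner_data_fix (inner_flip_data cG f).
exact: pending_data_fix (pending_flip_data cG f).
Qed.

Lemma flip_path_cubic G G' : cubic G -> flip_path G G' -> cubic G'.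
Proof. by move=> cG; elim=> // H1 H2 _ c s; exact: flip_step_cubic s. Qed.

Lemma flip_path_fix G G' : cubic G -> flip_path G G' ->
  forall x, (G' x == x) = (G x == x).
Proof.
move=> cG; elim=> // H1 H2 p IH s x.
by rewrite (flip_step_fix (flip_path_cubic cG p) s).
Qed.

(** The flip of a pending edge is an involution.  The flip of an inner edge turns
    that edge by a right angle, so four flips restore the graph and three undo one. *)
Lemma flip_step_inv G G' : cubic G -> flip_step G G' -> flip_path G' G.
Proof.
move=> cG [] [h] f; last first.
  have D := pending_flip_data cG f; apply: flip_path1; right; exists h.
  have n := pending_data_opp D; case: D => u p e1 e2 fr.
  apply: (@pending_data_flip _ _ _ (G (G h)) (G h)); split=> //.
  - by move: u; rewrite /= !inE !negb_or [G h == _]eq_sym => /andP [/andP [-> ->] ->].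
  - by rewrite fr.
  - by move=> x nx; rewrite fr //; move: nx; rewrite !inE !negb_or => /and3P [-> -> ->].
have D0 := inner_flip_data cG f; move: D0.
set a := G (G h); set b := G h; set c := G (G (opp E h)); set d := G (opp E h).
move=> D0; have c1 := inner_data_cubic cG D0.
case: (D0) => [u0 [[e1 e2 e3] [e4 e5 e6]] [[f1 f2 f3] [f4 f5 f6]] fr].
have P (L1 L2 : seq (halfedge E)) : perm_eq L1 L2 -> uniq L1 -> uniq L2 by move=> /perm_uniq ->.
have pe a' b' c' d' : perm_eq [:: h; a'; b'; opp E h; c'; d'] [:: h; d'; a'; opp E h; b'; c'].
  apply/seq.permP => q /=; rewrite !addn0; congr addn.
  by rewrite [RHS]addnC -!addnA; congr addn; rewrite addnCA.
have u1 := P _ _ (pe _ _ _ _) u0; have u2 := P _ _ (pe _ _ _ _) u1.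
have u3 := P _ _ (pe _ _ _ _) u2.
(* Each flip shifts the names a, b, c, d by one place. *)
have [G2 D1] := inner_data_ex u1 f1 f2 f3 f4 f5 f6.
have c2 := inner_data_cubic c1 D1.
case: (D1) => _ _ [[g1 g2 g3] [g4 g5 g6]] gr.
have [G3 D2] := inner_data_ex u2 g1 g2 g3 g4 g5 g6.
have c3 := inner_data_cubic c2 D2.
case: (D2) => _ _ [[k1 k2 k3] [k4 k5 k6]] kr.
have D3 : inner_data h b c d a G3 G.
  split=> // x nx.
  have nx1 := nx; rewrite (perm_mem (pe _ _ _ _)) in nx1.
  have nx2 := nx1; rewrite (perm_mem (pe _ _ _ _)) in nx2.
  have nx3 := nx2; rewrite (perm_mem (pe _ _ _ _)) in nx3.
  by rewrite kr ?gr ?fr.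
apply: (@flip_path_step _ G3).
  apply: (@flip_path_step _ G2).
    by apply: flip_path1; left; exists h; apply: inner_data_flip D1.
  by left; exists h; apply: inner_data_flip D2.
by left; exists h; apply: inner_data_flip D3.
Qed.

Lemma flip_path_sym G G' : cubic G -> flip_path G G' -> flip_path G' G.
Proof.
move=> cG; elim=> [|H1 H2 p IH s]; first exact: flip_path_refl.
exact: flip_path_trans (flip_step_inv (flip_path_cubic cG p) s) IH.
Qed.

End Flips.

(** * Flips preserve the number of faces *)
Section Retract.
Variables (T : finType) (f f' : {perm T}) (K : {pred T}) (r : T -> T).

Lemma porbit_step x : porbit f (f x) = porbit f x.
Proof. by apply/eqP; rewrite eq_porbit_mem -{1}[f]expg1 mem_porbit. Qed.

(** If the orbits of f meet K, a retraction onto K along which one step of f' stays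
    in an f-orbit sends the orbits of f' onto those of f.  A flip only changes at
    which place of its face the flipped edge is visited, so K will be the set of
    half-edges outside that edge. *)
Lemma card_porbits_retract :
  (forall x, exists2 y, y \in K & porbit f y = porbit f x) ->
  {in K, forall x, r x = x} ->
  (forall x, porbit f (r (f' x)) = porbit f (r x)) ->
  (#|porbits f| <= #|porbits f'|)%N.
Proof.
move=> Kf rK Hr.
pose F (O : {set T}) := if [pick z in O] is Some z then porbit f (r z) else finset.set0.
apply: leq_trans (leq_imset_card F _); apply/subset_leq_card/fintype.subsetP => O.
move=> /imsetP [x _ ->]; have [y Ky <-] := Kf x; apply/imsetP.
exists (porbit f' y); first exact: imset_f.
rewrite /F; case: pickP => [z|/(_ y)]; last by rewrite porbit_id.
move=> /porbitP [n ->]; elim: n => [|n IH]; first by rewrite perm1 rK.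
by rewrite expgSr permM Hr.
Qed.

End Retract.

Section Faces.
Context {E : finType}.
Implicit Types (G : fatgraph E) (x y h a b c d : halfedge E).

Lemma inner_data_faces G G' h a b c d : cubic G -> inner_data h a b c d G G' ->
  (#|porbits (left_turn G)| <= #|porbits (left_turn G')|)%N.
Proof.
move=> cG D; have cG' := inner_data_cubic cG D; have cl := inner_data_closed D.
case: D => [u0 [[e1 e2 e3] [e4 e5 e6]] [[f1 f2 f3] [f4 f5 f6]] fr].
have u := u0; move: u; rewrite /= !inE !negb_or => /and5P [/and5P [n1 n2 n3 n4 n5] /and4P [n6 n7 n8 n9]] /and3P [n10 n11 n12] /andP [n13 n14] /andP [n15 _].
have ne (y z : halfedge E) : y != z -> ((y == z) = false) * ((z == y) = false).
  by rewrite [z == y]eq_sym => /negbTE ->.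
pose h' := opp E h.
(* Both halves of the flipped edge are sent to their successors in the new faces. *)
pose r x := if x == h then b else if x == h' then d else x.
have rh : r h = b by rewrite /r eqxx.
have rh' : r h' = d by rewrite /r (negbTE (opp_neq _)) eqxx.
have rK x : x != h -> x != h' -> r x = x by rewrite /r => /negbTE -> /negbTE ->.
have ps := @porbit_step _ (left_turn G).
apply: (@card_porbits_retract _ _ _ (fun x => (x != h) && (x != h')) r).
- move=> x; have [->|xh] := eqVneq x h.
    exists c; last by rewrite -[in RHS]ps left_turnE // e4 e5.
    by rewrite unfold_in /h' !(ne _ _ n4, ne _ _ n13).
  have [->|xh'] := eqVneq x h'.
    exists a; last by rewrite -[in RHS]ps left_turnE // oppK e1 e2.
    by rewrite unfold_in /h' !(ne _ _ n1, ne _ _ n7).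
  by exists x => //; rewrite unfold_in xh xh'.
- by move=> x /andP [] /rK; apply.
- move=> x; rewrite left_turnE //.
  have ox y : opp E x = y -> x = opp E y by move<-; rewrite oppK.
  case: (boolP (opp E x \in [:: h; a; b; opp E h; c; d])) => [|nx].
    rewrite !inE => /or4P [|||/or3P []] /eqP e; rewrite e !(f1, f2, f3, f4, f5, f6) (ox _ e).
    + by rewrite rh' rK // /h' !(ne _ _ n5, ne _ _ n14).
    + rewrite rh rK; last first.
      * by rewrite /h' (inj_eq perm_inj) !(ne _ _ n1).
      * by rewrite opp_eq !(ne _ _ n7).
      by rewrite -[in RHS]ps left_turnE // oppK e3 e1.
    + rewrite !rK; first 1 last.
      * by rewrite opp_eq !(ne _ _ n10).
      * by rewrite /h' (inj_eq perm_inj) !(ne _ _ n2).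
      * by rewrite !(ne _ _ n4).
      * by rewrite /h' !(ne _ _ n13).
      by rewrite -[in RHS]ps -[in RHS]ps !left_turnE // oppK e2 e3 e4 e5.
    + by rewrite oppK rh rK // /h' !(ne _ _ n2, ne _ _ n10).
    + rewrite rh' rK; last first.
      * by rewrite /h' (inj_eq perm_inj) !(ne _ _ n4).
      * by rewrite opp_eq !(ne _ _ n13).
      by rewrite -[in RHS]ps left_turnE // oppK e6 e4.
    + rewrite !rK; first 1 last.
      * by rewrite opp_eq !(ne _ _ n14).
      * by rewrite /h' (inj_eq perm_inj) !(ne _ _ n5).
      * by rewrite !(ne _ _ n1).
      * by rewrite /h' !(ne _ _ n7).
      by rewrite -[in RHS]ps -[in RHS]ps !left_turnE // oppK e5 e6 oppK e1 e2.
  have nfx := cl _ (cl _ nx).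
  rewrite !fr ?cl // -left_turnE // rK ?ps ?rK //.
  + by apply: contraNneq nx => ->; rewrite !inE eqxx !orbT.
  + by apply: contraNneq nx => ->; rewrite oppK !inE eqxx.
  + by apply: contraNneq nfx; rewrite left_turnE // => ->; rewrite !inE eqxx.
  + by apply: contraNneq nfx; rewrite left_turnE // => ->; rewrite !inE eqxx !orbT.
Qed.

Lemma pending_data_faces G G' h y z : cubic G -> pending_data h y z G G' ->
  (#|porbits (left_turn G)| <= #|porbits (left_turn G')|)%N.
Proof.
move=> cG D; have cG' := pending_data_cubic cG D; have cl := pending_data_closed D.
have no := pending_data_opp D.
case: D => [u p [e1 e2 e3] [f1 f2 f3] fr].
move: u; rewrite /= !inE !negb_or => /andP [/andP [n1 n2]] /andP [n3 _].
have ne (s t : halfedge E) : s != t -> ((s == t) = false) * ((t == s) = false).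
  by rewrite [t == s]eq_sym => /negbTE ->.
have := no; rewrite !inE !negb_or => /and3P [m1 m2 m3].
pose h' := opp E h.
(* In the new graph h and then its opposite precede y in their face. *)
pose r x := if x == h then y else if x == h' then y else x.
have rh : r h = y by rewrite /r eqxx.
have rh' : r h' = y by rewrite /r (negbTE (opp_neq _)) eqxx.
have rK x : x != h -> x != h' -> r x = x by rewrite /r => /negbTE -> /negbTE ->.
have ps := @porbit_step _ (left_turn G).
have lh : left_turn G h = h' by rewrite left_turnE // !p.
have lh' : left_turn G h' = z by rewrite left_turnE // oppK e1 e2.
apply: (@card_porbits_retract _ _ _ (fun x => (x != h) && (x != h')) r).
- move=> x; have [->|xh] := eqVneq x h.
    exists z; last by rewrite -lh' -lh !ps.
    by rewrite unfold_in /h' !(ne _ _ m3, ne _ _ n2).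
  have [->|xh'] := eqVneq x h'.
    exists z; last by rewrite -lh' ps.
    by rewrite unfold_in /h' !(ne _ _ m3, ne _ _ n2).
  by exists x => //; rewrite unfold_in xh xh'.
- by move=> x /andP [] /rK; apply.
- move=> x; rewrite left_turnE //.
  have ox t : opp E x = t -> x = opp E t by move<-; rewrite oppK.
  case: (boolP (opp E x \in [:: h; y; z])) => [|nx].
    rewrite !inE => /or3P [] /eqP e; rewrite e !(f1, f2, f3) (ox _ e).
    + by rewrite rh' rK // /h' !(ne _ _ n1, ne _ _ m2).
    + rewrite !rK; first 1 last.
      * by rewrite opp_eq !(ne _ _ m2).
      * by rewrite /h' (inj_eq perm_inj) !(ne _ _ n1).
      * by rewrite !(ne _ _ n2).
      * by rewrite /h' !(ne _ _ m3).
      by rewrite -[in RHS]ps left_turnE // oppK e2 e3 -lh' -lh !ps.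
    + rewrite rh rK; last first.
      * by rewrite /h' (inj_eq perm_inj) !(ne _ _ n2).
      * by rewrite opp_eq !(ne _ _ m3).
      by rewrite -[in RHS]ps left_turnE // oppK e3 e1.
  have [->|xh] := eqVneq x h.
    by rewrite !fr ?p // rh rh'.
  have nfx := cl _ (cl _ nx).
  rewrite !fr ?cl // -left_turnE // rK ?ps ?rK //.
  + by apply: contraNneq nx => ->; rewrite oppK !inE eqxx.
  + by apply: contraNneq nfx; rewrite left_turnE // => ->; rewrite !inE eqxx.
  + apply: contraNneq xh; rewrite left_turnE // => e.
    by apply/eqP/(@perm_inj _ (opp E))/(@perm_inj _ G)/(@perm_inj _ G); rewrite e !p.
Qed.

Lemma flip_path_faces_le G G' : cubic G -> flip_path G G' ->
  (#|porbits (left_turn G)| <= #|porbits (left_turn G')|)%N.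
Proof.
move=> cG; elim=> // H1 H2 p IH s; apply: leq_trans IH _.
have c1 := flip_path_cubic cG p.
case: s => [] [h] f; first exact: inner_data_faces (inner_flip_data c1 f).
exact: pending_data_faces (pending_flip_data c1 f).
Qed.

(** One inequality per flip suffices, because flips can be undone. *)
Lemma flip_path_faces G G' : cubic G -> flip_path G G' ->
  #|porbits (left_turn G)| = #|porbits (left_turn G')|.
Proof.
move=> cG p; apply/eqP; rewrite eqn_leq flip_path_faces_le //=.
exact: flip_path_faces_le (flip_path_cubic cG p) (flip_path_sym cG p).
Qed.

End Faces.

(** * Flips along isomorphisms *)
Section Transport.
Context {E1 E2 : finType}.
Implicit Types (G : fatgraph E1) (H : fatgraph E2) (theta : halfedge E2 -> halfedge E1).

Lemma iso_copy theta H : bijective theta ->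
  exists G : fatgraph E1, forall h, theta (H h) = G (theta h).
Proof.
move=> [theta' K1 K2].
have inj : injective (fun x => theta (H (theta' x))).
  by move=> x y /(can_inj K1) /perm_inj /(can_inj K2).
by exists (perm inj) => h; rewrite permE /= K1.
Qed.

(** Every flip of a graph is matched by the flip of an isomorphic graph, through the
    same isomorphism. *)
Lemma iso_step theta G H H' : fatgraph_iso G H theta -> flip_step H H' ->
  exists2 G', flip_step G G' & fatgraph_iso G' H' theta.
Proof.
move=> [bt to tG] s; have [G' tG'] := iso_copy H' bt.
have [theta' K1 K2] := bt.
exists G' => //.
have nin x (L : seq (halfedge E2)) :
    x \notin map theta L -> exists2 y, x = theta y & y \notin L.
  move=> nx; exists (theta' x); first by rewrite K2.
  by apply: contra nx => /(map_f theta); rewrite K2.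
case: s => [] [h p]; [left|right]; exists (theta h).
  case: p => [[p1 p2 p3] [q1 q2 q3] [q4 q5 q6] fr].
  split; rewrite -?to -?tG -?tG' -?to -?tG ?q1 ?q2 ?q3 ?q4 ?q5 ?q6 //.
    rewrite /pending_end -?to -?tG -?to -?tG !(inj_eq (can_inj K1)); split=> //.
    apply: contra p3 => /porbitP [i e]; apply/porbitP; exists i.
    apply: (can_inj K1); rewrite e; elim: i {e} => [|i IH]; first by rewrite !perm1.
    by rewrite !expgSr !permM IH tG.
  move=> x; rewrite -?to -?tG -?to -?tG -[[:: theta _; _; _; _; _; _]]/(map theta [:: _; _; _; _; _; _]).
  by move=> /nin [y -> ny]; rewrite -tG -tG' fr.
case: p => [p1 p2 [q1 q2 q3] fr].
split; rewrite -?to -?tG -?tG' ?q1 ?q2 ?q3 //.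
- by rewrite /pending_end -tG (inj_eq (can_inj K1)).
- by rewrite /pending_end -tG (inj_eq (can_inj K1)).
move=> x; rewrite -?tG -?tG -[[:: theta _; _; _]]/(map theta [:: _; _; _]).
by move=> /nin [y -> ny]; rewrite -tG -tG' fr.
Qed.

Lemma iso_path theta G H H' : fatgraph_iso G H theta -> flip_path H H' ->
  exists2 G', flip_path G G' & fatgraph_iso G' H' theta.
Proof.
move=> i; elim=> [|H1 H2 p [G1 q j] s]; first by exists G => //; apply: flip_path_refl.
have [G2 t k] := iso_step j s; exists G2 => //; exact: flip_path_step q t.
Qed.

End Transport.

(** * Plane trees and their shapes *)

(** Counts of list elements contain booleans read as numbers, on whose values
    [lia] would split; they are generalized first. *)
Ltac lia_counts :=
  repeat match goal with |- context [nat_of_bool ?b] =>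
    generalize (nat_of_bool b); intro end; lia.

(** Labels are half-edges pointing from the root into the tree: the label of a leaf
    is a half-edge leaving the tree, that of a node leads to its vertex. *)
Inductive tree (T : Type) : Type := Leaf of T | Node of T & tree T & tree T.

Definition top T (t : tree T) : T := match t with Leaf x => x | Node x _ _ => x end.

Fixpoint leaves T (t : tree T) : seq T :=
  match t with Leaf x => [:: x] | Node _ A B => leaves A ++ leaves B end.

Fixpoint nodes T (t : tree T) : seq T :=
  if t is Node x A B then x :: nodes A ++ nodes B else [::].

Inductive shape : Type := Sleaf | Snode of shape & shape.

Fixpoint shape_of T (t : tree T) : shape :=
  match t with Leaf _ => Sleaf | Node _ A B => Snode (shape_of A) (shape_of B) end.

Fixpoint shape_size (S : shape) : nat :=
  match S with Sleaf => 1 | Snode A B => shape_size A + shape_size B end.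

Lemma shape_size_gt0 S : (0 < shape_size S)%N.
Proof. by elim: S => //= A IH B _; rewrite addn_gt0 IH. Qed.

Lemma size_leaves T (t : tree T) : size (leaves t) = shape_size (shape_of t).
Proof. by elim: t => //= x A <- B <-; rewrite size_cat. Qed.

Lemma leaves_nil T (t : tree T) : leaves t <> [::].
Proof. by move=> e; have := shape_size_gt0 (shape_of t); rewrite -size_leaves e. Qed.

(** * Reshaping a tree by inner flips *)
Section Trees.
Context {E : finType}.
Implicit Types (G : fatgraph E) (x y h : halfedge E) (t A B C U V : tree (halfedge E)).

(** The node labelled x stands for the three-valent vertex carrying [opp E x] and the
    labels of its two children, in this cyclic order. *)
Fixpoint tree_in G t : bool :=
  if t is Node x A B then
    [&& G (opp E x) == top A, G (top A) == top B, G (top B) == opp E x,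
        tree_in G A & tree_in G B]
  else true.

(** All the half-edges attached to the vertices of the tree. *)
Fixpoint tree_ends t : seq (halfedge E) :=
  if t is Node x A B then [:: opp E x; top A; top B] ++ tree_ends A ++ tree_ends B else [::].

Lemma eq_tree_in G G' t : (forall h, h \in tree_ends t -> G' h = G h) -> tree_in G' t = tree_in G t.
Proof.
elim: t => //= x A IA B IB H.
rewrite !H ?inE ?eqxx ?orbT // IA ?IB // => h hi; apply: H;
  by rewrite !inE mem_cat hi !orbT.
Qed.

(** Flips inside a tree leave the rest of the graph alone; the frame condition is
    what allows the subtrees of a node to be reshaped one after the other. *)
Record reshape G t G' t' : Prop := Reshape {
  reshape_path : flip_path G G';
  reshape_tree : tree_in G' t';
  reshape_top : top t' = top t;
  reshape_ends : perm_eq (tree_ends t') (tree_ends t);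
  reshape_frame : forall h, h \notin tree_ends t -> G' h = G h }.

Lemma reshape_refl G t : tree_in G t -> reshape G t G t.
Proof. by move=> w; split=> //; exact: flip_path_refl. Qed.

Lemma reshape_trans G1 G2 G3 t1 t2 t3 :
  reshape G1 t1 G2 t2 -> reshape G2 t2 G3 t3 -> reshape G1 t1 G3 t3.
Proof.
move=> [p1 w1 e1 v1 f1] [p2 w2 e2 v2 f2]; split=> //.
- exact: flip_path_trans p1 p2.
- by rewrite e2.
- exact: perm_trans v2 v1.
- by move=> h hn; rewrite f2 ?f1 // (perm_mem v1).
Qed.

Lemma reshape_uniq G t G' t' : reshape G t G' t' -> uniq (tree_ends t') = uniq (tree_ends t).
Proof. by move=> r; apply: perm_uniq (reshape_ends r). Qed.

Lemma reshape_cubic G t G' t' : cubic G -> reshape G t G' t' -> cubic G'.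
Proof. by move=> c r; apply: flip_path_cubic c (reshape_path r). Qed.

Lemma uniq_tree_ends_node x A B : uniq (tree_ends (Node x A B)) ->
  [/\ uniq [:: opp E x; top A; top B], uniq (tree_ends A), uniq (tree_ends B),
      forall h, h \in [:: opp E x; top A; top B] -> (h \notin tree_ends A) && (h \notin tree_ends B)
    & forall h, h \in tree_ends A -> h \notin tree_ends B].
Proof.
rewrite -[tree_ends _]/([:: opp E x; top A; top B] ++ (tree_ends A ++ tree_ends B)) cat_uniq [uniq (tree_ends A ++ _)]cat_uniq => /and3P [-> h1 /and3P [-> h2 ->]].
split=> // h hi.
  by rewrite -negb_or -mem_cat; apply/negP => k; move/hasPn: h1 => /(_ h k) /negP; apply.
by apply: contraNN h2 => hb; apply/hasP; exists h.
Qed.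

Lemma reshape_node G x A B G1 A1 G2 B1 :
  tree_in G (Node x A B) -> uniq (tree_ends (Node x A B)) ->
  reshape G A G1 A1 -> reshape G1 B G2 B1 ->
  reshape G (Node x A B) G2 (Node x A1 B1).
Proof.
move=> /= /and5P [/eqP w1 /eqP w2 /eqP w3 wA wB] u ra rb.
have [u1 uA uB d1 d2] := uniq_tree_ends_node u.
case: ra => p1 k1 e1 v1 f1; case: rb => p2 k2 e2 v2 f2.
have f h : h \in [:: opp E x; top A; top B] -> G2 h = G h.
  by move=> /d1 /andP [nA nB]; rewrite f2 ?f1.
split=> //=.
- exact: flip_path_trans p1 p2.
- rewrite e1 e2 !f ?inE ?eqxx ?orbT // w1 w2 w3 !eqxx /= k2 andbT.
  by rewrite (@eq_tree_in G1) // => h hi; rewrite f2 // d2 // -(perm_mem v1).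
- by rewrite e1 e2 !perm_cons perm_cat.
- move=> h; rewrite !inE !negb_or mem_cat negb_or => /and5P [_ _ _ nA nB].
  by rewrite f2 ?f1.
Qed.

(** Associativity: the flip of the edge between two adjacent nodes. *)
Lemma reshape_rotR G x y A B C (t := Node x (Node y A B) C) : cubic G ->
  tree_in G t -> uniq (tree_ends t) -> exists G', reshape G t G' (Node x A (Node y B C)).
Proof.
move=> cG w u; move: w => /= /and5P [/eqP w1 /eqP w2 /eqP w3 /and5P [/eqP w4 /eqP w5 /eqP w6 wA wB] wC].
have pv : perm_eq (tree_ends t) ([:: y; opp E x; top C; opp E y; top B; top A] ++ tree_ends A ++ tree_ends B ++ tree_ends C).
  by apply/seq.permP => q; rewrite /t /= ?count_cat /= ?count_cat; lia_counts.
move: u; rewrite (perm_uniq pv) cat_uniq => /and3P [u6 hn _].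
have [G' D] := inner_data_ex u6 w2 w3 w1 w4 w5 w6; exists G'.
have st := inner_data_flip cG D.
case: D => _ _ [[f1 f2 f3] [f4 f5 f6]] fr.
have frv h : h \in tree_ends A ++ tree_ends B ++ tree_ends C -> G' h = G h.
  by move=> hi; apply: fr; move/hasPn: hn; apply.
split=> //=.
- by apply: flip_path1; left; exists y.
- rewrite f1 f2 f3 f4 f5 f6 !eqxx /=.
  rewrite !(@eq_tree_in G) ?wA ?wB // => h hi; apply: frv; by rewrite !mem_cat hi ?orbT.
- rewrite perm_sym; apply: perm_trans pv _.
  by apply/seq.permP => q; rewrite /= ?count_cat /= ?count_cat; lia_counts.
- by move=> h; rewrite (perm_mem pv) mem_cat negb_or => /andP [/fr].
Qed.

Lemma reshape_rotL G x y A B C (t := Node x A (Node y B C)) : cubic G ->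
  tree_in G t -> uniq (tree_ends t) -> exists G', reshape G t G' (Node x (Node (opp E y) A B) C).
Proof.
move=> cG w u; move: w => /= /and5P [/eqP w1 /eqP w2 /eqP w3 wA /and5P [/eqP w4 /eqP w5 /eqP w6 wB wC]].
have pv : perm_eq (tree_ends t) ([:: y; top A; opp E x; opp E y; top C; top B] ++ tree_ends A ++ tree_ends B ++ tree_ends C).
  by apply/seq.permP => q; rewrite /t /= ?count_cat /= ?count_cat; lia_counts.
move: u; rewrite (perm_uniq pv) cat_uniq => /and3P [u6 hn _].
have [G' D] := inner_data_ex u6 w3 w1 w2 w4 w5 w6; exists G'.
have st := inner_data_flip cG D.
case: D => _ _ [[f1 f2 f3] [f4 f5 f6]] fr.
have frv h : h \in tree_ends A ++ tree_ends B ++ tree_ends C -> G' h = G h.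
  by move=> hi; apply: fr; move/hasPn: hn; apply.
split=> //=.
- by apply: flip_path1; left; exists y.
- rewrite oppK f1 f2 f3 f4 f5 f6 !eqxx /=.
  rewrite !(@eq_tree_in G) ?wA ?wB // => h hi; apply: frv; by rewrite !mem_cat hi ?orbT.
- rewrite perm_sym; apply: perm_trans pv _.
  by apply/seq.permP => q; rewrite /= ?count_cat /= ?count_cat ?oppK; lia_counts.
- by move=> h; rewrite (perm_mem pv) mem_cat negb_or => /andP [/fr].
Qed.

(** Any cut of the sequence of leaves can be made the cut at the root, by rotating
    towards the root the node where the leaves part. *)
Lemma reshape_split t : forall G u v, cubic G -> tree_in G t -> uniq (tree_ends t) ->
  leaves t = u ++ v -> u <> [::] -> v <> [::] ->
  exists G' U V, [/\ reshape G t G' (Node (top t) U V), leaves U = u & leaves V = v].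
Proof.
elim: t => [x|x A IA B IB] G u v cG w uq /= lt nu nv.
  case: u nu lt => // y u _ /= [_ /esym /eqP].
  by rewrite -size_eq0 size_cat addn_eq0 => /andP [_ /nilP].
have [k1 uA uB d1 d2] := uniq_tree_ends_node uq.
have := w; rewrite /= => /and5P [_ _ _ wA wB].
have [s|s|s] := ltngtP (size (leaves A)) (size u).
- have eu : u = leaves A ++ drop (size (leaves A)) u.
    rewrite -{1}(cat_take_drop (size (leaves A)) u); congr (_ ++ _).
    by rewrite -[RHS](take_size_cat (leaves B) (erefl _)) lt take_cat s.
  set u' := drop _ u in eu.
  have nu' : u' <> [::] by move=> e; move: s; rewrite eu e cats0 ltnn.
  have lB : leaves B = u' ++ v.
    move: lt; rewrite eu -catA => /eqP; rewrite eqseq_cat // eqxx /=; exact: eqP.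
  have [G1 [U [V [r lU lV]]]] := IB G u' v cG wB uB lB nu' nv.
  have r1 := reshape_node w uq (reshape_refl wA) r.
  have c1 := reshape_cubic cG r.
  have [G2 r2] := reshape_rotL c1 (reshape_tree r1) (etrans (reshape_uniq r1) uq).
  exists G2; eexists; exists V; split; first exact: reshape_trans r1 r2.
    by rewrite /= lU.
  by [].
- have ev : v = drop (size u) (leaves A) ++ leaves B.
    by rewrite -[LHS](drop_size_cat v (erefl (size u))) -lt drop_cat s.
  set v' := drop _ _ in ev.
  have nv' : v' <> [::].
    by move=> /(congr1 size); rewrite size_drop /=; move: s; rewrite -subn_gt0 => /[swap] ->.
  have lA : leaves A = u ++ v'.
    move: lt; rewrite ev catA => /eqP; rewrite eqseq_cat; first by rewrite eqxx andbT => /eqP.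
    by rewrite size_cat size_drop subnKC // ltnW.
  have [G1 [U [V [r lU lV]]]] := IA G u v' cG wA uA lA nu nv'.
  have wB1 : tree_in G1 B.
    by rewrite (@eq_tree_in G) // => h hB; apply: (reshape_frame r); apply: contraL hB; apply: d2.
  have r1 := reshape_node w uq r (reshape_refl wB1).
  have c1 := reshape_cubic cG r.
  have [G2 r2] := reshape_rotR c1 (reshape_tree r1) (etrans (reshape_uniq r1) uq).
  exists G2, U; eexists; split; first exact: reshape_trans r1 r2.
    by [].
  by rewrite /= lV.
- exists G, A, B; move/eqP: lt; rewrite eqseq_cat // => /andP [/eqP -> /eqP ->].
  by split=> //; apply: reshape_refl.
Qed.

(** Connectedness of the flips of a triangulated polygon: the first cut of the shape
    is brought to the root, and the two sides are treated recursively. *)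
Lemma reshape_shape S : forall G t, cubic G -> tree_in G t -> uniq (tree_ends t) ->
  size (leaves t) = shape_size S ->
  exists G' t', [/\ reshape G t G' t', leaves t' = leaves t & shape_of t' = S].
Proof.
elim: S => [|S1 I1 S2 I2] G t cG w u sz.
  exists G, t; split=> //; first exact: reshape_refl.
  case: t sz {w u} => //= x A B; rewrite size_cat !size_leaves.
  have := shape_size_gt0 (shape_of A); have := shape_size_gt0 (shape_of B); lia.
have lt := esym (cat_take_drop (shape_size S1) (leaves t)).
have sg1 := shape_size_gt0 S1; have sg2 := shape_size_gt0 S2.
set u1 := take _ _ in lt; set u2 := drop _ _ in lt.
have s1 : size u1 = shape_size S1.
  by rewrite size_takel // sz /= leq_addr.
have s2 : size u2 = shape_size S2 by rewrite size_drop sz /= addKn.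
have [|e|G1 [U [V [r lU lV]]]] := reshape_split cG w u lt.
- by move=> e; move: s1 sg1; rewrite e => <-.
- by move: s2 sg2; rewrite e => <-.
have c1 := reshape_cubic cG r.
have uq1 : uniq (tree_ends (Node (top t) U V)) by rewrite (reshape_uniq r).
have [k1 uU uV d1 d2] := uniq_tree_ends_node uq1.
have := reshape_tree r; rewrite /= => /and5P [_ _ _ wU wV].
have [|G2 [U' [r2 lU' sU']]] := I1 G1 U c1 wU uU; first by rewrite lU.
have c2 := reshape_cubic c1 r2.
have wV2 : tree_in G2 V.
  by rewrite (@eq_tree_in G1) // => h hB; apply: (reshape_frame r2); apply: contraL hB; apply: d2.
have [|G3 [V' [r3 lV' sV']]] := I2 G2 V c2 wV2 uV; first by rewrite lV.
exists G3, (Node (top t) U' V'); split.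
- apply: (reshape_trans r); exact: reshape_node (reshape_tree r) uq1 r2 r3.
- by rewrite /= lU' lV' lU lV -lt.
- by rewrite /= sU' sV'.
Qed.

End Trees.

(** * The polygon of a spanning tree and its word *)
Section Words.
Context {E : finType}.
Implicit Types (G : fatgraph E) (x y z h : halfedge E) (t A B C U V : tree (halfedge E))
  (u v w : seq (halfedge E)).

Lemma tree_ends_closed G t h : tree_in G t -> h \in tree_ends t -> G h \in tree_ends t.
Proof.
elim: t => //= x A IA B IB /and5P [/eqP w1 /eqP w2 /eqP w3 wA wB].
rewrite !inE mem_cat => /or4P [/eqP ->|/eqP ->|/eqP ->|/orP [hA|hB]].
- by rewrite w1 eqxx orbT.
- by rewrite w2 eqxx !orbT.
- by rewrite w3 eqxx.
- by rewrite mem_cat IA ?orbT.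
- by rewrite mem_cat IB ?orbT.
Qed.

(** A tree seen from one of its edges, as two rooted trees.  When A is a leaf, the
    label of the root of B is the opposite of that leaf. *)
Definition glued G A B : Prop :=
  [/\ tree_in G A, tree_in G B, uniq (tree_ends A ++ tree_ends B) & top B = opp E (top A)].

Lemma glued_sym G A B : glued G A B -> glued G B A.
Proof.
move=> [wA wB u e]; split=> //; first by rewrite uniq_catC.
by rewrite e oppK.
Qed.

(** The same tree seen from the next edge. *)
Lemma glued_rot G x A B C : glued G (Node x A B) C ->
  glued G A (Node (opp E (top A)) B C) /\
  perm_eq (tree_ends A ++ tree_ends (Node (opp E (top A)) B C)) (tree_ends (Node x A B) ++ tree_ends C).
Proof.
move=> [/= /and5P [/eqP w1 /eqP w2 /eqP w3 wA wB] wC u e].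
have p : perm_eq (tree_ends A ++ tree_ends (Node (opp E (top A)) B C)) (tree_ends (Node x A B) ++ tree_ends C).
  by apply/seq.permP => q; rewrite /= !count_cat /= !count_cat oppK e /=; lia_counts.
split=> //; split=> //=; first by rewrite oppK e w1 w2 w3 !eqxx wB wC.
by rewrite (perm_uniq p).
Qed.

Lemma glued_root G A : forall B z s, glued G A B -> leaves A = z :: s ->
  exists B', [/\ glued G (Leaf z) B', leaves B' = s ++ leaves B
    & perm_eq (tree_ends B') (tree_ends A ++ tree_ends B)].
Proof.
elim: A => [x|x A IA B _] C z s g /=.
  by case=> <- <-; exists C.
have [g1 p1] := glued_rot g.
case lA: (leaves A) => [|z' s'] /=; first by case: (leaves_nil lA).
case=> ez es; rewrite ez in lA.
have [B' [g' lB' pB']] := IA _ _ _ g1 lA.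
exists B'; split=> //; last exact: perm_trans p1.
by rewrite lB' -es /= catA.
Qed.

(** L lists the half-edges at the vertices of the tree, which need not span the
    graph: the move on chords cuts a spanning tree into two such trees. *)
Definition partial_word G (L : seq (halfedge E)) w : Prop :=
  exists A B, [/\ glued G A B, perm_eq (tree_ends A ++ tree_ends B) L & w = leaves A ++ leaves B].

Lemma partial_word_root G L z s : partial_word G L (z :: s) ->
  exists B, [/\ glued G (Leaf z) B, perm_eq (tree_ends B) L & leaves B = s].
Proof.
move=> [A [B [g p e]]].
case lA: (leaves A) => [|z' s']; first by case: (leaves_nil lA).
move: e; rewrite lA => -[ez es]; rewrite -ez in lA.
have [B' [g' lB' pB']] := glued_root g lA.
by exists B'; split=> //; [exact: perm_trans p | rewrite lB' es].
Qed.

Lemma partial_word_rot G L u v : partial_word G L (u ++ v) -> partial_word G L (v ++ u).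
Proof.
elim: u v => [|z u IH] v; first by rewrite cats0.
move=> H; have [B [g p e]] := partial_word_root (H : partial_word G L (z :: (u ++ v))).
rewrite -cat_rcons; apply: IH; rewrite -rcons_cat -cats1 -e.
exists B, (Leaf z); split=> //; first exact: glued_sym.
by rewrite cats0.
Qed.

(** Each label is attached to the vertex above it, except that of the root, and each
    node has its own opposite label attached to it. *)
Lemma tree_ends_nodes t :
  perm_eq (top t :: tree_ends t) (map (opp E) (nodes t) ++ nodes t ++ leaves t).
Proof.
elim: t => //= x A /seq.permP IA B /seq.permP IB; apply/seq.permP => q.
have := IA q; have := IB q; rewrite /= !map_cat !count_cat /= !count_cat; lia_counts.
Qed.

Lemma size_nodes t : size (leaves t) = (size (nodes t)).+1.
Proof. by elim: t => //= x A IA B IB; rewrite !size_cat IA IB addSn addnS. Qed.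

Lemma size_tree_ends t : size (tree_ends t) = 3 * size (nodes t).
Proof. by elim: t => //= x A IA B IB; rewrite !size_cat IA IB mulnS mulnDr. Qed.

(** Besides the letters, the vertices carry both halves of the inner edges n of the
    tree; a tree with n inner edges has n + 1 vertices and n + 3 leaves. *)
Lemma partial_word_inner G L w : partial_word G L w -> L != [::] ->
  exists n, [/\ perm_eq L (w ++ n ++ map (opp E) n), size w = size n + 3
    & size L = 3 * (size n).+1].
Proof.
case: w => [|z s]; first by move=> [A [B [_ _]]]; case lA: (leaves A) => //; case: (leaves_nil lA).
move=> /partial_word_root [B [[_ _ _ e] p es]] nL.
rewrite -es; case: B e p es => [x|x A B] e p es.
  by move: nL; rewrite -size_eq0 -(perm_size p).
exists (nodes A ++ nodes B); split.
- rewrite -(permPl p); have := tree_ends_nodes (Node x A B); move: e => /= ->.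
  move=> /seq.permP P; apply/seq.permP => q; have := P q.
  by rewrite /= oppK !map_cat !count_cat /= !count_cat; lia_counts.
- by have := size_nodes (Node x A B); rewrite /= => ->; rewrite addn3.
- by rewrite -(perm_size p) size_tree_ends.
Qed.

Definition has_word G w : Prop :=
  exists2 L, partial_word G L w & forall h, (h \in L) = (G h != h).

Lemma has_word_rot G u v : has_word G (u ++ v) -> has_word G (v ++ u).
Proof. by move=> [L p c]; exists L => //; apply: partial_word_rot. Qed.

Lemma partial_word_uniq G L w : partial_word G L w -> uniq L.
Proof. by move=> [A [B [[_ _ u _] p _]]]; rewrite -(perm_uniq p). Qed.

(** The tree is seen from the last letter, and its other leaves are cut at the root
    into u and the rest of v. *)
Lemma has_word_split G u v : cubic G -> has_word G (u ++ v) -> u <> [::] -> v <> [::] ->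
  exists G' A B, [/\ flip_path G G', glued G' A B,
    forall h, (h \in tree_ends A ++ tree_ends B) = (G' h != h), leaves A = u & leaves B = v].
Proof.
move=> cG [L p c] nu; case/lastP: v p => // v z p _.
have := partial_word_rot p; rewrite cat_rcons => /partial_word_rot; rewrite cat_cons.
move=> /partial_word_root [T [g pT lT]].
have c' h : (h \in tree_ends T) = (G h != h) by rewrite -c (perm_mem pT).
have [ev|nv] := altP (v =P [::]).
  exists G, T, (Leaf z); split=> //.
  - exact: flip_path_refl.
  - exact: glued_sym.
  - by move=> h; rewrite cats0.
  - by rewrite lT ev cats0.
  - by rewrite ev.
case: g => _ wT uT eT.
have [G' [U [V [r lU lV]]]] := reshape_split cG wT uT lT nu (elimN eqP nv).
have g : glued G' (Node (top T) U V) (Leaf z).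
  split=> //; first exact: reshape_tree r.
    by rewrite cats0 (reshape_uniq r).
  by rewrite eT /= oppK.
have [g' pg] := glued_rot g.
exists G', U; eexists; split; first exact: reshape_path r.
- exact: g'.
- move=> h; rewrite (perm_mem pg) cats0 (perm_mem (reshape_ends r)) c'.
  by rewrite (flip_path_fix cG (reshape_path r)).
- exact: lU.
- by rewrite /= lV cats1.
Qed.

(** Cutting and pasting.  The tree is split along an edge e that separates a from its
    opposite; joining the two parts along the edge of a instead yields another
    spanning tree, whose word has e in the place of a and in which both arcs
    between the two halves have been rotated. *)
Lemma has_word_chord G a (V1 V2 U1 U2 : seq (halfedge E)) : cubic G ->
  has_word G (a :: (V1 ++ V2) ++ opp E a :: U1 ++ U2) ->
  exists G' e, flip_path G G' /\
    has_word G' (e :: (V2 ++ V1) ++ opp E e :: U2 ++ U1).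
Proof.
move=> cG H.
(* The cut separates a from its opposite, at the points where the arcs will be
   rotated. *)
have {}H : has_word G ((U2 ++ a :: V1) ++ (V2 ++ opp E a :: U1)).
  rewrite -catA; apply: has_word_rot; move: H.
  by rewrite /= -!catA.
have [||G' [A [B [p g c lA lB]]]] := has_word_split cG H; try by case: (U2); case: (V2).
exists G', (top A); split=> //.
case: g => wA wB uAB eAB.
have uA : uniq (tree_ends A) by move: uAB; rewrite cat_uniq => /and3P [].
have uB : uniq (tree_ends B) by move: uAB; rewrite cat_uniq => /and3P [].
(* Each part of the tree is seen from a or its opposite, the cut edge being a leaf
   of it. *)
have [|S1 [[_ w1 _ e1] p1 l1]] := @partial_word_root G' (tree_ends A) a (V1 ++ opp E (top A) :: U2).
  rewrite -cat_cons -cat_rcons; apply: partial_word_rot; exists A, (Leaf (opp E (top A))).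
  by split; [split=> //; rewrite cats0 | rewrite cats0 | rewrite lA -cats1 catA].
have [|S2 [[_ w2 _ e2] p2 l2]] := @partial_word_root G' (tree_ends B) (opp E a) (U1 ++ top A :: V2).
  rewrite -cat_cons -cat_rcons; apply: partial_word_rot; exists B, (Leaf (top A)).
  by split; [split=> //; rewrite ?cats0 ?eAB ?oppK | rewrite cats0 | rewrite lB -cats1 catA].
exists (tree_ends S1 ++ tree_ends S2); last by move=> h; rewrite (perm_mem (perm_cat p1 p2)).
rewrite -[X in partial_word _ _ X]/((_ :: _) ++ _).
have -> : (top A :: V2 ++ V1) ++ opp E (top A) :: U2 ++ U1 =
  (top A :: V2) ++ (V1 ++ opp E (top A) :: U2 ++ U1) by rewrite /= -catA.
apply: partial_word_rot; exists S1, S2; split=> //; last by rewrite l1 l2 -!catA /= -!catA.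
split=> //; first by rewrite (perm_uniq (perm_cat p1 p2)).
by rewrite e1 e2.
Qed.

(** Once p and x hang from the same vertex, the pending flip exchanges them. *)
Lemma has_word_pending G p x w : cubic G -> G (opp E p) = opp E p -> w <> [::] ->
  has_word G (p :: x :: w) -> exists2 G', flip_path G G' & has_word G' (x :: p :: w).
Proof.
move=> cG pp nw H.
have [//|//|G1 [A [B [f g c lA lB]]]] := @has_word_split G [:: p; x] w cG H.
have [e eA] : exists e, A = Node e (Leaf p) (Leaf x).
  case: A lA {g c} => [?|e A1 A2] //= e0; exists e.
  have := size_nodes A1; have := size_nodes A2.
  have := congr1 size e0; rewrite size_cat /=.
  case: A1 e0 => [a1|??? ] /=; case: A2 => [a2|???] //=; rewrite ?size_cat; try lia.
  by case=> -> ->.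
have p1 : G1 (opp E p) = opp E p by apply/eqP; rewrite (flip_path_fix cG f) pp.
have c1 := flip_path_cubic cG f.
move: g c; rewrite {}eA {lA} => -[wA wB u0 eB] c.
have u : uniq ([:: opp E e; p; x] ++ tree_ends B) := u0.
move: wA => /= /and4P [/eqP w1 /eqP w2 /eqP w3 _].
have u3 : uniq [:: p; x; opp E e].
  move: u; rewrite cat_uniq => /andP [u _].
  by rewrite -(rot_uniq 1) in u; move: u.
have [G2 D] := pending_data_ex u3 p1 w2 w3 w1.
have st : flip_step G1 G2 by right; exists p; apply: pending_data_flip D.
exists G2; first exact: flip_path_step f st.
case: D => _ _ _ [f1 f2 f3] fr.
have pe : perm_eq [:: opp E e, x, p & tree_ends B] [:: opp E e, p, x & tree_ends B].
  by apply/seq.permP => q /=; lia_counts.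
exists (tree_ends (Node e (Leaf x) (Leaf p)) ++ tree_ends B); last first.
  by move=> h; rewrite (flip_step_fix c1 st) -c (perm_mem pe).
exists (Node e (Leaf x) (Leaf p)), B; split=> //; last by rewrite /= lB.
split=> //=.
- by rewrite f1 f2 f3 !eqxx.
- rewrite (@eq_tree_in _ G1) // => h hB; apply: fr.
  move: u; rewrite cat_uniq => /and3P [_ + _].
  by move=> /hasPn /(_ h hB); rewrite /= !inE !negb_or => /and3P [-> -> ->].
- by move: u; rewrite -(perm_uniq pe).
Qed.

Lemma partial_word_grow G L w x : cubic G -> partial_word G L w -> x \in w ->
  opp E x \notin L -> G (opp E x) != opp E x ->
  exists w', partial_word G ([:: opp E x; G (opp E x); G (G (opp E x))] ++ L) w'.
Proof.
move=> cG p xw nL np.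
have [s ps] : exists s, partial_word G L (x :: s).
  case/splitPr: xw p => w1 w2 /partial_word_rot p.
  by exists (w2 ++ w1); move: p; rewrite cat_cons.
have [B [[_ wB uB eB] pB lB]] := partial_word_root ps.
set o := opp E x in nL np *.
exists (leaves (Node x (Leaf (G o)) (Leaf (G (G o)))) ++ leaves B).
exists (Node x (Leaf (G o)) (Leaf (G (G o)))), B; split=> //; last by rewrite /= !perm_cons.
have cl h : G h \in tree_ends B -> h \in tree_ends B.
  by move=> hB; rewrite -(cG h); do 2!apply: tree_ends_closed => //.
have no : o \notin tree_ends B by rewrite (perm_mem pB).
have no1 : G o \notin tree_ends B by apply: contra no; apply: cl.
have no2 : G (G o) \notin tree_ends B by apply: contra no1; apply: cl.
split=> //=; first by rewrite -/o cG !eqxx.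
have := cubic_uniq cG np; rewrite -/o /= !inE !negb_or andbT => /andP [/andP [-> ->] ->] /=.
by rewrite no no1 no2.
Qed.

(** A maximal tree spans, by connectedness: a half-edge leading out of the vertices
    of the tree is a letter, and the vertex it leads to could be added. *)
Lemma has_word_ex G h0 : cubic G -> fg_connected G -> G h0 != h0 ->
  exists w, has_word G w.
Proof.
move=> cG conn n0.
suff grow k : forall L w, partial_word G L w -> L != [::] -> (forall h, h \in L -> G h != h) ->
    (#|[set h | G h != h]| <= size L + k)%N -> exists w, has_word G w.
  apply: (grow #|[set h | G h != h]| [:: h0; G h0; G (G h0)] [:: h0; G h0; G (G h0)]) => //.
  - exists (Leaf h0), (Node (opp E h0) (Leaf (G h0)) (Leaf (G (G h0)))).
    split; [split=> // | by rewrite /= oppK | by []].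
      by rewrite /= oppK cG !eqxx.
    by rewrite [_ ++ _]/= oppK cubic_uniq.
  - move=> h; rewrite !inE => /or3P [] /eqP -> //; first by rewrite (inj_eq perm_inj).
    by rewrite !(inj_eq perm_inj).
  - by rewrite leq_addl.
elim: k => [|k IH] L w p nL LG sz.
  exists w, L => // h; apply/idP/idP => [/LG //|hG].
  have sub : [set x in L] \subset [set h | G h != h].
    by apply/fintype.subsetP => y; rewrite !inE => /LG.
  have /eqP es : [set x in L] == [set h | G h != h].
    rewrite eqEcard sub /= (leq_trans sz) // addn0 cardsE.
    by have /card_uniqP -> := partial_word_uniq p.
  by have : h \in [set x in L]; [rewrite es inE | rewrite inE].
case: (boolP [forall h, (G h != h) ==> (h \in L)]) => [/forallP c|].
  by exists w, L => // h; apply/idP/idP => [/LG //|]; apply: implyP.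
rewrite negb_forall => /existsP [h1]; rewrite negb_imply => /andP [hG hL].
have [n [pn _ _]] := partial_word_inner p nL.
have uL := partial_word_uniq p.
case: (boolP (has (fun x => (opp E x \notin L) && (G (opp E x) != opp E x)) w)).
  move=> /hasP [x xw /andP [x1 x2]].
  have [w' p'] := partial_word_grow cG p xw x1 x2; apply: IH p' _ _ _ => //.
    move=> h; rewrite mem_cat => /orP [|/LG //]; rewrite !inE => /or3P [] /eqP -> //.
      by rewrite (inj_eq perm_inj).
    by rewrite !(inj_eq perm_inj).
  by apply: leq_trans sz _; rewrite size_cat /=; lia.
move=> /hasPn nx.
have wL h : h \notin L -> opp E h \in L -> opp E h \in w.
  move=> hn ho; move: (ho); rewrite (perm_mem pn) !mem_cat => /or3P [//|hi|hi].
    by case/negP: hn; rewrite (perm_mem pn) !mem_cat -[h]oppK (map_f _ hi) !orbT.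
  move/mapP: hi => [y yn /perm_inj e].
  by case/negP: hn; rewrite (perm_mem pn) !mem_cat e yn !orbT.
have wfix h : h \notin L -> opp E h \in L -> G h = h.
  move=> hn ho; have := nx _ (wL _ hn ho); rewrite oppK hn /= negbK; exact: eqP.
(* No letter leads to a new vertex: then the edges meeting the tree are closed under
   both permutations. *)
pose S h := (h \in L) || (opp E h \in L).
have clG h : h \in L -> G h \in L.
  case: p => [A [B [[wA wB _ _] pe _]]]; rewrite -!(perm_mem pe) !mem_cat.
  by case/orP => /tree_ends_closed ->; rewrite ?orbT.
have Sall h : S h.
  have [y yL] : exists y, y \in L by case: (L) nL => // y L' _; exists y; rewrite inE eqxx.
  have : S y by rewrite /S yL.
  have /connectP [q + ->] := conn y h; elim: q y {yL} => //= y' q IHq y /andP [e pq] Sy.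
  apply: (IHq y') => //; case/orP: e => /eqP ->; last by rewrite /S oppK orbC.
  case: (boolP (y \in L)) => yL; first by rewrite /S clG.
  by rewrite wfix //; move: Sy; rewrite /S (negbTE yL).
by have := Sall h1; rewrite /S (negbTE hL) /= => ho; move: hG; rewrite wfix // eqxx.
Qed.

Lemma has_word_letters G w : has_word G w -> w != [::] -> (exists h, G h != h) ->
  [/\ uniq w, forall x, x \in w -> G x != x
    & forall x, x \in w -> G (opp E x) != opp E x -> opp E x \in w].
Proof.
move=> [L p c] nw [h0 h0G].
have nL : L != [::] by apply: contraTneq h0G => e; rewrite -c e.
have [n [pn _ _]] := partial_word_inner p nL.
have := partial_word_uniq p; rewrite (perm_uniq pn) => uL.
have uw := uL; rewrite cat_uniq in uw; case/and3P: uw => uw hn _.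
split=> // x xw; first by rewrite -c (perm_mem pn) mem_cat xw.
rewrite -c (perm_mem pn) !mem_cat => /or3P [//|hi|hi].
  case/negP: hn; apply/hasP; exists x => //.
  by rewrite mem_cat -[x]oppK (map_f _ hi) orbT.
move/mapP: hi => [y yn /perm_inj e].
by case/negP: hn; apply/hasP; exists x => //; rewrite mem_cat e yn.
Qed.

End Words.

(** * Normal form of words *)

(** Equality of concatenations up to associativity. *)
Ltac cat_equal := rewrite ?cats0; repeat (progress rewrite /= -?catA); reflexivity.

Section NormalForm.
Context {E : finType}.
Implicit Types (x y z h a b e p : halfedge E) (u v w s Q X Y Z W : seq (halfedge E)).

(** An innermost chord: either its ends are adjacent, or a letter between them has
    its opposite between them, which gives a shorter chord, or outside, which gives
    two crossing chords. *)
Lemma chord_cases s : uniq s -> (forall x, x \in s -> opp E x \in s) -> s <> [::] ->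
  (exists s1 a s2, s = s1 ++ a :: opp E a :: s2) \/
  (exists s1 s2 a b X Y Z,
     s = s1 ++ a :: X ++ b :: Y ++ opp E a :: Z ++ opp E b :: s2).
Proof.
move=> us cl ns.
suff H n : forall s1 a V s2, (size V <= n)%N -> s = s1 ++ a :: V ++ opp E a :: s2 ->
    (exists s1 a s2, s = s1 ++ a :: opp E a :: s2) \/
    (exists s1 s2 a b X Y Z,
     s = s1 ++ a :: X ++ b :: Y ++ opp E a :: Z ++ opp E b :: s2).
  case es : s ns => [//|x s'] _; rewrite -es.
  have : opp E x \in s by apply: cl; rewrite es inE eqxx.
  rewrite {1}es inE (negbTE (opp_neq x)) /= => xs; case/splitPr: xs es => p1 p2 es.
  by apply: (H (size p1) [::] x p1 p2).
elim: n => [|n IH] s1 a V s2.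
  by rewrite leqn0 size_eq0 => /eqP -> e; left; exists s1, a, s2.
case: V => [|y V] szV es; first by left; exists s1, a, s2.
have ys : y \in s by rewrite es !(mem_cat, inE) eqxx !orbT.
have := cl _ ys; rewrite {1}es !(mem_cat, inE) (negbTE (opp_neq y)) /=.
case/or4P => [yo|/eqP yo|yo|/orP [/eqP /perm_inj yo|yo]].
- case/splitPr: yo es => t1 t2 es; right.
  exists t1, s2, (opp E y), a, t2, [::], V.
  by rewrite oppK es -!catA /=.
- exfalso; move: us; rewrite es -yo cat_uniq oppK => /and3P [_ _] /=.
  by rewrite !(mem_cat, inE) eqxx !orbT /= ?andbF.
- case/splitPr: yo es szV => t1 t2 es szV.
  apply: (IH (s1 ++ [:: a]) y t1 (t2 ++ opp E a :: s2)); last by rewrite es -!catA /= -!catA.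
  by move: szV; rewrite /= size_cat /=; lia.
- exfalso; move: us; rewrite es yo cat_uniq => /and3P [_ _] /=.
  by rewrite !(mem_cat, inE) eqxx.
- case/splitPr: yo es => t1 t2 es; right.
  by exists s1, t2, a, y, [::], V, t1; rewrite es.
Qed.

(** An adjacent pair bounds a face with one edge. *)
Definition tadpoles (ks : seq (halfedge E)) := flatten [seq [:: a; opp E a] | a <- ks].
(** Two crossing adjacent pairs form a handle of the surface. *)
Definition handles (cs : seq (halfedge E * halfedge E)) :=
  flatten [seq [:: c.1; c.2; opp E c.1; opp E c.2] | c <- cs].
Definition normal_word ps ks cs := ps ++ tadpoles ks ++ handles cs.

Lemma tadpoles_rcons ks a : tadpoles (rcons ks a) = tadpoles ks ++ [:: a; opp E a].
Proof. by rewrite /tadpoles map_rcons flatten_rcons. Qed.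

Lemma handles_rcons cs c :
  handles (rcons cs c) = handles cs ++ [:: c.1; c.2; opp E c.1; opp E c.2].
Proof. by rewrite /handles map_rcons flatten_rcons. Qed.

Lemma tadpoles_opp ks x : x \in tadpoles ks -> opp E x \in tadpoles ks.
Proof.
elim: ks => //= a ks IH; rewrite !inE => /or3P [/eqP ->|/eqP ->|/IH ->].
- by rewrite eqxx orbT.
- by rewrite oppK eqxx.
- by rewrite !orbT.
Qed.

Lemma handles_opp cs x : x \in handles cs -> opp E x \in handles cs.
Proof.
elim: cs => //= -[a b] cs IH /=; rewrite !inE.
case/or4P => [/eqP ->|/eqP ->|/eqP ->|/orP [/eqP ->|/IH ->]]; rewrite ?oppK ?eqxx ?orbT //.
Qed.

Variables (G : fatgraph E) (h0 : halfedge E).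
Hypotheses (cG : cubic G) (G0 : G h0 != h0).

Definition reach w : Prop := exists2 G', flip_path G G' & has_word G' w.

Definition is_pending x : bool := G (opp E x) == opp E x.

Lemma reach_rot u v w w' : reach w -> w = u ++ v -> w' = v ++ u -> reach w'.
Proof. by move=> [G' p H] e ->; exists G' => //; apply: has_word_rot; rewrite -e. Qed.

Lemma reach_chord V1 V2 U1 U2 a w : reach w ->
  w = a :: (V1 ++ V2) ++ opp E a :: U1 ++ U2 ->
  exists e, reach (e :: (V2 ++ V1) ++ opp E e :: U2 ++ U1).
Proof.
move=> [G' p H] ew; rewrite ew in H.
have [G2 [e [p2 H2]]] := has_word_chord (flip_path_cubic cG p) H.
by exists e, G2 => //; apply: flip_path_trans p2.
Qed.

Lemma reach_size w : reach w -> exists n, [/\ size w = n + 3 & #|[set h | G h != h]| = 3 * n.+1].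
Proof.
move=> [G' p [L pw c]].
have nL : L != [::].
  by apply: contraTneq G0 => e; rewrite -(flip_path_fix cG p) -c e.
have [n [_ s1 s2]] := partial_word_inner pw nL; exists (size n); split=> //.
rewrite -s2; have /card_uniqP <- := partial_word_uniq pw.
by apply: eq_card => h; rewrite inE c (flip_path_fix cG p).
Qed.

Lemma reach_letters w : reach w ->
  [/\ uniq w, forall x, x \in w -> is_pending x || (opp E x \in w)
    & forall x, x \in w -> opp E x \in w -> ~~ is_pending x].
Proof.
move=> H; have [n [sz _]] := reach_size H; case: H => [G' p H].
have nw : w != [::] by rewrite -size_eq0 sz addn3.
have [|uw l1 l2] := has_word_letters H nw.
  by exists h0; rewrite (flip_path_fix cG p).
split=> // x xw; rewrite /is_pending -(flip_path_fix cG p).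
  by case: eqP => //= /eqP; apply: l2.
exact: l1.
Qed.

(** A pending letter crosses its neighbours one at a time. *)
Lemma reach_past v u p : is_pending p -> reach (p :: v ++ u) -> reach (v ++ p :: u).
Proof.
move=> pp; elim: v u => [//|x v IH] u H.
have [n [sz _]] := reach_size H.
have {}H : reach (x :: p :: v ++ u).
  case: H => G' q H.
  have [|nw|G2 q2 H2] := has_word_pending (flip_path_cubic cG q) _ _ H.
  - by apply/eqP; rewrite (flip_path_fix cG q).
  - by have e : v ++ u = [::] := nw; move: sz; rewrite /= e /=; lia.
  - by exists G2 => //; apply: flip_path_trans q2.
have {}H : reach (p :: v ++ (u ++ [:: x])).
  by apply: (@reach_rot [:: x] (p :: v ++ u)) H _ _; rewrite //= catA.
apply: (@reach_rot (v ++ p :: u) [:: x]) (IH _ H) _ _ => //.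
by rewrite -catA.
Qed.

(** The two parts of the rest of the word can be exchanged around a handle by four
    moves on its chords, alternating between a and b. *)
Lemma reach_handle_past a b U1 U2 :
  reach ([:: a; b; opp E a; opp E b] ++ U1 ++ U2) ->
  exists a b, reach ([:: a; b; opp E a; opp E b] ++ U2 ++ U1).
Proof.
move=> H.
have [a1 {}H] := @reach_chord [:: b] [::] (opp E b :: U1) U2 a _ H erefl.
have {}H : reach (b :: ([:: opp E a1] ++ U2) ++ opp E b :: (U1 ++ [:: a1]) ++ [::]).
  by apply: (@reach_rot [:: a1] _) H _ _; rewrite //= cats0 -!catA /= -?catA.
have [b1 {}H] := reach_chord H erefl.
have {}H : reach (a1 :: ([:: b1] ++ U2) ++ opp E a1 :: (opp E b1 :: U1) ++ [::]).
  apply: (@reach_rot ((b1 :: U2) ++ opp E a1 :: opp E b1 :: U1) [:: a1]) H _ _;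
    by cat_equal.
have [a2 {}H] := reach_chord H erefl.
have {}H : reach (b1 :: ([:: opp E a2] ++ [::]) ++ opp E b1 :: (U1 ++ [:: a2]) ++ U2).
  apply: (@reach_rot (a2 :: U2) (b1 :: opp E a2 :: opp E b1 :: U1)) H _ _;
    by cat_equal.
have [b2 {}H] := reach_chord H erefl.
exists a2, b2.
apply: (@reach_rot (b2 :: opp E a2 :: opp E b2 :: U2 ++ U1) [:: a2]) H _ _;
  by cat_equal.
Qed.

(** With W the rest of the cyclic word, moves on the chords a, b and a turn
    a X b Y a' Z b' W into a b a' b' W Z Y X; then s1 Z Y X is exchanged with
    s2 Q around the handle. *)
Lemma reach_extract_handle Q s1 a X b Y Z s2 :
  reach (Q ++ s1 ++ a :: X ++ b :: Y ++ opp E a :: Z ++ opp E b :: s2) ->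
  exists a b, reach (Q ++ [:: a; b; opp E a; opp E b] ++ s1 ++ Z ++ Y ++ X ++ s2).
Proof.
pose W := s2 ++ Q ++ s1 => H.
have {}H : reach (a :: (X ++ b :: Y) ++ opp E a :: [::] ++ Z ++ opp E b :: W).
  by apply: (@reach_rot (Q ++ s1) (a :: X ++ b :: Y ++ opp E a :: Z ++ opp E b :: s2)) H _ _;
    rewrite ?/W; cat_equal.
have [a1 {}H] := reach_chord H erefl.
have {}H : reach (b :: ((Y ++ X) ++ opp E a1 :: Z) ++ opp E b :: (W ++ [:: a1]) ++ [::]).
  by apply: (@reach_rot [:: a1] (b :: Y ++ X ++ opp E a1 :: Z ++ opp E b :: W)) H _ _;
    cat_equal.
have [b1 {}H] := reach_chord H erefl.
have {}H : reach (a1 :: ([:: b1] ++ [::]) ++ opp E a1 :: (Z ++ Y ++ X) ++ opp E b1 :: W).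
  by apply: (@reach_rot (b1 :: opp E a1 :: Z ++ Y ++ X ++ opp E b1 :: W) [:: a1]) H _ _;
    cat_equal.
have [a2 {}H] := reach_chord H erefl.
have [|a3 [b3 {}H]] := @reach_handle_past a2 b1 (s2 ++ Q) (s1 ++ Z ++ Y ++ X).
  by move: H; rewrite /W /= -!catA.
exists a3, b3.
by apply: (@reach_rot ([:: a3; b3; opp E a3; opp E b3] ++ s1 ++ Z ++ Y ++ X ++ s2) Q) H _ _;
  cat_equal.
Qed.

(** One of the arcs of the chord is empty, and rotating the other one moves the block
    anywhere. *)
Lemma reach_extract_tadpole Q1 Q2 s1 a s2 :
  reach (Q1 ++ Q2 ++ s1 ++ a :: opp E a :: s2) ->
  exists a, reach (Q1 ++ [:: a; opp E a] ++ Q2 ++ s1 ++ s2).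
Proof.
move=> H.
have {}H : reach (a :: ([::] ++ [::]) ++ opp E a :: (s2 ++ Q1) ++ (Q2 ++ s1)).
  by apply: (@reach_rot (Q1 ++ Q2 ++ s1) (a :: opp E a :: s2)) H _ _;
    cat_equal.
have [a1 {}H] := reach_chord H erefl; exists a1.
by apply: (@reach_rot ([:: a1; opp E a1] ++ Q2 ++ s1 ++ s2) Q1) H _ _;
  cat_equal.
Qed.

(** Pending letters are removed from the unsorted part s first; then s is closed under
    opposites, and a tadpole or a handle can be extracted from it. *)
Lemma reach_normal_word w : reach w ->
  exists ps ks cs, all is_pending ps /\ reach (normal_word ps ks cs).
Proof.
(* ps, ks and cs are the blocks already sorted. *)
move=> H; suff N n : forall ps ks cs s, (size s <= n)%N -> all is_pending ps ->
    reach (normal_word ps ks cs ++ s) -> exists ps ks cs, all is_pending ps /\ reach (normal_word ps ks cs).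
  exact: (N (size w) [::] [::] [::] w).
elim: n => [|n IH] ps ks cs s.
  by rewrite leqn0 size_eq0 => /eqP -> pps; rewrite cats0; exists ps, ks, cs.
move=> sz pps R.
case: (boolP (has is_pending s)) => [/hasP [p ps' pp]|/hasPn np].
  case/splitPr: ps' sz R => s1 s2 sz R.
  have {}R : reach (p :: s2 ++ (normal_word ps ks cs ++ s1)).
    by apply: (@reach_rot (normal_word ps ks cs ++ s1) (p :: s2)) R _ _; cat_equal.
  have {}R := reach_past pp R.
  apply: (IH (p :: ps) ks cs (s1 ++ s2)).
  - by move: sz; rewrite !size_cat /=; lia.
  - by rewrite /= pp.
  - by apply: (@reach_rot s2 (p :: normal_word ps ks cs ++ s1)) R _ _; cat_equal.
have [uw l1 l2] := reach_letters R.
have [es|/eqP ns] := altP (s =P [::]).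
  by exists ps, ks, cs; split=> //; move: R; rewrite es cats0.
have [us dis] : uniq s /\ (forall x, x \in s -> x \notin normal_word ps ks cs).
  move: uw; rewrite cat_uniq => /and3P [_ d ->]; split=> // x xs.
  by move/hasPn: d; apply.
have cl x : x \in s -> opp E x \in s.
  move=> xs; have xw : x \in normal_word ps ks cs ++ s by rewrite mem_cat xs orbT.
  have := l1 _ xw; rewrite (negbTE (np _ xs)) /= => ow; move: (ow).
  rewrite mem_cat => /orP [|//]; rewrite !mem_cat => /or3P [xo|xo|xo].
  - have := l2 _ ow; rewrite oppK => /(_ xw).
    by rewrite (allP pps).
  - by have := dis _ xs; rewrite !mem_cat -[X in X \in tadpoles _]oppK tadpoles_opp // orbT.
  - by have := dis _ xs; rewrite !mem_cat -[X in X \in handles _]oppK handles_opp // !orbT.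
have [[s1 [a [s2 es]]]|[s1 [s2 [a [b [X [Y [Z es]]]]]]]] := chord_cases us cl ns.
  have [|a1 R1] := @reach_extract_tadpole (ps ++ tadpoles ks) (handles cs) s1 a s2.
    by move: R; rewrite /normal_word es -!catA.
  apply: (IH ps (rcons ks a1) cs (s1 ++ s2)) => //.
    by move: sz; rewrite es !size_cat /=; lia.
  by move: R1; rewrite /normal_word tadpoles_rcons -!catA.
rewrite es in R; have [a1 [b1 R1]] := reach_extract_handle R.
apply: (IH ps ks (rcons cs (a1, b1)) (s1 ++ Z ++ Y ++ X ++ s2)) => //.
  by move: sz; rewrite es !size_cat /= !size_cat /= !size_cat /= !size_cat /=; lia.
by move: R1; rewrite /normal_word handles_rcons -!catA.
Qed.

End NormalForm.

(** * Isomorphisms from matching trees *)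
Section Matching.
Context {E1 E2 : finType}.
Implicit Types (L w v : seq (halfedge E1)) (M : seq (halfedge E2)).

(** The positions of opposite letters agree. *)
Definition same_pairing L M : Prop :=
  size L = size M /\
  forall p q, p \in zip L M -> q \in zip L M ->
    (p.1 == opp E1 q.1) = (p.2 == opp E2 q.2).

Lemma mem_zip (T1 T2 : eqType) (s : seq T1) (t : seq T2) p :
  p \in zip s t -> p.1 \in s /\ p.2 \in t.
Proof.
elim: s t => [|x s IH] [|y t] //=; rewrite !inE => /orP [/eqP -> /=|/IH [-> ->]].
  by rewrite !eqxx.
by rewrite !orbT.
Qed.

Lemma same_pairing_cat L L' M M' :
  same_pairing L M -> same_pairing L' M' ->
  (forall x y, x \in L -> y \in L' -> x != opp E1 y) ->
  (forall x y, x \in M -> y \in M' -> x != opp E2 y) ->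
  same_pairing (L ++ L') (M ++ M').
Proof.
move=> [s1 c1] [s2 c2] d1 d2; split; first by rewrite !size_cat s1 s2.
move=> p q; rewrite zip_cat // !mem_cat => /orP [] hp /orP [] hq.
- exact: c1.
- have [p1 p2] := mem_zip hp; have [q1 q2] := mem_zip hq.
  by rewrite (negbTE (d1 _ _ p1 q1)) (negbTE (d2 _ _ p2 q2)).
- have [p1 p2] := mem_zip hp; have [q1 q2] := mem_zip hq.
  rewrite -[p.1 == _]opp_eq [_ == q.1]eq_sym -[p.2 == _]opp_eq [_ == q.2]eq_sym.
  by rewrite (negbTE (d1 _ _ q1 p1)) (negbTE (d2 _ _ q2 p2)).
- exact: c2.
Qed.

Lemma same_pairing_none L M : size L = size M ->
  (forall x y, x \in L -> y \in L -> x != opp E1 y) ->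
  (forall x y, x \in M -> y \in M -> x != opp E2 y) -> same_pairing L M.
Proof.
move=> s d1 d2; split=> // p q /mem_zip [p1 p2] /mem_zip [q1 q2].
by rewrite (negbTE (d1 _ _ p1 q1)) (negbTE (d2 _ _ p2 q2)).
Qed.

End Matching.

Lemma same_pairing_sym (E1 E2 : finType) (L : seq (halfedge E1)) (M : seq (halfedge E2)) :
  same_pairing L M -> same_pairing M L.
Proof.
move=> [s c]; split=> // p q hp hq.
have sw (r : halfedge E2 * halfedge E1) : r \in zip M L -> (r.2, r.1) \in zip L M.
  move: s {c hp hq}; elim: L M => [|x L IH] [|y M] //= [/IH {}IH]; rewrite !inE.
  by case: r IH => r1 r2 IH /=; rewrite !xpair_eqE [(r2 == x) && _]andbC => /orP [->|/IH ->] //; rewrite orbT.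
by have := c _ _ (sw _ hp) (sw _ hq).
Qed.

Section MatchMap.
Context {E1 E2 : finType}.
Variables (L : seq (halfedge E1)) (M : seq (halfedge E2)) (d : halfedge E1).
Hypotheses (P : same_pairing L M) (uM : uniq M).

(** A half-edge of the list goes to the half-edge at the same position; the others are
    reached through their opposites. *)
Definition match_map (h : halfedge E2) : halfedge E1 :=
  if h \in M then nth d L (index h M) else opp E1 (nth d L (index (opp E2 h) M)).

Lemma match_mapP h : h \in M -> (match_map h, h) \in zip L M.
Proof.
move=> hM; rewrite /match_map hM; case: P => s _.
have -> : (nth d L (index h M), h) = nth (d, h) (zip L M) (index h M).
  by rewrite nth_zip // nth_index.
by rewrite mem_nth // size2_zip ?s // index_mem.
Qed.

Lemma match_map_opp_mem h : h \in M -> match_map (opp E2 h) = opp E1 (match_map h).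
Proof.
move=> hM; have p1 := match_mapP hM.
case: (boolP (opp E2 h \in M)) => oM; last first.
  by rewrite {1}/match_map (negbTE oM) oppK /match_map hM.
have p2 := match_mapP oM; case: P => _ c; apply/eqP.
by have := c _ _ p2 p1 => /= ->.
Qed.

Lemma map_match_map : map match_map M = L.
Proof.
case: P => s _; apply: (@eq_from_nth _ d); first by rewrite size_map.
move=> i; rewrite size_map => iM; have [h _] : exists h : halfedge E2, h \in M.
  by case: (M) iM => // h M' _; exists h; rewrite inE eqxx.
by rewrite (nth_map h) // /match_map mem_nth // index_uniq.
Qed.

End MatchMap.

Section MatchBij.
Context {E1 E2 : finType}.
Variables (L : seq (halfedge E1)) (M : seq (halfedge E2)) (d1 : halfedge E1).
Hypotheses (P : same_pairing L M) (cM : forall h, (h \in M) || (opp E2 h \in M)).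

Lemma match_map_opp h : match_map L M d1 (opp E2 h) = opp E1 (match_map L M d1 h).
Proof.
case/orP: (cM h) => hM; first exact: match_map_opp_mem.
by have := match_map_opp_mem d1 P hM; rewrite oppK => ->; rewrite oppK.
Qed.
End MatchBij.

(** The lists determine both maps on all half-edges because every edge has a half in
    them. *)
Lemma match_mapK (E1 E2 : finType) (L : seq (halfedge E1)) (M : seq (halfedge E2)) d1 d2 :
  same_pairing L M -> uniq L -> uniq M ->
  (forall h, (h \in L) || (opp E1 h \in L)) -> (forall h, (h \in M) || (opp E2 h \in M)) ->
  cancel (match_map L M d1) (match_map M L d2).
Proof.
move=> P uL uM cL cM; have P' := same_pairing_sym P.
have K h : h \in M -> match_map M L d2 (match_map L M d1 h) = h.
  move=> hM; case: (P) => s _; have hi : (index h M < size L)%N by rewrite s index_mem.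
  by rewrite {2}/match_map hM /match_map mem_nth // index_uniq // nth_index.
move=> h; case/orP: (cM h) => hM; first exact: K.
by apply: (@perm_inj _ (opp E2)); rewrite -!match_map_opp // K.
Qed.

(** Leaves and nodes are listed in orders that depend on the shape only. *)
Lemma same_shape_eq (T : Type) (t t' : tree T) :
  shape_of t = shape_of t' -> leaves t = leaves t' -> nodes t = nodes t' -> t = t'.
Proof.
elim: t t' => [x|x A IA B IB] [y|y A' B'] //=; first by move=> _ [->].
case=> sA sB lE [ey nE]; rewrite ey.
have sn (u u' : tree T) : shape_of u = shape_of u' -> size (nodes u) = size (nodes u').
  elim: u u' => [?|? u1 I1 u2 I2] [?|? v1 v2] //= [e1 e2].
  by rewrite !size_cat (I1 _ e1) (I2 _ e2).
have split_eq (s1 s2 s3 s4 : seq T) : size s1 = size s3 -> s1 ++ s2 = s3 ++ s4 -> s1 = s3 /\ s2 = s4.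
  by elim: s1 s3 => [|a s1 IH] [|b s3] //= [/IH {}IH] [-> /IH [-> ->]].
have [|lA lB] := split_eq _ _ _ _ _ lE; first by rewrite !size_leaves sA.
have [|nA nB] := split_eq _ _ _ _ _ nE; first exact: sn.
by rewrite (IA A') // (IB B').
Qed.

Fixpoint map_tree (S T : Type) (f : S -> T) (t : tree S) : tree T :=
  match t with Leaf x => Leaf (f x) | Node x A B => Node (f x) (map_tree f A) (map_tree f B) end.

Lemma top_map S T (f : S -> T) t : top (map_tree f t) = f (top t).
Proof. by case: t. Qed.
Lemma leaves_map S T (f : S -> T) t : leaves (map_tree f t) = map f (leaves t).
Proof. by elim: t => //= x A -> B ->; rewrite map_cat. Qed.
Lemma nodes_map S T (f : S -> T) t : nodes (map_tree f t) = map f (nodes t).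
Proof. by elim: t => //= x A -> B ->; rewrite map_cat. Qed.
Lemma shape_map S T (f : S -> T) t : shape_of (map_tree f t) = shape_of t.
Proof. by elim: t => //= x A -> B ->. Qed.

Section Rooted.
Context {E : finType}.
Implicit Types (G : fatgraph E) (z : halfedge E) (B : tree (halfedge E)).

Definition spanning G z B : Prop :=
  [/\ tree_in G B, uniq (tree_ends B), top B = opp E z & forall h, (h \in tree_ends B) = (G h != h)].

Definition no_isolated G : Prop := forall h, (G h != h) || (G (opp E h) != opp E h).

Lemma spanning_inner G z B : spanning G z B -> no_isolated G ->
  perm_eq (tree_ends B) ((z :: leaves B) ++ behead (nodes B) ++ map (opp E) (behead (nodes B)))
  /\ nodes B = opp E z :: behead (nodes B).
Proof.
move=> [w u e c] ni; case: B w u e c => [x|x A B] w u e c.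
  by have := ni z; rewrite -!c.
have ex : x = opp E z := e.
split; last by rewrite -ex.
have := tree_ends_nodes (Node x A B); move=> /seq.permP P; apply/seq.permP => q; have := P q.
rewrite ex /= oppK !map_cat !count_cat /= !count_cat /=; lia_counts.
Qed.

Lemma spanning_cover G z B : spanning G z B -> no_isolated G ->
  forall h, (h \in (z :: leaves B) ++ behead (nodes B)) ||
            (opp E h \in (z :: leaves B) ++ behead (nodes B)).
Proof.
move=> sp ni h; have [p _] := spanning_inner sp ni; have [_ _ _ c] := sp.
have H k : G k != k -> (k \in (z :: leaves B) ++ behead (nodes B)) ||
            (opp E k \in (z :: leaves B) ++ behead (nodes B)).
  rewrite -c (perm_mem p) catA mem_cat => /orP [->//|/mapP [y yn ->]].
  by rewrite oppK [in X in _ || X]mem_cat yn !orbT.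
by case/orP: (ni h) => [/H //|/H]; rewrite oppK orbC.
Qed.

End Rooted.

(** The half-edges of the word and of the inner edges of the tree meet every edge, so
    matching positions defines a bijection; equality of shapes makes it carry one
    tree to the other, hence commute with the rotation at the vertices. *)
Lemma spanning_iso (E1 E2 : finType) (G1 : fatgraph E1) (G2 : fatgraph E2) z1 z2 B1 B2 :
  spanning G1 z1 B1 -> spanning G2 z2 B2 -> no_isolated G1 -> no_isolated G2 ->
  shape_of B1 = shape_of B2 -> same_pairing (z1 :: leaves B1) (z2 :: leaves B2) ->
  exists theta, fatgraph_iso G1 G2 theta.
Proof.
move=> sp1 sp2 ni1 ni2 sh pa.
have [p1 e1] := spanning_inner sp1 ni1; have [p2 e2] := spanning_inner sp2 ni2.
have c1 := spanning_cover sp1 ni1; have c2 := spanning_cover sp2 ni2.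
case: (sp1) => w1 u1 t1 f1; case: (sp2) => w2 u2 t2 f2.
move: p1 e1 p2 e2 c1 c2; set n1 := behead _; set n2 := behead _ => p1 e1 p2 e2 c1 c2.
have [uq1 dj1] : uniq ((z1 :: leaves B1) ++ n1) /\
    (forall x y, x \in (z1 :: leaves B1) ++ n1 -> y \in n1 -> x != opp E1 y).
  move: u1; rewrite (perm_uniq p1) catA cat_uniq => /and3P [-> hn _]; split=> // x y xL yn.
  by apply: contraNneq hn => e; apply/hasP; exists x => //; rewrite e map_f.
have [uq2 dj2] : uniq ((z2 :: leaves B2) ++ n2) /\
    (forall x y, x \in (z2 :: leaves B2) ++ n2 -> y \in n2 -> x != opp E2 y).
  move: u2; rewrite (perm_uniq p2) catA cat_uniq => /and3P [-> hn _]; split=> // x y xL yn.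
  by apply: contraNneq hn => e; apply/hasP; exists x => //; rewrite e map_f.
have sl : size (leaves B1) = size (leaves B2) by rewrite !size_leaves sh.
have sn : size n1 = size n2.
  by move: sl; rewrite !size_nodes e1 e2 /= => -[].
(* Inner edges have one half only in these lists, so they pair with nothing. *)
have PA : same_pairing ((z1 :: leaves B1) ++ n1) ((z2 :: leaves B2) ++ n2).
  apply: same_pairing_cat => //.
  - apply: same_pairing_none => // x y xn yn; [apply: dj1|apply: dj2] => //;
      by rewrite mem_cat xn orbT.
  - by move=> x y xL yn; apply: dj1 => //; rewrite mem_cat xL.
  - by move=> x y xL yn; apply: dj2 => //; rewrite mem_cat xL.
pose theta := match_map ((z1 :: leaves B1) ++ n1) ((z2 :: leaves B2) ++ n2) z1.
have bt : bijective theta.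
  exists (match_map ((z2 :: leaves B2) ++ n2) ((z1 :: leaves B1) ++ n1) z2).
    exact: match_mapK.
  by apply: match_mapK => //; apply: same_pairing_sym.
have inj := bij_inj bt.
have to h : theta (opp E2 h) = opp E1 (theta h) by apply: match_map_opp.
have : map theta ((z2 :: leaves B2) ++ n2) = (z1 :: leaves B1) ++ n1 by apply: map_match_map.
clearbody theta.
rewrite map_cat => /eqP; rewrite eqseq_cat; last by rewrite size_map /= sl.
case/andP => /eqP [tz tl] /eqP tn.
have eB : B1 = map_tree theta B2.
  apply: same_shape_eq; first by rewrite shape_map.
    by rewrite leaves_map tl.
  by rewrite nodes_map e1 e2 /= to tz tn.
exists theta; split=> // h.
case: (boolP (h \in tree_ends B2)) => hB.
  move: w1 w2 hB; rewrite eB {sp1 sp2 u1 u2 t1 t2 f1 f2 sh pa p1 e1 p2 e2 c1 c2 uq1 dj1 uq2 dj2 sl sn PA tl tn eB n1 n2 bt inj tz}.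
  elim: B2 {B1} => //= x A IA B IB.
  rewrite !top_map => /and5P [/eqP k1 /eqP k2 /eqP k3 kA kB] /and5P [/eqP l1 /eqP l2 /eqP l3 lA lB].
  rewrite !inE mem_cat => /or4P [/eqP ->|/eqP ->|/eqP ->|/orP [hA|hB]].
  - by rewrite l1 to k1.
  - by rewrite l2 k2.
  - by rewrite l3 to k3.
  - exact: IA.
  - exact: IB.
have hf : G2 h = h by move: hB; rewrite f2 negbK => /eqP.
rewrite hf; apply/esym/eqP; rewrite -[_ == _]negbK -f1.
apply: contra hB => hB.
have : theta h \in (z1 :: leaves B1) ++ n1 ++ map (opp E1) n1 by rewrite -(perm_mem p1).
rewrite (perm_mem p2) -tn -[z1 :: leaves B1]/([:: z1] ++ leaves B1) -tl -tz.
rewrite -[[:: theta z2] ++ _]/(map theta (z2 :: leaves B2)) !mem_cat -map_comp.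
case/or3P => [/mapP [y yn /inj ->]|/mapP [y yn /inj ->]|/mapP [y yn /=]].
- by rewrite yn.
- by rewrite yn !orbT.
- by rewrite -to => /inj ->; rewrite map_f ?orbT.
Qed.

(** * Canonical forms of fatgraphs *)
Fixpoint comb (l : seq shape) : shape :=
  match l with [::] => Sleaf | [:: X] => X | X :: l' => Snode X (comb l') end.

Definition cherry := Snode Sleaf Sleaf.

Definition blocks k n := nseq k cherry ++ nseq n Sleaf.

(** The tree is rooted at the first letter.  The two letters of every tadpole hang from
    a common vertex: those of the first one are the root and the first leaf. *)
Definition canonical_shape k n : shape :=
  if k is k'.+1 then Snode Sleaf (comb (blocks k' n)) else comb (nseq n.-1 Sleaf).

Lemma size_comb l : l <> [::] -> shape_size (comb l) = sumn (map shape_size l).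
Proof. by elim: l => //= S [|S' l] IH _; rewrite ?addn0 //= IH. Qed.

Lemma size_canonical_shape k n : 3 <= 2 * k + n ->
  shape_size (canonical_shape k n) = (2 * k + n).-1.
Proof.
have sb j i : sumn (map shape_size (blocks j i)) = 2 * j + i.
  rewrite /blocks map_cat sumn_cat !map_nseq !sumn_nseq /=; lia.
case: k => [|k] h /=.
  have := sb 0 n.-1; rewrite /blocks [nseq 0 _]/= cat0s => e.
  by rewrite size_comb ?e //; case: n h {e} => [|[|n]].
rewrite size_comb ?sb; first by lia.
by case: k n h => [|k] [|n].
Qed.

Section Canonical.
Context {E : finType}.
Implicit Types (G : fatgraph E) (x y z h a : halfedge E) (t A B C : tree (halfedge E))
  (w s ps ks : seq (halfedge E)).

Lemma comb_cherries G ks : forall t r l, tree_in G t -> leaves t = tadpoles ks ++ r ->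
  shape_of t = comb (nseq (size ks) cherry ++ l) -> forall a, a \in ks -> G a = opp E a.
Proof.
elim: ks => // k ks IH t r l w lt st a.
have ck x A B : tree_in G (Node x A B) -> shape_of A = Sleaf -> shape_of B = Sleaf ->
    forall v, leaves A ++ leaves B = [:: k, opp E k & v] -> G k = opp E k.
  case: A => // a' w0 _; case: B w0 => // b' w0 _ v /= [ea eb _].
  by move: w0; rewrite /= ea eb => /and4P [_ /eqP].
case es: (nseq (size ks) cherry ++ l) => [|S l'].
  have /size0nil ek : size ks = 0 by case: (ks) es.
  have {}st : shape_of t = cherry by rewrite st /= es.
  rewrite ek inE => /eqP ->.
  by case: t w lt st => // x A B w lt [sA sB]; apply: ck w sA sB _ lt.
have {}st : shape_of t = Snode cherry (comb (nseq (size ks) cherry ++ l)).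
  by rewrite st /= es.
case: t w lt st => // x A B w /= lt [sA sB].
case: A w lt sA => // y A1 A2 w lt [sA1 sA2].
have wA : tree_in G (Node y A1 A2) by case/and5P: w.
have [e1 e2] : leaves A1 ++ leaves A2 = [:: k; opp E k] /\ leaves B = tadpoles ks ++ r.
  move: lt => /= /eqP; rewrite -[_ :: _]/([:: k; opp E k] ++ (tadpoles ks ++ r)) eqseq_cat.
    by case/andP => /eqP -> /eqP ->.
  by rewrite size_cat !size_leaves sA1 sA2.
rewrite inE => /predU1P [->|]; first exact: ck wA sA1 sA2 _ e1.
have wB : tree_in G B by case/and5P: w.
exact: IH wB e2 sB a.
Qed.

(** Otherwise the graph would consist of a single edge with two pending ends. *)
Lemma no_isolated_connected G h0 : fg_connected G -> G h0 != h0 -> no_isolated G.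
Proof.
move=> conn n0 h; rewrite -negb_and; apply/negP => /andP [/eqP f1 /eqP f2].
have /connectP [q + e] := conn h h0.
suff H y : path (fun x y => (y == G x) || (y == opp E x)) y q ->
    y \in [:: h; opp E h] -> last y q \in [:: h; opp E h].
  move=> /H; rewrite inE eqxx -e => /(_ isT).
  by rewrite !inE => /orP [] /eqP e'; move: n0; rewrite e' ?f1 ?f2 eqxx.
elim: q y {e} => //= y' q IH y /andP [e pq] yi; apply: IH => //.
by move: yi e; rewrite !inE => /orP [] /eqP -> /orP [] /eqP ->; rewrite ?f1 ?f2 ?oppK eqxx ?orbT.
Qed.

(** Keeping a tree on the left, one meets its leaves backwards: after coming back
    along the opposite of a leaf, the next leaf met is the previous one.  Hence the
    relation r between consecutive letters. *)
Section Walk.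
Variables (G : fatgraph E) (cG : cubic G).
Let face x := porbit (left_turn G) x.
Let r x y := face (opp E y) == face x.

Lemma eq_path_face x y s : face x = face y -> path r x s = path r y s.
Proof. by case: s => //= z s; rewrite /r => ->. Qed.

Lemma walk_tree t : tree_in G t ->
  path r (opp E (top t)) (leaves t) /\
  face (last (opp E (top t)) (leaves t)) = face (top t).
Proof.
elim: t => [x|x A IA B IB] /=; first by rewrite /r eqxx.
move=> /and5P [/eqP w1 /eqP w2 /eqP w3 /IA [pA lA] /IB [pB lB]].
have st y z : left_turn G y = z -> face y = face z.
  by move <-; rewrite /face porbit_step.
have e1 : face (opp E (top A)) = face (opp E x).
  by apply: st; rewrite left_turnE // oppK w2 w3.
have e2 : face (opp E (top B)) = face (top A).
  by apply: st; rewrite left_turnE // oppK w3 w1.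
have e3 : face x = face (top B) by apply: st; rewrite left_turnE // w1 w2.
rewrite cat_path last_cat -(eq_path_face _ e1) pA /=.
have nA := @leaves_nil _ A; have nB := @leaves_nil _ B.
have eA : face (last (opp E x) (leaves A)) = face (top A).
  by rewrite -lA; case: (leaves A) nA.
rewrite (eq_path_face _ eA) -(eq_path_face _ e2) pB; split=> //.
by rewrite e3 -lB; case: (leaves B) nB.
Qed.

Lemma walk_tree_mem t h : tree_in G t -> h \in tree_ends t ->
  exists2 x, x \in leaves t & (face h == face x) || (face h == face (opp E x)).
Proof.
have tp t' : tree_in G t' ->
  (exists2 x, x \in leaves t' & face (top t') == face x) /\
  (exists2 x, x \in leaves t' & face (opp E (top t')) == face (opp E x)).
  move=> /walk_tree []; case e: (leaves t') => [|y s]; first by case: (leaves_nil e).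
  move=> /= /andP [/eqP p1 _] p2; split.
    by exists (last y s); [rewrite mem_last | rewrite -p2].
  by exists y; rewrite ?mem_head // -p1.
elim: t => //= x A IA B IB w; have [_ [x0 x0l x0e]] := tp (Node x A B) w.
have /and5P [/eqP w1 /eqP w2 /eqP w3 wA wB] := w.
have [[a1 a1l a1e] _] := tp _ wA; have [[b1 b1l b1e] _] := tp _ wB.
rewrite !inE mem_cat => /or4P [/eqP ->|/eqP ->|/eqP ->|/orP [hA|hB]].
- by exists x0; rewrite // x0e orbT.
- by exists a1; rewrite ?mem_cat ?a1l ?a1e.
- by exists b1; rewrite ?mem_cat ?b1l ?b1e ?orbT.
- by have [y yl ye] := IA wA hA; exists y; rewrite ?mem_cat ?yl.
- by have [y yl ye] := IB wB hB; exists y; rewrite ?mem_cat ?yl ?orbT.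
Qed.

Lemma walk_spanning z B : spanning G z B -> no_isolated G ->
  path r (last z (leaves B)) (z :: leaves B) /\
  forall h, exists2 x, x \in z :: leaves B & face h = face x.
Proof.
move=> [w u e c] ni.
have [p1 p2] := walk_tree w; rewrite e oppK in p1 p2.
have cyc : path r (last z (leaves B)) (z :: leaves B).
  by rewrite /= /r -p2 eqxx.
split=> //.
have op x : x \in z :: leaves B -> exists2 y, y \in z :: leaves B & face (opp E x) = face y.
  have : last z (leaves B) \in z :: leaves B by exact: mem_last.
  move: (last z _) (z :: leaves B) cyc => q v + qv xv.
  case/splitPr: xv qv => s1 s2 qv; rewrite cat_path /= => /and3P [_ /eqP -> _].
  exists (last q s1) => //; case/lastP: s1 qv => [//|s1 y] _.
  by rewrite last_rcons mem_cat mem_rcons inE eqxx.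
have ov h : h \in tree_ends B -> exists2 x, x \in z :: leaves B & face h = face x.
  move=> /(walk_tree_mem w) [x xl /orP [] /eqP fx].
    by exists x; rewrite ?inE ?xl ?orbT.
  by rewrite fx; apply: op; rewrite inE xl orbT.
move=> h; case: (boolP (G h == h)) => [/eqP hf|hn]; last by apply: ov; rewrite c.
have : opp E h \in tree_ends B by rewrite c; have := ni h; rewrite hf eqxx.
move=> /ov [x xw fx]; exists x => //; rewrite -fx /face -[in RHS]porbit_step.
by rewrite left_turnE // oppK !hf.
Qed.

(** Coming from q, the face goes on with the second letter of a tadpole, while the
    first letter bounds a face of its own. *)
Lemma path_tadpoles q ks s : path r q (tadpoles ks ++ s) ->
  exists2 q', face q' = face q & path r q' s /\ forall x, x \in tadpoles ks -> x \in ks \/ face x = face q.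
Proof.
elim: ks q => [|k ks IH] q /=; first by exists q.
rewrite /r oppK => /and3P [/eqP e _ /IH [q' e' [p H]]].
exists q'; [by rewrite e' e | split=> // x].
rewrite !inE => /or3P [/eqP ->|/eqP ->|/H [->|->]]; rewrite ?eqxx ?orbT; [by left|by right|by left|].
by right.
Qed.

(** The face entering a handle runs through all four letters before leaving it. *)
Lemma path_handles q cs s : path r q (handles cs ++ s) ->
  exists2 q', face q' = face q & path r q' s /\ forall x, x \in handles cs -> face x = face q.
Proof.
elim: cs q => [|[a b] cs IH] q /=; first by exists q.
rewrite /r !oppK => /and5P [/eqP e1 /eqP e2 /eqP e3 /eqP e4 /IH [q' e' [p H]]].
have f4 : face (opp E b) = face q by rewrite e2 e3 e4.
exists q'; [by rewrite e' f4 | split=> // x].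
rewrite !inE => /or4P [/eqP ->|/eqP ->|/eqP ->|/orP [/eqP ->|/H ->]] //.
- by rewrite e3 e4.
- by rewrite e4.
Qed.

Lemma path_pending q ps : path r q ps -> all (fun x => G (opp E x) == opp E x) ps ->
  forall x, x \in ps -> face x = face q.
Proof.
elim: ps q => //= p ps IH q /andP [/eqP e pp] /andP [/eqP fp ap] x.
have fpp : face p = face q.
  by rewrite -e /face -porbit_step left_turnE // !fp.
by rewrite inE => /predU1P [-> //|/(IH _ pp ap)]; rewrite fpp.
Qed.

(** One face for each tadpole, and a single one for all the other letters. *)
Lemma card_faces z B ks cs ps : spanning G z B -> no_isolated G ->
  z :: leaves B = tadpoles ks ++ handles cs ++ ps ->
  uniq ks -> (forall a, a \in ks -> G a = opp E a) ->
  all (fun x => G (opp E x) == opp E x) ps ->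
  #|porbits (left_turn G)| = (size ks).+1.
Proof.
move=> sp ni ew uk kf pp.
have [cyc fc] := walk_spanning sp ni.
set q := last z _ in cyc; rewrite ew in cyc fc.
have [q1 e1 [c1 m1]] := path_tadpoles cyc.
have [q2 e2 [c2 m2]] := path_handles c1.
have m3 := path_pending c2 pp.
have cls x : x \in tadpoles ks ++ handles cs ++ ps -> x \in ks \/ face x = face q.
  rewrite !mem_cat => /or3P [/m1 //|/m2 ->|/m3 ->]; right; by rewrite ?e2 ?e1.
have kfix a : a \in ks -> left_turn G a = a.
  by move=> ak; rewrite left_turnE // -(kf _ ak) cG.
have face1 a : a \in ks -> face a = [set a].
  move=> ak; apply/setP => y; rewrite inE; apply/porbitP/eqP => [[i ->]|->].
    by elim: i => [|i IH]; rewrite ?perm1 // expgSr permM IH kfix.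
  by exists 0; rewrite perm1.
have kq a : a \in ks -> face q <> face a.
  move=> ak fq; have aw : opp E a \in tadpoles ks.
    by apply: tadpoles_opp; apply/flattenP; exists [:: a; opp E a]; rewrite ?inE ?eqxx ?map_f.
  have := cls (opp E a); rewrite mem_cat aw => /(_ isT) [ok|fo].
    have := cG a; rewrite (kf _ ak) (kf _ ok) oppK (kf _ ak) => e.
    by have := opp_neq a; rewrite e eqxx.
  have : opp E a \in face (opp E a) by rewrite /face porbit_id.
  by rewrite fo fq face1 // inE (negbTE (opp_neq a)).
(* q, the last letter of the word, lies on the large face. *)
have -> : porbits (left_turn G) = face q |: [set face a | a in ks].
  apply/setP => O; rewrite !inE; apply/imsetP/idP => [[h _ ->]|].
    rewrite -/(face h); have [x xw ->] := fc h; case/cls: xw => [xk|->]; last by rewrite eqxx.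
    by rewrite (imset_f face xk) orbT.
  case/predU1P => [->|/imsetP [a _ ->]]; first by exists q.
  by exists a.
rewrite cardsU1 card_in_imset; last first.
  by move=> a b ak bk; rewrite !face1 // => /set1_inj.
have -> : face q \notin [set face a | a in ks].
  by apply/imsetP => -[a ak]; apply: kq.
by have /card_uniqP -> := uk.
Qed.

End Walk.
End Canonical.

Lemma size_tadpoles (E : finType) (ks : seq (halfedge E)) : size (tadpoles ks) = 2 * size ks.
Proof. by elim: ks => //= a ks ->; lia. Qed.

Lemma size_handles (E : finType) (cs : seq (halfedge E * halfedge E)) :
  size (handles cs) = 4 * size cs.
Proof. by elim: cs => //= a ks ->; lia. Qed.

Section CanonicalForm.
Context {E : finType}.
Implicit Types (G : fatgraph E) (x y z h a : halfedge E) (t A B C : tree (halfedge E))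
  (w s ps ks : seq (halfedge E)).

Lemma reach_spanning G h0 z s S : cubic G -> G h0 != h0 -> reach G (z :: s) ->
  shape_size S = size s ->
  exists G' B, [/\ flip_path G G', spanning G' z B, leaves B = s & shape_of B = S].
Proof.
move=> cG n0 [G1 p1 [L pw c]] sz.
have c1 := flip_path_cubic cG p1.
have [B [[_ w u e] pB lB]] := partial_word_root pw.
have [|G2 [B' [r l' s']]] := reshape_shape c1 w u (S := S); first by rewrite lB sz.
exists G2, B'; split=> //; [exact: flip_path_trans (reshape_path r)| |by rewrite l'].
split; [exact: reshape_tree r | by rewrite (reshape_uniq r)| by rewrite (reshape_top r) e|].
move=> h; rewrite (perm_mem (reshape_ends r)) (perm_mem pB) c.
by rewrite (flip_path_fix c1 (reshape_path r)).
Qed.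

Definition pending_ends G := [set h | G h == h].

(** The last three fields express the sizes of ks and ps and the length of the word by
    numbers that flips preserve. *)
Record canonical_form G ps ks cs z B : Prop := CanonicalForm {
  cf_spanning : spanning G z B;
  cf_no_isolated : no_isolated G;
  cf_word : z :: leaves B = tadpoles ks ++ handles cs ++ ps;
  cf_uniq : uniq (z :: leaves B);
  cf_shape : shape_of B = canonical_shape (size ks) (size (handles cs ++ ps));
  cf_pending : forall x y, x \in ps -> y \in ps -> x != opp E y;
  cf_faces : #|porbits (left_turn G)| = (size ks).+1;
  cf_ends : #|pending_ends G| = size ps;
  cf_edges : #|{: halfedge E}| + 6 = 3 * size (z :: leaves B) + size ps }.

Lemma canonical_form_ex G h0 : cubic G -> fg_connected G -> G h0 != h0 ->
  exists G', flip_path G G' /\ exists ps ks cs z B, canonical_form G' ps ks cs z B.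
Proof.
move=> cG conn n0; have ni := no_isolated_connected conn n0.
have [w0 H0] := has_word_ex cG conn n0.
have R0 : reach G w0 by exists G => //; apply: flip_path_refl.
have [ps [ks [cs [pps R1]]]] := reach_normal_word cG n0 R0.
have {R0 R1 w0 H0} R : reach G (tadpoles ks ++ handles cs ++ ps).
  by apply: (reach_rot (u := ps)) R1 _ _; rewrite // -!catA.
have [n [sw sn]] := reach_size cG n0 R.
have [uw l1 l2] := reach_letters cG n0 R.
case ew : (tadpoles ks ++ handles cs ++ ps) => [|z s]; first by move: sw; rewrite ew /= addn3.
have szw : 2 * size ks + size (handles cs ++ ps) = (size s).+1.
  by rewrite -size_tadpoles -size_cat ew.
have sz3 : 3 <= 2 * size ks + size (handles cs ++ ps).
  by rewrite szw; move: sw; rewrite ew /= => ->; rewrite addn3.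
have [||G' [B [p sp lB sB]]] := @reach_spanning G h0 z s
    (canonical_shape (size ks) (size (handles cs ++ ps))) cG n0.
- by rewrite -ew.
- by rewrite size_canonical_shape // szw.
exists G'; split=> //; exists ps, ks, cs, z, B.
have cG' := flip_path_cubic cG p.
have fx := flip_path_fix cG p.
have ni' : no_isolated G' by move=> h; rewrite !fx.
have ezw : z :: leaves B = tadpoles ks ++ handles cs ++ ps by rewrite lB ew.
have pps' : all (fun x => G' (opp E x) == opp E x) ps.
  by apply/allP => x xp; rewrite fx; apply: (allP pps).
have uks : uniq ks.
  move: uw; rewrite cat_uniq => /andP [+ _].
  elim: ks {R ew szw sz3 sB ezw l1 l2 sw} => //= a ks IH; rewrite !inE !negb_or -!andbA.
  case/and4P => _ nk _ /IH ->; rewrite andbT.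
  apply: contra nk => ak; apply/flattenP; exists [:: a; opp E a]; rewrite ?inE ?eqxx //.
  by rewrite map_f.
have kf a : a \in ks -> G' a = opp E a.
  have [w _ _ _] := sp.
  case: (ks) ew sB lB => // k ks' /= [ez es] sB lB.
  case: B sp sB lB w {ezw} => // x A1 A2 sp [sA sB] lB w.
  case: A1 w sp sA lB => // y w sp _ /=; rewrite -es => -[ey lA2].
  rewrite inE => /predU1P [->|].
    move: w => /= /and4P [/eqP + _ _ _]; have [_ _ /= -> _] := sp.
    by rewrite oppK -ez ey.
  by apply: comb_cherries lA2 sB _; move: w => /= /and4P [].
have ends : pending_ends G' = [set opp E x | x in ps].
  apply/setP => h; rewrite inE; apply/idP/imsetP => [hf|[x xp ->]]; last exact: (allP pps').
  exists (opp E h); last by rewrite oppK.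
  have [e _] := spanning_inner sp ni'; have [_ u _ c] := sp.
  have nh : h \notin tree_ends B by rewrite c negbK.
  have : opp E h \in tree_ends B by rewrite c; have := ni' h; rewrite hf.
  rewrite (perm_mem e) !mem_cat => /or3P [|hi|/mapP [y yn /perm_inj hy]]; last 2 first.
  - by case/negP: nh; rewrite (perm_mem e) !mem_cat -[h]oppK (map_f _ hi) !orbT.
  - by case/negP: nh; rewrite (perm_mem e) !mem_cat hy yn !orbT.
  have nw : h \notin tadpoles ks ++ handles cs ++ ps.
    by apply: contra nh; rewrite -ezw (perm_mem e) mem_cat => ->.
  rewrite ezw !mem_cat => /or3P [/tadpoles_opp|/handles_opp|//]; rewrite oppK => hi;
    by case/negP: nw; rewrite !mem_cat hi ?orbT.
have ce : #|pending_ends G'| = size ps.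
  rewrite ends card_imset; last exact: perm_inj.
  move: uw; rewrite catA cat_uniq => /and3P [_ _ /card_uniqP <-].
  by apply: eq_card.
split=> //.
- by rewrite lB -ew.
- move=> x y xp yp; apply: contraTneq (allP pps _ yp) => e.
  by apply: l2; rewrite -?e !mem_cat ?xp ?yp !orbT.
- exact: (card_faces cG' sp ni' ezw).
- rewrite -ce ezw sw -(cardsC (pending_ends G')).
  have -> : #|~: pending_ends G'| = 3 * n.+1.
    by rewrite -sn; apply: eq_card => h; rewrite !inE fx.
  by lia.
Qed.

End CanonicalForm.

(** The blocks of a normal word are closed under opposites, so no letter of a block is
    paired with a letter outside it. *)
Section SamePairing.
Context {E1 E2 : finType}.
Implicit Types (r : seq (halfedge E1)) (v : seq (halfedge E2)).

Lemma cross_closed (E : finType) (s r : seq (halfedge E)) : uniq (s ++ r) ->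
  (forall x, x \in s -> opp E x \in s) ->
  forall x y, x \in s -> y \in r -> x != opp E y.
Proof.
rewrite cat_uniq => /and3P [_ hn _] cl x y xs yr; apply: contraNneq hn => e.
by apply/hasP; exists y => //; rewrite -[y]oppK -e cl.
Qed.

Lemma same_pairing_tadpoles ks1 ks2 r v : size ks1 = size ks2 ->
  uniq (tadpoles ks1 ++ r) -> uniq (tadpoles ks2 ++ v) -> same_pairing r v ->
  same_pairing (tadpoles ks1 ++ r) (tadpoles ks2 ++ v).
Proof.
elim: ks1 ks2 => [|a ks1 IH] [|b ks2] //= [/IH {}IH] u1 u2 P.
apply: (@same_pairing_cat _ _ [:: a; opp E1 a] _ [:: b; opp E2 b]).
- have fl (E : finType) (c : halfedge E) : ((c == opp E c) = false) * ((opp E c == c) = false).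
    by rewrite [c == _]eq_sym (negbTE (opp_neq c)).
  split=> // p q; rewrite /= !inE => /orP [] /eqP -> /orP [] /eqP -> /=;
    by rewrite ?oppK ?eqxx // !fl.
- by apply: IH => //; [case/and3P: u1 | case/and3P: u2].
- apply: cross_closed => // x; rewrite !inE => /orP [] /eqP ->; by rewrite ?oppK eqxx ?orbT.
- apply: cross_closed => // x; rewrite !inE => /orP [] /eqP ->; by rewrite ?oppK eqxx ?orbT.
Qed.

Lemma same_pairing_handles cs1 cs2 r v : size cs1 = size cs2 ->
  uniq (handles cs1 ++ r) -> uniq (handles cs2 ++ v) -> same_pairing r v ->
  same_pairing (handles cs1 ++ r) (handles cs2 ++ v).
Proof.
elim: cs1 cs2 => [|[a a'] cs1 IH] [|[b b'] cs2] //= [/IH {}IH] u1 u2 P.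
have cl (E : finType) (c c' x : halfedge E) : x \in [:: c; c'; opp E c; opp E c'] ->
    opp E x \in [:: c; c'; opp E c; opp E c'].
  by rewrite !inE => /or4P [] /eqP ->; rewrite ?oppK eqxx ?orbT.
have ne (E : finType) (c c' : halfedge E) s : uniq [:: c, c', opp E c, opp E c' & s] ->
   [/\ c != c', c != opp E c', c != opp E c, c' != opp E c & c' != opp E c'].
  by rewrite /= !inE !negb_or -!andbA => /and5P [-> -> -> _ /and4P [-> -> _ _]].
have [n1 n2 n3 n4 n5] := ne _ _ _ _ u1; have [m1 m2 m3 m4 m5] := ne _ _ _ _ u2.
have fl (T : eqType) (x y : T) : x != y -> ((x == y) = false) * ((y == x) = false).
  by rewrite [y == x]eq_sym => /negbTE ->.
apply: (@same_pairing_cat _ _ [:: a; a'; opp E1 a; opp E1 a'] _ [:: b; b'; opp E2 b; opp E2 b']).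
- split=> // p q; rewrite /= !inE => /or4P [] /eqP -> /or4P [] /eqP -> /=;
    rewrite ?oppK ?eqxx // ?(inj_eq perm_inj) ?opp_eq;
    by rewrite ?(fl _ _ _ n1, fl _ _ _ n2, fl _ _ _ n3, fl _ _ _ n4, fl _ _ _ n5, fl _ _ _ m1, fl _ _ _ m2, fl _ _ _ m3, fl _ _ _ m4, fl _ _ _ m5).
- by apply: IH => //; [case/and5P: u1 | case/and5P: u2].
- by apply: cross_closed => // x; apply: cl.
- by apply: cross_closed => // x; apply: cl.
Qed.

End SamePairing.

(** The three numbers determine the canonical form; G1 is flipped into it, and the
    flips that bring G2 into it are undone on the isomorphic copy. *)
Theorem flip_connected (E1 E2 : finType) (G1 : fatgraph E1) (G2 : fatgraph E2) h1 h2 :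
  cubic G1 -> cubic G2 -> fg_connected G1 -> fg_connected G2 ->
  G1 h1 != h1 -> G2 h2 != h2 -> #|E1| = #|E2| ->
  #|pending_ends G1| = #|pending_ends G2| ->
  #|porbits (left_turn G1)| = #|porbits (left_turn G2)| ->
  exists G theta, flip_path G1 G /\ fatgraph_iso G G2 theta.
Proof.
move=> c1 c2 cn1 cn2 n1 n2 eE em ef.
have [X1 [p1 [ps1 [ks1 [cs1 [z1 [B1 f1]]]]]]] := canonical_form_ex c1 cn1 n1.
have [X2 [p2 [ps2 [ks2 [cs2 [z2 [B2 f2]]]]]]] := canonical_form_ex c2 cn2 n2.
have ek : size ks1 = size ks2.
  apply: succn_inj; rewrite -(cf_faces f1) -(cf_faces f2).
  by rewrite -(flip_path_faces c1 p1) -(flip_path_faces c2 p2).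
have ep : size ps1 = size ps2.
  rewrite -(cf_ends f1) -(cf_ends f2).
  have -> : pending_ends X1 = pending_ends G1.
    by apply/setP => h; rewrite !inE (flip_path_fix c1 p1).
  by rewrite em; apply: eq_card => h; rewrite !inE (flip_path_fix c2 p2).
have ec : size cs1 = size cs2.
  have := cf_edges f1; have := cf_edges f2.
  rewrite !(cf_word f1) !(cf_word f2) !size_cat !size_tadpoles !size_handles.
  rewrite !card_prod eE ek ep; lia.
have [theta i] : exists theta, fatgraph_iso X1 X2 theta.
  apply: (spanning_iso (cf_spanning f1) (cf_spanning f2) (cf_no_isolated f1) (cf_no_isolated f2)).
    by rewrite (cf_shape f1) (cf_shape f2) ek !size_cat !size_handles ec ep.
  have := cf_uniq f1; have := cf_uniq f2; rewrite (cf_word f1) (cf_word f2) => u2 u1.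
  apply: same_pairing_tadpoles => //; apply: same_pairing_handles => //.
  - by move: u1; rewrite cat_uniq => /and3P [].
  - by move: u2; rewrite cat_uniq => /and3P [].
  - by apply: same_pairing_none => //; [exact: cf_pending f1 | exact: cf_pending f2].
have [G q j] := iso_path i (flip_path_sym c2 p2).
by exists G, theta; split=> //; apply: flip_path_trans q.
Qed.

Import Order.TTheory GRing.Theory Num.Theory.
Import numFieldNormedType.Exports.
Local Open Scope classical_set_scope.
Local Open Scope ring_scope.

(** * Functions polynomial in exponentials of the coordinates *)
Section ExpPoly.
Context {R : realType} {E : finType}.
Implicit Types (f g : (E -> R) -> R) (Z : E -> R).

(** A class that contains the geodesic functions and is closed under the bracket, with
    explicit partial derivatives: [pderiv] is total, so the chain rule needs
    such a class. *)
Inductive gradient : ((E -> R) -> R) -> (E -> (E -> R) -> R) -> Prop :=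
| gradient_cst c : gradient (cst c) (fun _ => cst 0)
| gradient_exp c e : gradient (fun Z => expR (c * Z e))
    (fun e' Z => (c *+ (e' == e)) * expR (c * Z e))
| gradient_add f g df dg : gradient f df -> gradient g dg ->
    gradient (f \+ g) (fun e => df e \+ dg e)
| gradient_mul f g df dg : gradient f df -> gradient g dg ->
    gradient (f \* g) (fun e => df e \* g \+ f \* dg e).

Definition exp_poly f : Prop := exists df, gradient f df.

Lemma gradient_chain f df (c : R -> E -> R) (t : R) (J : E -> R) :
  (forall e, is_derive t 1 (fun s => c s e) (J e)) -> gradient f df ->
  is_derive t 1 (fun s => f (c s)) (\sum_e df e (c t) * J e).
Proof.
move=> Hc; elim=> {f df} [k|k e|f g df dg _ If _ Ig|f g df dg _ If _ Ig].
- rewrite big1 => [|e _]; last by rewrite mul0r.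
  exact: is_derive_cst.
- have H : is_derive t 1 (fun s => k * c s e) (k * J e) := is_deriveZ k (Hc e).
  have := @is_derive1_comp R expR (fun s => k * c s e) t _ _ (is_derive_expR _) H.
  move=> H2; apply: (is_derive_eq H2); rewrite (bigD1 e) //= eqxx big1 ?addr0.
    by rewrite mulr1n; ring.
  by move=> e' /negbTE ->; rewrite mulr0n !mul0r.
- have := is_deriveD If Ig; move=> H; apply: (is_derive_eq H).
  by rewrite -big_split; apply: eq_bigr => e _; rewrite /= mulrDl.
- have := is_deriveM If Ig; move=> H; apply: (is_derive_eq H).
  rewrite /GRing.scale /= !mulr_sumr -big_split; apply: eq_bigr => e _ /=; ring.
Qed.

Lemma is_derive_line Z e e' :
  is_derive (Z e) 1 (fun t : R => [eta Z with e |-> t] e') ((e' == e)%:R : R).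
Proof.
rewrite /=; case: eqP => _; [exact: is_derive_id | exact: is_derive_cst].
Qed.

Lemma line_id Z e : [eta Z with e |-> Z e] = Z :> (E -> R).
Proof. by apply/funext => x /=; case: eqP => [->|]. Qed.

Lemma pderiv_gradient f df e Z : gradient f df -> pderiv e f Z = df e Z.
Proof.
move=> H; rewrite /pderiv derive1E.
have D := gradient_chain (is_derive_line Z e) H.
rewrite (@derive_val _ _ _ _ _ _ _ D) (bigD1 e) //= eqxx mulr1 big1 ?addr0.
  by congr (df e _); exact: line_id.
by move=> e' /negbTE ->; rewrite mulr0.
Qed.

Lemma gradient_poly f df e : gradient f df -> exp_poly (df e).
Proof.
elim=> {f df} [k|k e'|f g df dg hf [ddf If] hg [ddg Ig]|f g df dg hf [ddf If] hg [ddg Ig]].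
- by eexists; apply: gradient_cst.
- by eexists; apply: (gradient_mul (gradient_cst _) (gradient_exp _ _)).
- by eexists; apply: gradient_add If Ig.
- by eexists; apply: gradient_add (gradient_mul If hg) (gradient_mul hf Ig).
Qed.

Lemma exp_poly_cst c : exp_poly (cst c).
Proof. by eexists; apply: gradient_cst. Qed.
Lemma exp_poly_exp c e : exp_poly (fun Z => expR (c * Z e)).
Proof. by eexists; apply: gradient_exp. Qed.
Lemma exp_polyD f g : exp_poly f -> exp_poly g -> exp_poly (f \+ g).
Proof. by move=> [? ?] [? ?]; eexists; apply: gradient_add; eassumption. Qed.
Lemma exp_polyM f g : exp_poly f -> exp_poly g -> exp_poly (f \* g).
Proof. by move=> [? ?] [? ?]; eexists; apply: gradient_mul; eassumption. Qed.
Lemma exp_poly_sum (I : Type) (r : seq I) (P : pred I) (F : I -> (E -> R) -> R) :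
  (forall i, exp_poly (F i)) -> exp_poly (fun Z => \sum_(i <- r | P i) F i Z).
Proof.
move=> H; elim: r => [|i r IH].
  rewrite (_ : (fun _ => _) = cst 0); first exact: exp_poly_cst.
  by apply/funext => Z; rewrite big_nil.
have [Pi|Pi] := boolP (P i).
  rewrite (_ : (fun _ => _) = F i \+ (fun Z => \sum_(i <- r | P i) F i Z)).
    exact: exp_polyD.
  by apply/funext => Z; rewrite big_cons Pi.
rewrite (_ : (fun _ => _) = (fun Z => \sum_(i <- r | P i) F i Z)) //.
by apply/funext => Z; rewrite big_cons (negbTE Pi).
Qed.

Lemma exp_poly_pderiv f e : exp_poly f -> exp_poly (pderiv e f).
Proof.
move=> [df H]; rewrite (_ : pderiv e f = df e); first exact: gradient_poly H.
by apply/funext => Z; apply: pderiv_gradient.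
Qed.

Lemma exp_poly_bracket G f g : exp_poly f -> exp_poly g -> exp_poly (bracket G f g).
Proof.
move=> hf hg; apply: exp_poly_sum => v; apply: exp_poly_sum => h.
rewrite (_ : pwedge _ _ _ _ = (pderiv h.1 f \* pderiv (G h).1 g) \+
   (cst (-1) \* (pderiv (G h).1 f \* pderiv h.1 g))); last first.
  by apply/funext => Z; rewrite /pwedge /= mulN1r.
apply: exp_polyD; first by apply: exp_polyM; apply: exp_poly_pderiv.
apply: exp_polyM; first exact: exp_poly_cst.
by apply: exp_polyM; apply: exp_poly_pderiv.
Qed.

(** The bracket of two functions whose gradients at a point are u and v. *)
Definition wedge_sum (G : fatgraph E) (u v : E -> R) : R :=
  \sum_h (u h.1 * v (G h).1 - u (G h).1 * v h.1).

(** The one-valent vertices may be included, since the wedge of an edge with itself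
    vanishes. *)
Lemma bracketE G f g Z : cubic G ->
  bracket G f g Z = wedge_sum G (pderiv^~ f ^~ Z) (pderiv^~ g ^~ Z).
Proof.
move=> cG; rewrite /bracket /wedge_sum.
rewrite [RHS](partition_big (porbit G) (mem (porbits G))) /=; last first.
  by move=> h _; apply: imset_f.
rewrite [RHS](bigID (fun v : {set halfedge E} => #|v| == 3%N)) /=.
rewrite [X in _ = _ + X]big1 ?addr0; last first.
  move=> v /andP [/imsetP [x _ ->] n3]; apply: big1 => h hx.
  suff -> : G h = h by rewrite subrr.
  apply/eqP; apply: contraNT n3; rewrite -(eqP hx) => nh.
  have u := cubic_uniq cG nh.
  rewrite -[3%N]/(size [:: h; G h; G (G h)]) -(card_uniqP u); apply/eqP/eq_card => y.
  by rewrite porbit_cubic.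
apply: eq_bigr => v /andP [/imsetP [x _ ->] _]; apply: eq_bigl => h.
by rewrite eq_porbit_mem.
Qed.

End ExpPoly.

(** * The bracket under flips *)
Section Wedge.
Context {R : realType} {E : finType}.
Implicit Types (G : fatgraph E) (u v : E -> R) (h a b c d y z : halfedge E).

Lemma sum_split (L : seq (halfedge E)) (F : halfedge E -> R) : uniq L ->
  \sum_h F h = \sum_(h <- L) F h + \sum_(h | h \notin L) F h.
Proof. by move=> uL; rewrite (bigID (mem L)) /= -big_uniq. Qed.

(** The hypotheses on u' and v' are the chain rule.  With p + q = 1, the terms in
    which the flipped edge has been replaced by its neighbours rearrange into the
    wedges at the two new vertices. *)
Lemma inner_wedge_sum G G' h a b c d p q u v u' v' :
  inner_data h a b c d G G' -> p + q = 1 ->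
  (forall e, u' e = if e == h.1 then - u e + p * u a.1 + q * u b.1 + p * u c.1 + q * u d.1 else u e) ->
  (forall e, v' e = if e == h.1 then - v e + p * v a.1 + q * v b.1 + p * v c.1 + q * v d.1 else v e) ->
  wedge_sum G u' v' = wedge_sum G' u v.
Proof.
move=> D pq eu ev; have cl := inner_data_closed D.
case: D => [uL [[e1 e2 e3] [e4 e5 e6]] [[f1 f2 f3] [f4 f5 f6]] fr].
have nh x : x \notin [:: h; opp E h] -> (x.1 == h.1) = false.
  by rewrite !inE negb_or same_edge => /andP [/negbTE -> /negbTE ->].
have sub x : x \notin [:: h; a; b; opp E h; c; d] -> x \notin [:: h; opp E h].
  by apply: contra; rewrite !inE => /orP [] ->; rewrite ?orbT.
have mm := uL; move: mm; rewrite /= !inE !negb_or -!andbA.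
case/and5P => n1 n2 n3 n4 /and5P [n5 n6 n7 n8 /and5P [n9 n10 n11 n12 /and4P [n13 n14 n15 _]]].
have ha : (a.1 == h.1) = false by apply: nh; rewrite !inE negb_or eq_sym n1 n7.
have hb : (b.1 == h.1) = false by apply: nh; rewrite !inE negb_or eq_sym n2 n10.
have hc : (c.1 == h.1) = false by apply: nh; rewrite !inE negb_or eq_sym n4 eq_sym n13.
have hd : (d.1 == h.1) = false by apply: nh; rewrite !inE negb_or eq_sym n5 eq_sym n14.
rewrite /wedge_sum (sum_split _ uL) [RHS](sum_split _ uL); congr (_ + _); last first.
  apply: eq_bigr => x nx; rewrite fr // !eu !ev !nh //; apply: sub => //; exact: cl.
rewrite !big_cons !big_nil !(e1, e2, e3, e4, e5, e6, f1, f2, f3, f4, f5, f6) opp_fst.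
rewrite !eu !ev eqxx ha hb hc hd (_ : q = 1 - p); last by rewrite -pq addrC addKr.
ring.
Qed.

(** Here the sum of the coefficients is 2: the wedge of the two neighbours changes
    sign, as their cyclic order at the vertex does. *)
Lemma pending_wedge_sum G G' h y z p q u v u' v' :
  pending_data h y z G G' -> p + q = 2 ->
  (forall e, u' e = if e == h.1 then - u e + p * u y.1 + q * u z.1 else u e) ->
  (forall e, v' e = if e == h.1 then - v e + p * v y.1 + q * v z.1 else v e) ->
  wedge_sum G u' v' = wedge_sum G' u v.
Proof.
move=> D pq eu ev; have cl := pending_data_closed D; have no := pending_data_opp D.
case: D => [uL po [e1 e2 e3] [f1 f2 f3] fr].
have nh x : x \notin [:: h; opp E h] -> (x.1 == h.1) = false.
  by rewrite !inE negb_or same_edge => /andP [/negbTE -> /negbTE ->].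
have mm := uL; move: mm; rewrite /= !inE !negb_or -!andbA => /and4P [n1 n2 n3 _].
move: (no); rewrite !inE !negb_or => /and3P [m1 m2 m3].
have hy : (y.1 == h.1) = false by apply: nh; rewrite !inE negb_or eq_sym n1 eq_sym m2.
have hz : (z.1 == h.1) = false by apply: nh; rewrite !inE negb_or eq_sym n2 eq_sym m3.
rewrite /wedge_sum (sum_split _ uL) [RHS](sum_split _ uL); congr (_ + _); last first.
  apply: eq_bigr => x nx; rewrite fr //.
  have [->|xo] := eqVneq x (opp E h); first by rewrite po !subrr.
  have xh : x != h by apply: contraNneq nx => ->; rewrite mem_head.
  have Gh : G x != h by apply: contraNneq (cl _ nx) => ->; rewrite mem_head.
  have Go : G x != opp E h by rewrite -po (inj_eq perm_inj).
  by rewrite !eu !ev !nh // !inE negb_or ?xh ?Gh.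
rewrite !big_cons !big_nil !(e1, e2, e3, f1, f2, f3).
rewrite !eu !ev eqxx hy hz (_ : q = 2 - p); last by rewrite -pq addrC addKr.
ring.
Qed.

(** The derivative of [phi]. *)
Definition sigmoid (x : R) : R := expR x / (1 + expR x).

Lemma sigmoidN x : sigmoid x + sigmoid (- x) = 1.
Proof.
rewrite /sigmoid expRN; have := expR_gt0 x; set w := expR x => w0.
field; apply/andP; split; lra.
Qed.

Lemma is_derive_phi (x : R) : is_derive x 1 (phi : R -> R) (sigmoid x).
Proof.
have w0 : 0 < 1 + expR x by have := expR_gt0 x; lra.
have H0 : is_derive x 1 (fun y : R => 1 + expR y) (0 + expR x) :=
  is_deriveD (is_derive_cst _ _ _) (is_derive_expR x).
have H : is_derive x 1 (fun y : R => 1 + expR y) (expR x).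
  by apply: (is_derive_eq H0); rewrite add0r.
have := @is_derive1_comp R (@ln R) (fun y : R => 1 + expR y) x _ _ (is_derive1_ln w0) H.
by move=> H2; apply: (is_derive_eq H2); rewrite /sigmoid mulrC.
Qed.

Lemma is_derive_phi_lin (k x : R) :
  is_derive x 1 (fun t : R => phi (k * t)) (k * sigmoid (k * x)).
Proof.
have H0 : is_derive x 1 (fun t : R => k * t) (k * 1) :=
  is_deriveZ k (is_derive_id _ _).
have H : is_derive x 1 (fun t : R => k * t) k by apply: (is_derive_eq H0); rewrite mulr1.
have := @is_derive1_comp R phi (fun t : R => k * t) x _ _ (is_derive_phi _) H.
by move=> H2; apply: (is_derive_eq H2); rewrite mulrC.
Qed.

Lemma sum_delta (F : E -> R) x : \sum_e F e * (e == x)%:R = F x.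
Proof.
rewrite (bigD1 x) //= eqxx mulr1 big1 ?addr0 // => e /negbTE ->.
by rewrite mulr0.
Qed.

Lemma is_derive_val (f : R -> R) (x df df' : R) :
  is_derive x 1 f df -> df = df' -> is_derive x 1 f df'.
Proof. by move=> ? <-. Qed.

Lemma is_derive_add (f g : R -> R) (x df dg : R) :
  is_derive x 1 f df -> is_derive x 1 g dg ->
  is_derive x 1 (fun t => f t + g t) (df + dg).
Proof. exact: is_deriveD. Qed.

Lemma is_derive_sub (f g : R -> R) (x df dg : R) :
  is_derive x 1 f df -> is_derive x 1 g dg ->
  is_derive x 1 (fun t => f t - g t) (df - dg).
Proof. exact: is_deriveB. Qed.

Lemma is_derive_mulrn (f : R -> R) (x df : R) (n : nat) :
  is_derive x 1 f df -> is_derive x 1 (fun t => f t *+ n) (df *+ n).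
Proof.
move=> H; have H1 : is_derive x 1 (fun t : R => n%:R * f t) (n%:R * df) := is_deriveZ _ H.
rewrite -mulr_natl (_ : (fun t : R => _) = (fun t : R => n%:R * f t)) //.
by apply/funext => t; rewrite mulr_natl.
Qed.

Lemma is_derive_oppid (x : R) : is_derive x 1 (fun t : R => - t) (-1 : R).
Proof. exact: is_deriveNid. Qed.

Lemma is_derive_const (k x : R) : is_derive x 1 (fun _ : R => k) (0 : R).
Proof. exact: is_derive_cst. Qed.

Lemma is_derive_phiN (x : R) : is_derive x 1 (fun t : R => - phi (- t)) (sigmoid (- x)).
Proof.
have H0 : is_derive x 1 (fun t : R => - phi (- 1 * t)) (- (- 1 * sigmoid (-1 * x))) :=
  is_deriveN (is_derive_phi_lin (-1) x).
rewrite (_ : (fun t : R => _) = (fun t : R => - phi (- 1 * t))); last first.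
  by apply/funext => t; rewrite mulN1r.
by apply: (is_derive_eq H0); rewrite !mulN1r opprK.
Qed.

(** Only the coordinate of h itself influences other coordinates; a neighbour that
    occurs twice contributes twice, and both kinds of terms add up correctly
    because they are written with indicator functions. *)
Lemma inner_flip_map_pderiv G G' h (f : (E -> R) -> R) df (Z : E -> R) e : cubic G -> inner_flip h G G' ->
  gradient f df ->
  let p := sigmoid (Z h.1) in let q := sigmoid (- Z h.1) in
  let W := inner_flip_map h G Z in
  let h' := opp E h in
  pderiv e (f \o inner_flip_map h G) Z =
    if e == h.1 then - df e W + p * df (G (G h)).1 W + q * df (G h).1 W
       + p * df (G (G h')).1 W + q * df (G h').1 W
    else df e W.
Proof.
move=> cG fl H p q W h'.
have D := inner_flip_data cG fl.
case: D => [uL _ _ _].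
have nh x : x \notin [:: h; opp E h] -> (x.1 == h.1) = false.
  by rewrite !inE negb_or same_edge => /andP [/negbTE -> /negbTE ->].
move: uL; rewrite /= !inE !negb_or -!andbA.
case/and5P => n1 n2 n3 n4 /and5P [n5 n6 n7 n8 /and5P [n9 n10 n11 n12 /and4P [n13 n14 n15 _]]].
rewrite /W /inner_flip_map -/h'.
have ha : ((G (G h)).1 == h.1) = false by apply: nh; rewrite !inE negb_or eq_sym n1 n7.
have hb : ((G h).1 == h.1) = false by apply: nh; rewrite !inE negb_or eq_sym n2 n10.
have hc : ((G (G h')).1 == h.1) = false by apply: nh; rewrite !inE negb_or eq_sym n4 eq_sym n13.
have hd : ((G h').1 == h.1) = false by apply: nh; rewrite !inE negb_or eq_sym n5 eq_sym n14.
rewrite /pderiv derive1E.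
pose J e' : R := if e == h.1 then - (e' == h.1)%:R + p * (e' == (G (G h)).1)%:R + q * (e' == (G h).1)%:R
       + p * (e' == (G (G h')).1)%:R + q * (e' == (G h').1)%:R else (e' == e)%:R.
have DJ e' : is_derive (Z e) 1 (fun t : R => inner_flip_map h G [eta Z with e |-> t] e') (J e').
  rewrite /inner_flip_map /J /= -/h' [h.1 == e]eq_sym.
  have [eh|eh] := eqVneq e h.1; rewrite /=; last first.
    have [->|e'h] := eqVneq e' h.1; rewrite /=.
      by rewrite eq_sym (negbTE eh); apply: is_derive_const.
    apply: (is_derive_val (df := (e' == e)%:R + 0 - 0 + 0 - 0)); last by rewrite !subr0 !addr0.
    apply: (is_derive_sub _ (is_derive_const _ _)).
    apply: (is_derive_add _ (is_derive_const _ _)).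
    apply: (is_derive_sub _ (is_derive_const _ _)).
    apply: (is_derive_add _ (is_derive_const _ _)).
    exact: is_derive_line.
  have [->|e'h] := eqVneq e' h.1; rewrite /=.
    rewrite ![h.1 == _]eq_sym ha hb hc hd; apply: (is_derive_eq (is_derive_oppid _)).
    by rewrite /= !mulr0 !addr0.
  rewrite -eh in e'h *.
  have fE : (fun t : R => (if e' == e then t else Z e') + phi t *+ (e' == (G (G h)).1)
      - phi (- t) *+ (e' == (G h).1) + phi t *+ (e' == (G (G h')).1)
      - phi (- t) *+ (e' == (G h').1)) = (fun t : R => Z e' + phi t *+ (e' == (G (G h)).1)
      + (- phi (- t)) *+ (e' == (G h).1) + phi t *+ (e' == (G (G h')).1)
      + (- phi (- t)) *+ (e' == (G h').1)).
    by apply/funext => t; rewrite (negbTE e'h) !mulNrn.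
  rewrite fE.
  apply: (is_derive_val (df := 0 + p *+ (e' == (G (G h)).1) + q *+ (e' == (G h).1)
       + p *+ (e' == (G (G h')).1) + q *+ (e' == (G h').1))); last first.
    by rewrite /= oppr0 !mulr_natr.
  rewrite /p /q -eh.
  apply: (is_derive_add _ (is_derive_mulrn _ (is_derive_phiN _))).
  apply: (is_derive_add _ (is_derive_mulrn _ (is_derive_phi _))).
  apply: (is_derive_add _ (is_derive_mulrn _ (is_derive_phiN _))).
  exact: (is_derive_add (is_derive_const _ _) (is_derive_mulrn _ (is_derive_phi _))).
have DD := gradient_chain DJ H.
rewrite (@derive_val _ _ _ _ _ _ _ DD) line_id /J.
case: ifP => [/eqP ->|_]; last exact: sum_delta.
under eq_bigr do rewrite !mulrDr mulrN !(mulrCA _ p) !(mulrCA _ q).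
by rewrite !big_split /= sumrN -!mulr_sumr !sum_delta.
Qed.

Lemma pending_flip_map_pderiv G G' h (f : (E -> R) -> R) df (Z : E -> R) e : cubic G -> pending_flip h G G' ->
  gradient f df ->
  let p := 2 * sigmoid (- (2 * Z h.1)) in let q := 2 * sigmoid (2 * Z h.1) in
  let W := pending_flip_map h G Z in
  pderiv e (f \o pending_flip_map h G) Z =
    if e == h.1 then - df e W + p * df (G h).1 W + q * df (G (G h)).1 W
    else df e W.
Proof.
move=> cG fl H p q W.
have D := pending_flip_data cG fl; have no := pending_data_opp D.
case: D => [uL _ _ _ _].
have nh x : x \notin [:: h; opp E h] -> (x.1 == h.1) = false.
  by rewrite !inE negb_or same_edge => /andP [/negbTE -> /negbTE ->].
move: uL; rewrite /= !inE !negb_or -!andbA => /and4P [n1 n2 n3 _].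
move: (no); rewrite !inE !negb_or => /and3P [m1 m2 m3].
have hy : ((G h).1 == h.1) = false by apply: nh; rewrite !inE negb_or eq_sym n1 eq_sym m2.
have hz : ((G (G h)).1 == h.1) = false by apply: nh; rewrite !inE negb_or eq_sym n2 eq_sym m3.
rewrite /pderiv derive1E.
pose J e' : R := if e == h.1 then - (e' == h.1)%:R + p * (e' == (G h).1)%:R + q * (e' == (G (G h)).1)%:R
   else (e' == e)%:R.
have DJ e' : is_derive (Z e) 1 (fun t : R => pending_flip_map h G [eta Z with e |-> t] e') (J e').
  rewrite /pending_flip_map /J /= [h.1 == e]eq_sym.
  have [eh|eh] := eqVneq e h.1; rewrite /=; last first.
    have [->|e'h] := eqVneq e' h.1; rewrite /=.
      by rewrite eq_sym (negbTE eh); apply: is_derive_const.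
    apply: (is_derive_val (df := (e' == e)%:R - 0 + 0)); last by rewrite !subr0 !addr0.
    apply: (is_derive_add _ (is_derive_const _ _)).
    apply: (is_derive_sub _ (is_derive_const _ _)).
    exact: is_derive_line.
  have [->|e'h] := eqVneq e' h.1; rewrite /=.
    rewrite ![h.1 == _]eq_sym hy hz; apply: (is_derive_eq (is_derive_oppid _)).
    by rewrite /= !mulr0 !addr0.
  rewrite -eh in e'h *.
  have fE : (fun t : R => (if e' == e then t else Z e') - phi (- (2 * t)) *+ (e' == (G h).1)
      + phi (2 * t) *+ (e' == (G (G h)).1)) = (fun t : R => Z e' + (- phi (- 2 * t)) *+ (e' == (G h).1)
      + phi (2 * t) *+ (e' == (G (G h)).1)).
    by apply/funext => t; rewrite (negbTE e'h) !mulNrn mulNr.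
  rewrite fE.
  apply: (is_derive_val (df := 0 + p *+ (e' == (G h).1) + q *+ (e' == (G (G h)).1))); last first.
    by rewrite /= oppr0 !mulr_natr.
  rewrite /p /q -eh.
  have H0 : is_derive (Z e) 1 (fun t : R => - phi (- 2 * t)) (- (- 2 * sigmoid (- 2 * Z e))) :=
    is_deriveN (is_derive_phi_lin (-2) (Z e)).
  have H1 := is_derive_val H0 (_ : _ = 2 * sigmoid (- (2 * Z e))).
  apply: (is_derive_add _ (is_derive_mulrn _ (is_derive_phi_lin _ _))).
  apply: (is_derive_add (is_derive_const _ _) (is_derive_mulrn _ (H1 _))).
  by rewrite !mulNr opprK.
have DD := gradient_chain DJ H.
rewrite (@derive_val _ _ _ _ _ _ _ DD) line_id /J.
case: ifP => [/eqP ->|_]; last exact: sum_delta.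
under eq_bigr do rewrite !mulrDr mulrN !(mulrCA _ p) !(mulrCA _ q).
by rewrite !big_split /= sumrN -!mulr_sumr !sum_delta.
Qed.

Lemma inner_flip_bracket G G' h (f g : (E -> R) -> R) (Z : E -> R) : cubic G -> inner_flip h G G' ->
  exp_poly f -> exp_poly g ->
  bracket G (f \o inner_flip_map h G) (g \o inner_flip_map h G) Z =
  bracket G' f g (inner_flip_map h G Z).
Proof.
move=> cG fl [df Hf] [dg Hg]; have D := inner_flip_data cG fl.
rewrite !bracketE //; last exact: inner_data_cubic D.
apply: (inner_wedge_sum D (sigmoidN (Z h.1))) => e.
  by rewrite (inner_flip_map_pderiv _ _ cG fl Hf) !(pderiv_gradient _ _ Hf).
by rewrite (inner_flip_map_pderiv _ _ cG fl Hg) !(pderiv_gradient _ _ Hg).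
Qed.

Lemma pending_flip_bracket G G' h (f g : (E -> R) -> R) (Z : E -> R) : cubic G -> pending_flip h G G' ->
  exp_poly f -> exp_poly g ->
  bracket G (f \o pending_flip_map h G) (g \o pending_flip_map h G) Z =
  bracket G' f g (pending_flip_map h G Z).
Proof.
move=> cG fl [df Hf] [dg Hg]; have D := pending_flip_data cG fl.
rewrite !bracketE //; last exact: pending_data_cubic D.
apply: (pending_wedge_sum D (p := 2 * sigmoid (- (2 * Z h.1))) (q := 2 * sigmoid (2 * Z h.1))).
  by rewrite -mulrDr addrC sigmoidN mulr1.
- by move=> e; rewrite (pending_flip_map_pderiv _ _ cG fl Hf) !(pderiv_gradient _ _ Hf).
- by move=> e; rewrite (pending_flip_map_pderiv _ _ cG fl Hg) !(pderiv_gradient _ _ Hg).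
Qed.

End Wedge.

(** * Matrices along paths and flips *)
Section Matrices.
Context {R : realType}.
Implicit Types (z t : R).

Lemma mx2_mul (a b c d a' b' c' d' : R) :
  mx2 a b c d *m mx2 a' b' c' d' =
  mx2 (a * a' + b * c') (a * b' + b * d') (c * a' + d * c') (c * b' + d * d').
Proof.
by apply/matrixP => -[[|[|//]] i] [[|[|//]] j]; rewrite !mxE !big_ord_recl big_ord0 !mxE addr0.
Qed.

(** Shifting the coordinate of an edge by t multiplies its matrix by [shift_mx t] at
    the far end, or equally by [shift_mx (- t)] at the near end.  This lets each end
    of an edge account for its own share of the shift. *)
Definition shift_mx t : 'M[R]_2 := mx2 (expR (t / 2)) 0 0 (expR (- t / 2)).

Lemma shift_mxD s t : shift_mx s *m shift_mx t = shift_mx (s + t).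
Proof.
by rewrite /shift_mx mx2_mul !(mulr0, mul0r, addr0, add0r) -!expRD -!mulrDl -opprD.
Qed.

Lemma shift_mx0 : shift_mx 0 = 1%:M.
Proof.
by rewrite /shift_mx oppr0 mul0r expR0; apply/matrixP => -[[|[|//]] i] [[|[|//]] j]; rewrite !mxE.
Qed.

Lemma shift_mxNK t : shift_mx (- t) *m shift_mx t = 1%:M.
Proof. by rewrite shift_mxD addNr shift_mx0. Qed.

Lemma shift_mxKN t : shift_mx t *m shift_mx (- t) = 1%:M.
Proof. by rewrite shift_mxD subrr shift_mx0. Qed.

Lemma X_mx_addl z t : X_mx (z + t) = shift_mx t *m X_mx z.
Proof.
rewrite /shift_mx /X_mx mx2_mul !(mulr0, mul0r, addr0, add0r) mulrN -!expRD.
by congr mx2; [congr (- _)|]; congr expR; field.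
Qed.

Lemma X_mx_addr z t : X_mx (z + t) = X_mx z *m shift_mx (- t).
Proof.
rewrite /shift_mx /X_mx mx2_mul !(mulr0, mul0r, addr0, add0r) [- expR _ * _]mulNr -!expRD opprK.
by congr mx2; [congr (- _)|]; congr expR; field.
Qed.

Lemma phiN z : phi (- z) = phi z - z.
Proof.
rewrite /phi; have w0 := expR_gt0 z; have w1 : 0 < 1 + expR z by lra.
have e : 1 + expR (- z) = (1 + expR z) / expR z.
  by rewrite expRN; field; lra.
by rewrite e ln_div ?posrE ?expRK.
Qed.

Lemma expR_half z : expR (z / 2) ^+ 2 = expR z.
Proof. by rewrite expr2 -expRD; congr expR; field. Qed.

(** With w = exp (z / 2) and r = exp (phi z / 2), so that r ^ 2 = 1 + w ^ 2, all
    matrices have entries rational in w and r. *)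
Lemma flip_params z : exists w r, [/\ 0 < w, 0 < r, r ^+ 2 = 1 + w ^+ 2
  & [/\ X_mx z = mx2 0 (- w) w^-1 0, X_mx (- z) = mx2 0 (- w^-1) w 0
     & [/\ shift_mx (phi z) = mx2 r 0 0 r^-1, shift_mx (- phi z) = mx2 r^-1 0 0 r,
       shift_mx (- phi (- z)) = mx2 (w / r) 0 0 (r / w)
     & shift_mx (phi (- z)) = mx2 (r / w) 0 0 (w / r)]]].
Proof.
exists (expR (z / 2)), (expR (phi z / 2)).
have n x : expR (- x / 2) = (expR (x / 2))^-1 :> R by rewrite mulNr expRN.
have p x : expR (- - x / 2) = expR (x / 2) :> R by rewrite opprK.
have q : expR (phi (- z) / 2) = expR (phi z / 2) / expR (z / 2) :> R.
  by rewrite phiN mulrBl expRD expRN.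
split; rewrite ?expR_gt0 //.
  rewrite !expR_half /phi lnK // posrE; have := expR_gt0 z; lra.
by split; rewrite /X_mx /shift_mx; [| |split]; rewrite ?opprK ?n ?q ?invf_div.
Qed.

(** The six passages that enter the region of a flip from a or from b, with exits b,
    c, d and a, c, d; the right-hand sides are the passages before the flip. *)
Lemma flip_matrices z :
  [/\ shift_mx (phi (- z)) *m (L_mx *m X_mx (- z) *m L_mx) *m shift_mx (phi z) = L_mx,
      shift_mx (- phi z) *m (R_mx *m X_mx (- z) *m L_mx) *m shift_mx (phi z) =
        L_mx *m X_mx z *m R_mx
    & shift_mx (phi (- z)) *m R_mx *m shift_mx (phi z) = R_mx *m X_mx z *m R_mx] /\
  [/\ shift_mx (- phi z) *m (R_mx *m X_mx (- z) *m R_mx) *m shift_mx (- phi (- z)) = R_mx,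
      shift_mx (- phi z) *m L_mx *m shift_mx (- phi (- z)) = L_mx *m X_mx z *m L_mx
    & shift_mx (phi (- z)) *m (L_mx *m X_mx (- z) *m R_mx) *m shift_mx (- phi (- z)) =
        R_mx *m X_mx z *m L_mx].
Proof.
have [w [r [w0 r0 rw [e1 e2 [e3 e4 e5 e6]]]]] := flip_params z.
have r2 : r ^+ 2 = w ^+ 2 + 1 by rewrite rw addrC.
by split; split; rewrite ?e1 ?e2 ?e3 ?e4 ?e5 ?e6 /L_mx /R_mx !mx2_mul; congr mx2;
  (field: r2; rewrite ?(gt_eqF w0) ?(gt_eqF r0)).
Qed.

(** A visit to a pending edge is the passage of an edge with twice the coordinate. *)
Lemma X_F_X z : X_mx z *m F_mx *m X_mx z = X_mx (2 * z).
Proof.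
rewrite /X_mx /F_mx !mx2_mul !(mulr0, mul0r, addr0, add0r, mulr1, mul1r, mulrN1, mulN1r, mulNr, mulrN) -!expRD.
by rewrite opprK oppr0; congr mx2; [congr (- _)|]; congr expR; field.
Qed.

End Matrices.

(** * Matching closed paths *)
Section Walks.
Context {R : realType} {E : finType}.
Implicit Types (G : fatgraph E) (x y k h : halfedge E) (s u p : seq (halfedge E)) (Z : E -> R).

Fixpoint walk_mx G Z x s : 'M[R]_2 :=
  if s is y :: s' then walk_mx G Z y s' *m (turn_mx G x y *m X_mx (Z x.1)) else 1%:M.

Lemma walk_mx_cat G Z x s1 s2 :
  walk_mx G Z x (s1 ++ s2) = walk_mx G Z (last x s1) s2 *m walk_mx G Z x s1.
Proof. by elim: s1 x => [|y s1 IH] x /=; rewrite ?mulmx1 // IH -!mulmxA. Qed.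

Lemma geodesic_functionE G x s Z :
  geodesic_function G (x :: s) Z = \tr (walk_mx G Z x (rcons s x)).
Proof.
rewrite /geodesic_function /path_mx rot1_cons.
suff H y (M : 'M[R]_2) : foldl (fun M hk => turn_mx G hk.1 hk.2 *m X_mx (Z hk.1.1) *m M) M
    (zip (y :: s) (rcons s x)) = walk_mx G Z y (rcons s x) *m M by rewrite H mulmx1.
elim: s y M => [|k s IH] y M; first by rewrite /= mul1mx.
refine (etrans (IH k (turn_mx G y k *m X_mx (Z y.1) *m M)) _).
by rewrite /= mulmxA.
Qed.

Lemma geodesic_function_rot G u v Z :
  geodesic_function G (u ++ v) Z = geodesic_function G (v ++ u) Z.
Proof.
case: u v => [|x u] [|y v] //; rewrite ?cats0 //= !geodesic_functionE.
rewrite !rcons_cat !rcons_cons -cat_rcons -[in RHS]cat_rcons !walk_mx_cat !last_rcons.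
exact: mxtrace_mulC.
Qed.

(** The edges of x and y are left out: only the turns, and the crossings of the edges
    of u, contribute. *)
Fixpoint passage_mx G Z x u y : 'M[R]_2 :=
  if u is k :: u' then passage_mx G Z k u' y *m X_mx (Z k.1) *m turn_mx G x k
  else turn_mx G x y.

Lemma walk_passage G Z x u y :
  walk_mx G Z x (rcons u y) = passage_mx G Z x u y *m X_mx (Z x.1).
Proof. by elim: u x => [|k u IH] x /=; rewrite ?mul1mx // IH !mulmxA. Qed.

(** Passages between kept half-edges through discarded ones are the units in which
    paths of G are translated into paths of G'.  The total shift of a kept edge is
    the sum of the shifts t at its two ends, and each passage absorbs those at its
    own two ends. *)
Section Transfer.
Variables (P : Type) (G G' : fatgraph E) (Z Z' : P -> E -> R)
  (t : halfedge E -> P -> R) (kept : pred (halfedge E)).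
Hypothesis shift : forall i x, kept x -> Z' i x.1 = Z i x.1 + t x i + t (opp E x) i.
Hypothesis local : forall x u y, kept x -> all (predC kept) u -> kept y ->
  path (path_step G) x (rcons u y) ->
  exists2 u', path (path_step G') x (rcons u' y) &
    forall i, shift_mx (- t y i) *m passage_mx G' (Z' i) x u' y *m shift_mx (t (opp E x) i)
      = passage_mx G (Z i) x u y.

(** u is the part already read of a passage that is still incomplete. *)
Lemma transfer_walk s : forall x u, kept x -> all (predC kept) u ->
  path (path_step G) x (u ++ s) -> kept (last x (u ++ s)) ->
  exists s', [/\ path (path_step G') x s', last x s' = last x (u ++ s),
    (s' == [::]) = (u ++ s == [::]) &
    forall i, shift_mx (- t (last x s') i) *m walk_mx G' (Z' i) x s' *m shift_mx (t x i) =
      walk_mx G (Z i) x (u ++ s)].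
Proof.
elim: s => [|y s IH] x u kx au.
  rewrite cats0; case/lastP: u au => [|u y] au _.
    by exists [::]; split=> // i /=; rewrite mulmx1 shift_mxNK.
  by rewrite last_rcons; move: au; rewrite all_rcons /= => /andP [/negbTE ->].
rewrite -cat_rcons => pp kl.
case ky: (kept y); last by apply: IH => //; rewrite all_rcons /= ky.
move: pp kl; rewrite cat_path last_cat last_rcons => /andP [p1 p2] kl.
have [u' p' e'] := local kx au ky p1.
have [s' [q' l' _ w']] := IH y [::] ky isT p2 kl.
exists (rcons u' y ++ s'); split.
- by rewrite cat_path p' last_rcons.
- by rewrite last_cat last_rcons.
- by rewrite -!size_eq0 !size_cat !size_rcons.
move=> i; rewrite last_cat last_rcons !walk_mx_cat !last_rcons -w' !walk_passage -e'.
rewrite shift // X_mx_addl X_mx_addr -!mulmxA shift_mxNK mulmx1.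
by rewrite [shift_mx (t y i) *m _]mulmxA shift_mxKN mul1mx.
Qed.

(** The shifts at the point where the path is closed cancel under the trace. *)
Lemma transfer_closed_path p : closed_path G p -> has kept p ->
  exists2 p', closed_path G' p' &
    forall i, geodesic_function G' p' (Z' i) = geodesic_function G p (Z i).
Proof.
move=> /andP [np cp] /hasP [x xp kx]; case/splitPr: xp np cp => p1 p2 _ cp.
have {cp} : path.cycle (path_step G) (x :: p2 ++ p1).
  by rewrite -cat_cons -(rot_size_cat p1) rot_cycle.
rewrite /= => pp.
have [|s' [q l n w]] := transfer_walk (u := [::]) kx isT pp; first by rewrite last_rcons.
case/lastP: s' n l q w => [|s' y]; first by move=> /=; case: (p2 ++ p1).
rewrite !last_rcons => _ -> q w; exists (x :: s'); first by apply/andP.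
move=> i; rewrite [RHS]geodesic_function_rot cat_cons !geodesic_functionE.
have := w i; rewrite ?last_rcons ?cat0s => <-.
by rewrite mxtrace_mulC mulmxA shift_mxKN mul1mx.
Qed.

End Transfer.
End Walks.

(** * Passages near an inner flip *)
Section LocalPassages.
Context {R : realType} {E : finType}.
Implicit Types (G : fatgraph E) (x y k h e l r o a b c d : halfedge E)
  (s u p : seq (halfedge E)) (Z : E -> R).

(** The two ways on from the arrival o at a three-valent vertex. *)
Lemma step_at G x o l r : cubic G -> opp E x = o -> G o = r -> G r = l -> r != o ->
  [/\ forall k, path_step G x k = (k == l) || (k == r),
      turn_mx G x l = L_mx :> 'M[R]_2 & turn_mx G x r = R_mx :> 'M[R]_2].
Proof.
move=> cG ox e1 e2 ro; rewrite /turn_mx /path_step /pending_end left_turnE // right_turnE //.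
rewrite ox e1 e2 (negbTE ro) eqxx; split=> //.
case: eqP => // rl; have := e2; rewrite -rl -{2}e1 => /perm_inj ro'.
by move: ro; rewrite ro' eqxx.
Qed.

Lemma passage_cases (step : rel (halfedge E)) (kept : pred (halfedge E)) x e l l' r' u y :
  (forall k, step x k = (k == l) || (k == e)) ->
  (forall k, step e k = (k == l') || (k == r')) ->
  kept l -> ~~ kept e -> kept l' -> kept r' ->
  all (predC kept) u -> kept y -> path step x (rcons u y) ->
  [\/ u = [::] /\ y = l, u = [:: e] /\ y = l' | u = [:: e] /\ y = r'].
Proof.
move=> s1 s2 kl ke kl' kr'; case: u => [|k u] /=.
  move=> _ ky; rewrite s1 andbT => /orP [] /eqP ey; first by constructor 1.
  by move: ke; rewrite -ey ky.
case/andP => kk au ky /andP []; rewrite s1 => /orP [] /eqP ek; rewrite {}ek in kk *.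
  by move: kk; rewrite /= kl.
case: u au => [_|k2 u] /=.
  by rewrite s2 andbT => /orP [] /eqP ->; [constructor 2|constructor 3].
case/andP => k2k _ /andP []; rewrite s2 => /orP [] /eqP ek2; move: k2k;
  by rewrite ek2 /= ?kl' ?kr'.
Qed.

Definition inner_shift h a b c d y Z : R :=
  phi (Z h.1) *+ ((y == a) + (y == c))%N - phi (- Z h.1) *+ ((y == b) + (y == d))%N.

Definition other_edge h : pred (halfedge E) := fun y => y.1 != h.1.

(** Of the new coordinates, only that of the flipped edge enters the passages. *)
Definition matched G G' (t : halfedge E -> (E -> R) -> R) h x u u' y : Prop :=
  [/\ path (path_step G) x (rcons u y), path (path_step G') x (rcons u' y) &
  forall Z Z', Z' h.1 = - Z h.1 ->
    shift_mx (- t y Z) *m passage_mx G' Z' x u' y *m shift_mx (t (opp E x) Z)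
      = passage_mx G Z x u y].

(** From a or b each graph has three passages, one for each other leg: the turn at
    the first vertex leaves directly or crosses the flipped edge.  The passages
    from c and d follow by exchanging the two ends of h. *)
Lemma inner_half G G' h a b c d x : cubic G -> inner_data h a b c d G G' ->
  (opp E x == a) || (opp E x == b) ->
  (forall u y, all (predC (other_edge h)) u -> other_edge h y ->
    path (path_step G) x (rcons u y) ->
    exists u', matched G G' (inner_shift h a b c d) h x u u' y) /\
  (forall u' y, all (predC (other_edge h)) u' -> other_edge h y ->
    path (path_step G') x (rcons u' y) ->
    exists u, matched G G' (inner_shift h a b c d) h x u u' y).
Proof.
move=> cG D; have cG' := inner_data_cubic cG D.
case: D => [uL [[e1 e2 e3] [e4 e5 e6]] [[f1 f2 f3] [f4 f5 f6]] fr].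
have nh k : k \notin [:: h; opp E h] -> other_edge h k.
  by rewrite !inE negb_or /other_edge same_edge => /andP [/negbTE -> /negbTE ->].
move: uL; rewrite /= !inE !negb_or -!andbA.
case/and5P => n1 n2 n3 n4 /and5P [n5 n6 n7 n8 /and5P [n9 n10 n11 n12 /and4P [n13 n14 n15 _]]].
have ne (s t : halfedge E) : s != t -> ((s == t) = false) * ((t == s) = false).
  by rewrite [t == s]eq_sym => /negbTE ->.
have NE := (ne _ _ n1, ne _ _ n2, ne _ _ n3, ne _ _ n4, ne _ _ n5, ne _ _ n6,
  ne _ _ n7, ne _ _ n8, ne _ _ n9, ne _ _ n10, ne _ _ n11, ne _ _ n12, ne _ _ n13, ne _ _ n14, ne _ _ n15).
have ka : other_edge h a by apply: nh; rewrite !inE !NE.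
have kb : other_edge h b by apply: nh; rewrite !inE !NE.
have kc : other_edge h c by apply: nh; rewrite !inE !NE.
have kd : other_edge h d by apply: nh; rewrite !inE !NE.
have kh : ~~ other_edge h h by rewrite /other_edge eqxx.
have kh' : ~~ other_edge h (opp E h) by rewrite /other_edge opp_fst eqxx.
have ta Z : inner_shift h a b c d a Z = phi (Z h.1).
  by rewrite /inner_shift eqxx !NE subr0.
have tb Z : inner_shift h a b c d b Z = - phi (- Z h.1).
  by rewrite /inner_shift eqxx !NE sub0r.
have tc Z : inner_shift h a b c d c Z = phi (Z h.1).
  by rewrite /inner_shift eqxx !NE subr0.
have td Z : inner_shift h a b c d d Z = - phi (- Z h.1).
  by rewrite /inner_shift eqxx !NE sub0r.
have hh : opp E (opp E h) = h by rewrite oppK.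
have dh' : d != opp E h by rewrite !NE.
have [sh Lh Rh] := step_at (x := h) cG erefl e4 e5 dh'.
have [|sh1 Lh1 Rh1] := step_at (x := h) cG' erefl f4 f5; first by rewrite !NE.
have [|sh2 Lh2 Rh2] := step_at (x := opp E h) cG' hh f1 f2; first by rewrite !NE.
case/orP => /eqP ox.
- have [|sx Lx Rx] := step_at (x := x) cG ox e3 e1; first by rewrite !NE.
  have [|sx' Lx' Rx'] := step_at (x := x) cG' ox f2 f3; first by rewrite !NE.
  have M1 : matched G G' (inner_shift h a b c d) h x [::] [:: h] b.
    split; rewrite /= ?sx ?sx' ?sh1 ?eqxx ?orbT // => Z Z' eZ.
    rewrite ox ta tb opprK eZ Lx Lh1 Lx'.
    by have [[-> _ _] _] := flip_matrices (Z h.1).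
  have M2 : matched G G' (inner_shift h a b c d) h x [:: h] [:: h] c.
    split; rewrite /= ?sx ?sx' ?sh ?sh1 ?eqxx ?orbT // => Z Z' eZ.
    rewrite ox ta tc eZ Rx Lh Rh1 Lx'.
    by have [[_ -> _] _] := flip_matrices (Z h.1).
  have M3 : matched G G' (inner_shift h a b c d) h x [:: h] [::] d.
    split; rewrite /= ?sx ?sx' ?sh ?eqxx ?orbT // => Z Z' eZ.
    rewrite ox ta td opprK Rx Rh Rx'.
    by have [[_ _ ->] _] := flip_matrices (Z h.1).
  split=> [u y au ky pp|u' y au ky pp].
    case: (passage_cases sx sh kb kh kc kd au ky pp) => [] [-> ->];
      [exists [:: h] | exists [:: h] | exists [::]] => //.
  have sx2 k : path_step G' x k = (k == d) || (k == h) by rewrite sx' orbC.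
  case: (passage_cases sx2 sh1 kd kh kb kc au ky pp) => [] [-> ->];
      [exists [:: h] | exists [::] | exists [:: h]] => //.
- have [|sx Lx Rx] := step_at (x := x) cG ox e2 e3; first by rewrite !NE.
  have [|sx' Lx' Rx'] := step_at (x := x) cG' ox f6 f4; first by rewrite !NE.
  have M1 : matched G G' (inner_shift h a b c d) h x [::] [:: opp E h] a.
    split; rewrite /= ?sx ?sx' ?sh2 ?eqxx ?orbT // => Z Z' eZ.
    rewrite ox ta tb opp_fst eZ Rx Rh2 Rx'.
    by have [_ [-> _ _]] := flip_matrices (Z h.1).
  have M2 : matched G G' (inner_shift h a b c d) h x [:: h] [::] c.
    split; rewrite /= ?sx ?sx' ?sh ?sh1 ?eqxx ?orbT // => Z Z' eZ.
    rewrite ox tb tc Lx Lh Lx'.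
    by have [_ [_ -> _]] := flip_matrices (Z h.1).
  have M3 : matched G G' (inner_shift h a b c d) h x [:: h] [:: opp E h] d.
    split; rewrite /= ?sx ?sx' ?sh ?sh2 ?eqxx ?orbT // => Z Z' eZ.
    rewrite ox tb td opprK opp_fst eZ Lx Rh Rx' Lh2.
    by have [_ [_ _ ->]] := flip_matrices (Z h.1).
  split=> [u y au ky pp|u' y au ky pp].
    have sx2 k : path_step G x k = (k == a) || (k == h) by rewrite sx orbC.
    case: (passage_cases sx2 sh ka kh kc kd au ky pp) => [] [-> ->];
      [exists [:: opp E h] | exists [::] | exists [:: opp E h]] => //.
  case: (passage_cases sx' sh2 kc kh' kd ka au ky pp) => [] [-> ->];
      [exists [:: h] | exists [:: h] | exists [::]] => //.
Qed.

(** At vertices outside the region of the flip, turns and coordinates are unchanged. *)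
Lemma passages_away G G' t h x (o := opp E x) : cubic G -> cubic G' ->
  G' o = G o -> G' (G o) = G (G o) ->
  other_edge h (G o) -> other_edge h (G (G o)) ->
  (forall Z, [/\ t o Z = 0, t (G o) Z = 0 & t (G (G o)) Z = 0]) ->
  (forall u y, all (predC (other_edge h)) u -> other_edge h y ->
    path (path_step G) x (rcons u y) -> exists u', matched G G' t h x u u' y) /\
  (forall u' y, all (predC (other_edge h)) u' -> other_edge h y ->
    path (path_step G') x (rcons u' y) -> exists u, matched G G' t h x u u' y).
Proof.
move=> cG cG' r1 r2 k1 k2 t0.
have sE k : path_step G x k = (k == G (G o)) || (k == G o).
  by rewrite /path_step left_turnE // right_turnE.
have sE' k : path_step G' x k = path_step G x k.
  by rewrite sE /path_step left_turnE // right_turnE // r1 r2.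
have M k : path_step G x k -> matched G G' t h x [::] [::] k.
  move=> sk; split; rewrite /= ?sE' ?sk // => Z Z' _; have [z0 z1 z2] := t0 Z.
  have tm : turn_mx G' x k = turn_mx G x k :> 'M[R]_2.
    by rewrite /turn_mx /pending_end !left_turnE // r1 r2.
  have tk : t k Z = 0 by move: sk; rewrite sE => /orP [] /eqP ->.
  by rewrite tm tk z0 oppr0 shift_mx0 mul1mx mulmx1.
have C (step : rel (halfedge E)) u y : (forall k, step x k = path_step G x k) ->
    all (predC (other_edge h)) u ->
    path step x (rcons u y) -> u = [::] /\ path_step G x y.
  move=> es; case: u => [|k u] /=; first by rewrite es andbT.
  case/andP => kk _ /andP []; rewrite es sE => /orP [] /eqP ek _;
    by move: kk; rewrite ek ?k1 ?k2.
split=> u y au ky pp.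
  have [|-> sy] := C (path_step G) u y _ au pp; first by [].
  by exists [::]; apply: M.
have [-> sy] := C (path_step G') u y sE' au pp.
by exists [::]; apply: M.
Qed.

Lemma inner_data_sym G G' h a b c d :
  inner_data h a b c d G G' -> inner_data (opp E h) c d a b G G'.
Proof.
move=> [u [e1 e2] [f1 f2] fr].
have pe : perm_eq [:: opp E h; c; d; opp E (opp E h); a; b] [:: h; a; b; opp E h; c; d].
  by rewrite oppK -[X in perm_eq X _]/([:: opp E h; c; d] ++ [:: h; a; b]) perm_catC.
split; [by rewrite (perm_uniq pe)|by rewrite oppK|by rewrite oppK|].
by move=> x; rewrite (perm_mem pe); apply: fr.
Qed.

Lemma inner_passages G G' h a b c d x : cubic G -> inner_data h a b c d G G' ->
  other_edge h x ->
  (forall u y, all (predC (other_edge h)) u -> other_edge h y ->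
    path (path_step G) x (rcons u y) ->
    exists u', matched G G' (inner_shift h a b c d) h x u u' y) /\
  (forall u' y, all (predC (other_edge h)) u' -> other_edge h y ->
    path (path_step G') x (rcons u' y) ->
    exists u, matched G G' (inner_shift h a b c d) h x u u' y).
Proof.
move=> cG D kx; have cG' := inner_data_cubic cG D; have cl := inner_data_closed D.
have D' := inner_data_sym D.
have oo y : other_edge (opp E h) y = other_edge h y by rewrite /other_edge opp_fst.
have st y Z : inner_shift (opp E h) c d a b y Z = inner_shift h a b c d y Z.
  by rewrite /inner_shift opp_fst addnC [((y == d) + _)%N]addnC.
have mt u u' y : matched G G' (inner_shift (opp E h) c d a b) (opp E h) x u u' y ->
    matched G G' (inner_shift h a b c d) h x u u' y.
  case=> p p' H; split=> // Z Z' eZ; rewrite -!st; apply: H; by rewrite opp_fst.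
case: (boolP ((opp E x == a) || (opp E x == b))) => [ab|nab]; first exact: inner_half D ab.
case: (boolP ((opp E x == c) || (opp E x == d))) => [cd|ncd].
  have [H1 H2] := inner_half cG D' cd.
  have ea v : all (predC (other_edge (opp E h))) v = all (predC (other_edge h)) v.
    by apply: eq_all => k; rewrite /= oo.
  split=> u y; rewrite -ea => au ky pp; have ky' : other_edge (opp E h) y by rewrite oo.
    by have [u' m] := H1 u y au ky' pp; exists u'; apply: mt.
  by have [u' m] := H2 u y au ky' pp; exists u'; apply: mt.
have nx : opp E x \notin [:: h; a; b; opp E h; c; d].
  rewrite !inE !negb_or; move: nab ncd; rewrite !negb_or => /andP [-> ->] /andP [-> ->].
  move: kx; rewrite /other_edge same_edge negb_or => /andP [k1 k2].
  by rewrite opp_eq k2 (inj_eq perm_inj) k1.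
case: (D) => _ _ _ fr.
have n1 := cl _ nx; have n2 := cl _ n1.
have kept k : k \notin [:: h; a; b; opp E h; c; d] -> other_edge h k.
  rewrite !inE !negb_or /other_edge same_edge => /and5P [/negbTE -> _ _ /negbTE -> _] //.
have t0 k Z : k \notin [:: h; a; b; opp E h; c; d] -> inner_shift h a b c d k Z = 0.
  rewrite !inE !negb_or /inner_shift => /and5P [_ /negbTE -> /negbTE -> _ /andP [/negbTE -> /negbTE ->]].
  by rewrite subr0.
apply: passages_away => //; rewrite ?fr //; try exact: kept.
by move=> Z; rewrite !t0.
Qed.

(** The number of ends of the edge of y at which x or its opposite sits: this turns the
    shifts of coordinates, indexed by edges, into shifts at ends. *)
Lemma edge_count x y : (x.1 == y.1) = ((x == y) + (opp E x == y))%N :> nat.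
Proof.
rewrite same_edge opp_eq; case: eqP => [->|_]; last by case: eqP.
by rewrite eq_sym (negbTE (opp_neq y)).
Qed.

Lemma inner_flip_map_shift G h Z x : other_edge h x ->
  inner_flip_map h G Z x.1 = Z x.1 +
    inner_shift h (G (G h)) (G h) (G (G (opp E h))) (G (opp E h)) x Z +
    inner_shift h (G (G h)) (G h) (G (G (opp E h))) (G (opp E h)) (opp E x) Z.
Proof.
rewrite /other_edge /inner_flip_map /inner_shift => /negbTE ->.
rewrite !edge_count !mulrnDr; ring.
Qed.

Lemma cycle_succ (T : eqType) (e : rel T) (p : seq T) (x : T) : path.cycle e p -> x \in p ->
  exists2 y, y \in p & e x y.
Proof.
by move=> cp xp; exists (path.next p x); [rewrite mem_next | apply: next_cycle].
Qed.

(** Both directions come from [transfer_closed_path], with opposite shifts.  A closed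
    path cannot stay on the flipped edge, because its ends are different vertices. *)
Lemma inner_flip_paths G G' h : cubic G -> inner_flip h G G' ->
  (forall p, closed_path G p -> exists2 p', closed_path G' p' &
    forall Z, geodesic_function G' p' (inner_flip_map h G Z) = geodesic_function G p Z) /\
  (forall p', closed_path G' p' -> exists2 p, closed_path G p &
    forall Z, geodesic_function G' p' (inner_flip_map h G Z) = geodesic_function G p Z).
Proof.
move=> cG fl; have D := inner_flip_data cG fl; have cG' := inner_data_cubic cG D.
have zh (Z : E -> R) : inner_flip_map h G Z h.1 = - Z h.1 by rewrite /inner_flip_map eqxx.
case: (D) => uL [[e1 e2 e3] [e4 e5 e6]] [[f1 f2 f3] [f4 f5 f6]] fr.
have out (H : fatgraph E) : cubic H -> H (opp E h) \notin [:: h; opp E h] ->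
   H (H (opp E h)) \notin [:: h; opp E h] -> H h \notin [:: h; opp E h] ->
   H (H h) \notin [:: h; opp E h] -> forall p, closed_path H p -> has (other_edge h) p.
  move=> cH h1 h2 h3 h4 p /andP [np cp]; apply/negPn; rewrite -all_predC; apply/negP => /allP al.
  have [x xp] : exists x, x \in p by case: (p) np => // x s _; exists x; rewrite mem_head.
  have [y yp sy] := cycle_succ cp xp; move: sy; rewrite /path_step.
  have bad k : k \in p -> k \in [:: h; opp E h].
    by move=> /al; rewrite /= negbK same_edge !inE.
  have := bad _ xp; rewrite !inE => /orP [] /eqP -> /orP [] /eqP ey; have := bad _ yp;
    by rewrite ey ?left_turnE // ?right_turnE // ?oppK; apply/negP.
have [na nb nc nd] : [/\ G (G h) \notin [:: h; opp E h], G h \notin [:: h; opp E h],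
    G (G (opp E h)) \notin [:: h; opp E h] & G (opp E h) \notin [:: h; opp E h]].
  move: uL; rewrite /= !inE !negb_or -!andbA.
  case/and5P => n1 n2 n3 n4 /and5P [n5 n6 n7 n8 /and5P [n9 n10 n11 n12 /and4P [n13 n14 n15 _]]].
  by rewrite ![_ == h]eq_sym n1 n2 n4 n5 n7 n10 ![_ == opp E h]eq_sym n13 n14.
split.
- move=> p cp; apply: (@transfer_closed_path R E (E -> R) G G' id (inner_flip_map h G)
    (inner_shift h (G (G h)) (G h) (G (G (opp E h))) (G (opp E h))) (other_edge h)) => //.
  + by move=> Z x kx; apply: inner_flip_map_shift kx.
  + move=> x u y kx au ky pp; have [H _] := inner_passages cG D kx.
    have [u' [_ p' H']] := H u y au ky pp; exists u' => // Z; exact: H'.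
  + by apply: out cp; rewrite ?e1 ?e4.
- move=> p' cp'.
  have [|||p cp e] := @transfer_closed_path R E (E -> R) G' G (inner_flip_map h G) id
    (fun y Z => - inner_shift h (G (G h)) (G h) (G (G (opp E h))) (G (opp E h)) y Z)
    (other_edge h) _ _ p' cp'.
  + by move=> Z x kx; rewrite (inner_flip_map_shift _ _ kx) /=; ring.
  + move=> x u y kx au ky pp; have [_ H] := inner_passages cG D kx.
    have [u' [pg _ H']] := H u y au ky pp; exists u' => // Z.
    rewrite -(H' Z (inner_flip_map h G Z)) //= !mulmxA opprK shift_mxKN mul1mx -!mulmxA.
    by rewrite shift_mxKN mulmx1.
  + by apply: out cp'; rewrite ?f1 ?f2 ?f4 ?f5.
  + by exists p => // Z; rewrite e.
Qed.

End LocalPassages.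

(** * Passages near a pending flip *)
Section PendingPassages.
Context {R : realType} {E : finType}.
Implicit Types (G : fatgraph E) (x y z k h l r o : halfedge E)
  (s u p : seq (halfedge E)) (Z : E -> R).

Lemma pending_passage_cases (step : rel (halfedge E)) (kept : pred (halfedge E)) x e e' l l' r' u y :
  (forall k, step x k = (k == l) || (k == e)) ->
  (forall k, step e k = (k == e')) ->
  (forall k, step e' k = (k == l') || (k == r')) ->
  kept l -> ~~ kept e -> ~~ kept e' -> kept l' -> kept r' ->
  all (predC kept) u -> kept y -> path step x (rcons u y) ->
  [\/ u = [::] /\ y = l, u = [:: e; e'] /\ y = l' | u = [:: e; e'] /\ y = r'].
Proof.
move=> s1 s2 s3 kl ke ke' kl' kr'; case: u => [|k u] /=.
  move=> _ ky; rewrite s1 andbT => /orP [] /eqP ey; first by constructor 1.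
  by move: ke; rewrite -ey ky.
case/andP => kk au ky /andP []; rewrite s1 => /orP [] /eqP ek; rewrite {}ek in kk *.
  by move: kk; rewrite /= kl.
case: u au => [_|k2 u] /=.
  by rewrite s2 andbT => /eqP ey; move: ke'; rewrite -ey ky.
case/andP => k2k au /andP []; rewrite s2 => /eqP ->.
case: u au => [_|k3 u] /=.
  by rewrite s3 andbT => /orP [] /eqP ->; [constructor 2|constructor 3].
case/andP => k3k _ /andP []; rewrite s3 => /orP [] /eqP e3; move: k3k;
  by rewrite e3 /= ?kl' ?kr'.
Qed.

Definition pending_shift h y z k Z : R :=
  phi (2 * Z h.1) *+ (k == z) - phi (- (2 * Z h.1)) *+ (k == y).

(** Passing from y to z directly, with the marked point on one side, becomes going
    round it on the other side, by a visit to the pending edge, and conversely. *)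
Lemma pending_near G G' h y z x : cubic G -> pending_data h y z G G' ->
  (opp E x == y) || (opp E x == z) ->
  (forall u k, all (predC (other_edge h)) u -> other_edge h k ->
    path (path_step G) x (rcons u k) ->
    exists u', matched G G' (pending_shift h y z) h x u u' k) /\
  (forall u' k, all (predC (other_edge h)) u' -> other_edge h k ->
    path (path_step G') x (rcons u' k) ->
    exists u, matched G G' (pending_shift h y z) h x u u' k).
Proof.
move=> cG D; have cG' := pending_data_cubic cG D; have no := pending_data_opp D.
case: D => [uL po [e1 e2 e3] [f1 f2 f3] fr].
have po' : G' (opp E h) = opp E h by rewrite fr.
have nh k : k \notin [:: h; opp E h] -> other_edge h k.
  by rewrite !inE negb_or /other_edge same_edge => /andP [/negbTE -> /negbTE ->].
move: uL no; rewrite /= !inE !negb_or -!andbA => /and4P [n1 n2 n3 _] /and3P [m1 m2 m3].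
have ne (s t : halfedge E) : s != t -> ((s == t) = false) * ((t == s) = false).
  by rewrite [t == s]eq_sym => /negbTE ->.
have NE := (ne _ _ n1, ne _ _ n2, ne _ _ n3, ne _ _ m1, ne _ _ m2, ne _ _ m3).
have ky : other_edge h y by apply: nh; rewrite !inE !NE.
have kz : other_edge h z by apply: nh; rewrite !inE !NE.
have kh : ~~ other_edge h h by rewrite /other_edge eqxx.
have kh' : ~~ other_edge h (opp E h) by rewrite /other_edge opp_fst eqxx.
have ty Z : pending_shift h y z y Z = - phi (- (2 * Z h.1)).
  by rewrite /pending_shift eqxx !NE sub0r.
have tz Z : pending_shift h y z z Z = phi (2 * Z h.1).
  by rewrite /pending_shift eqxx !NE subr0.
have hh : opp E (opp E h) = h by rewrite oppK.
have Fh : turn_mx G h (opp E h) = F_mx :> 'M[R]_2 by rewrite /turn_mx /pending_end po eqxx.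
have Fh' : turn_mx G' h (opp E h) = F_mx :> 'M[R]_2 by rewrite /turn_mx /pending_end po' eqxx.
have sh k : path_step G h k = (k == opp E h).
  by rewrite /path_step left_turnE // right_turnE // !po orbb.
have sh' k : path_step G' h k = (k == opp E h).
  by rewrite /path_step left_turnE // right_turnE // !po' orbb.
have [|so Lo Ro] := step_at (R := R) (x := opp E h) cG hh e1 e2; first by rewrite !NE.
have [|so' Lo' Ro'] := step_at (R := R) (x := opp E h) cG' hh f1 f2; first by rewrite !NE.
have v H (Z : E -> R) k (T : 'M[R]_2) : turn_mx H h (opp E h) = F_mx :> 'M[R]_2 -> turn_mx H (opp E h) k = T ->
    passage_mx H Z x [:: h; opp E h] k = T *m X_mx (2 * Z h.1) *m turn_mx H x h.
  by move=> /= -> ->; rewrite opp_fst -X_F_X !mulmxA.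
have w (Z Z' : E -> R) : Z' h.1 = - Z h.1 -> 2 * Z' h.1 = - (2 * Z h.1).
  by move=> ->; rewrite mulrN.
case/orP => /eqP ox.
- have [|sx Lx Rx] := step_at (R := R) (x := x) cG ox e2 e3; first by rewrite !NE.
  have [|sx' Lx' Rx'] := step_at (R := R) (x := x) cG' ox f3 f1; first by rewrite !NE.
  have M1 : matched G G' (pending_shift h y z) h x [::] [:: h; opp E h] z.
    split=> [||Z Z' eZ]; [by rewrite /= ?sx ?sx' ?sh' ?so' ?eqxx ?orbT|by rewrite /= ?sx ?sx' ?sh' ?so' ?eqxx ?orbT|].
    rewrite (v _ _ _ _ Fh' Ro') (w _ _ eZ) ox ty tz Rx' /= Rx.
    by have [_ [-> _ _]] := flip_matrices (2 * Z h.1).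
  have M2 : matched G G' (pending_shift h y z) h x [:: h; opp E h] [::] z.
    split=> [||Z Z' eZ]; [by rewrite /= ?sx ?sx' ?sh ?so ?eqxx ?orbT|by rewrite /= ?sx ?sx' ?sh ?so ?eqxx ?orbT|].
    rewrite (v _ _ _ _ Fh Lo) ox ty tz Lx /= Lx'.
    by have [_ [_ -> _]] := flip_matrices (2 * Z h.1).
  have M3 : matched G G' (pending_shift h y z) h x [:: h; opp E h] [:: h; opp E h] y.
    split=> [||Z Z' eZ]; [by rewrite /= ?sx ?sx' ?sh ?so ?sh' ?so' ?eqxx ?orbT|by rewrite /= ?sx ?sx' ?sh ?so ?sh' ?so' ?eqxx ?orbT|].
    rewrite (v _ _ _ _ Fh' Lo') (v _ _ _ _ Fh Ro) (w _ _ eZ) ox ty opprK Lx Rx'.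
    by have [_ [_ _ ->]] := flip_matrices (2 * Z h.1).
  have sx2 k : path_step G x k = (k == z) || (k == h) by rewrite sx orbC.
  split=> [u k au kk pp|u' k au kk pp].
    case: (pending_passage_cases sx2 sh so kz kh kh' kz ky au kk pp) => [] [-> ->];
      [exists [:: h; opp E h] | exists [::] | exists [:: h; opp E h]] => //.
  case: (pending_passage_cases sx' sh' so' kz kh kh' ky kz au kk pp) => [] [-> ->];
      [exists [:: h; opp E h] | exists [:: h; opp E h] | exists [::]] => //.
- have [|sx Lx Rx] := step_at (R := R) (x := x) cG ox e3 e1; first by rewrite !NE.
  have [|sx' Lx' Rx'] := step_at (R := R) (x := x) cG' ox f2 f3; first by rewrite !NE.
  have M1 : matched G G' (pending_shift h y z) h x [::] [:: h; opp E h] y.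
    split=> [||Z Z' eZ]; [by rewrite /= ?sx ?sx' ?sh' ?so' ?eqxx ?orbT|by rewrite /= ?sx ?sx' ?sh' ?so' ?eqxx ?orbT|].
    rewrite (v _ _ _ _ Fh' Lo') (w _ _ eZ) ox ty tz opprK Lx' /= Lx.
    by have [[-> _ _] _] := flip_matrices (2 * Z h.1).
  have M2 : matched G G' (pending_shift h y z) h x [:: h; opp E h] [::] y.
    split=> [||Z Z' eZ]; [by rewrite /= ?sx ?sx' ?sh ?so ?eqxx ?orbT|by rewrite /= ?sx ?sx' ?sh ?so ?eqxx ?orbT|].
    rewrite (v _ _ _ _ Fh Ro) ox ty tz opprK Rx /= Rx'.
    by have [[_ _ ->] _] := flip_matrices (2 * Z h.1).
  have M3 : matched G G' (pending_shift h y z) h x [:: h; opp E h] [:: h; opp E h] z.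
    split=> [||Z Z' eZ]; [by rewrite /= ?sx ?sx' ?sh ?so ?sh' ?so' ?eqxx ?orbT|by rewrite /= ?sx ?sx' ?sh ?so ?sh' ?so' ?eqxx ?orbT|].
    rewrite (v _ _ _ _ Fh' Ro') (v _ _ _ _ Fh Lo) (w _ _ eZ) ox tz Rx Lx'.
    by have [[_ -> _] _] := flip_matrices (2 * Z h.1).
  have sx2 k : path_step G' x k = (k == y) || (k == h) by rewrite sx' orbC.
  split=> [u k au kk pp|u' k au kk pp].
    case: (pending_passage_cases sx sh so ky kh kh' kz ky au kk pp) => [] [-> ->];
      [exists [:: h; opp E h] | exists [:: h; opp E h] | exists [::]] => //.
  case: (pending_passage_cases sx2 sh' so' ky kh kh' ky kz au kk pp) => [] [-> ->];
      [exists [:: h; opp E h] | exists [::] | exists [:: h; opp E h]] => //.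
Qed.

Lemma pending_passages G G' h y z x : cubic G -> pending_data h y z G G' ->
  other_edge h x ->
  (forall u k, all (predC (other_edge h)) u -> other_edge h k ->
    path (path_step G) x (rcons u k) ->
    exists u', matched G G' (pending_shift h y z) h x u u' k) /\
  (forall u' k, all (predC (other_edge h)) u' -> other_edge h k ->
    path (path_step G') x (rcons u' k) ->
    exists u, matched G G' (pending_shift h y z) h x u u' k).
Proof.
move=> cG D kx; have cG' := pending_data_cubic cG D; have cl := pending_data_closed D.
case: (boolP ((opp E x == y) || (opp E x == z))) => [yz|]; first exact: pending_near D yz.
rewrite negb_or => /andP [ny nz]; case: (D) => _ po _ _ fr.
move: kx; rewrite /other_edge same_edge negb_or => /andP [k1 k2].
have nx : opp E x \notin [:: h; y; z] by rewrite !inE !negb_or ny nz opp_eq k2.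
have no : opp E x != opp E h by rewrite (inj_eq perm_inj).
have n1 := cl _ nx; have n2 := cl _ n1.
have kept k : k \notin [:: h; y; z] -> k != opp E h -> other_edge h k.
  by rewrite !inE !negb_or /other_edge same_edge => /and3P [/negbTE -> _ _] /negbTE ->.
have no1 : G (opp E x) != opp E h by rewrite -po (inj_eq perm_inj).
have no2 : G (G (opp E x)) != opp E h by rewrite -po (inj_eq perm_inj).
have t0 k Z : k \notin [:: h; y; z] -> pending_shift h y z k Z = 0.
  by rewrite !inE !negb_or /pending_shift => /and3P [_ /negbTE -> /negbTE ->]; rewrite subr0.
apply: passages_away => //; rewrite ?fr //; try exact: kept.
by move=> Z; rewrite !t0.
Qed.

Lemma pending_flip_map_shift G h Z x : other_edge h x ->
  pending_flip_map h G Z x.1 = Z x.1 + pending_shift h (G h) (G (G h)) x Z +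
    pending_shift h (G h) (G (G h)) (opp E x) Z.
Proof.
rewrite /other_edge /pending_flip_map /pending_shift => /negbTE ->.
rewrite !edge_count !mulrnDr; ring.
Qed.

Lemma pending_flip_paths G G' h : cubic G -> pending_flip h G G' ->
  (forall p, closed_path G p -> exists2 p', closed_path G' p' &
    forall Z, geodesic_function G' p' (pending_flip_map h G Z) = geodesic_function G p Z) /\
  (forall p', closed_path G' p' -> exists2 p, closed_path G p &
    forall Z, geodesic_function G' p' (pending_flip_map h G Z) = geodesic_function G p Z).
Proof.
move=> cG fl; have D := pending_flip_data cG fl; have cG' := pending_data_cubic cG D.
have no := pending_data_opp D.
have zh (Z : E -> R) : pending_flip_map h G Z h.1 = - Z h.1 by rewrite /pending_flip_map eqxx.
case: (D) => uL po [e1 e2 e3] [f1 f2 f3] fr.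
have po' : G' (opp E h) = opp E h by rewrite fr.
have out (H : fatgraph E) : cubic H -> H (opp E h) = opp E h ->
   H h \notin [:: h; opp E h] -> H (H h) \notin [:: h; opp E h] ->
   forall p, closed_path H p -> has (other_edge h) p.
  move=> cH ho h1 h2 p /andP [np cp]; apply/negPn; rewrite -all_predC; apply/negP => /allP al.
  have bad k : k \in p -> k \in [:: h; opp E h].
    by move=> /al; rewrite /= negbK same_edge !inE.
  have op : opp E h \in p.
    have [x xp] : exists x, x \in p by case: (p) np => // x s _; exists x; rewrite mem_head.
    have := bad _ xp; rewrite !inE => /orP [] /eqP ex; rewrite ex in xp => //.
    have [y yp] := cycle_succ cp xp.
    by rewrite /path_step left_turnE // right_turnE // !ho orbb => /eqP <-.
  have [y yp] := cycle_succ cp op; rewrite /path_step left_turnE // right_turnE // oppK.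
  by case/orP => /eqP ey; have := bad _ yp; rewrite ey; apply/negP.
have [ny nz] : G h \notin [:: h; opp E h] /\ G (G h) \notin [:: h; opp E h].
  move: uL no; rewrite /= !inE !negb_or -!andbA => /and4P [n1 n2 n3 _] /and3P [m1 m2 m3].
  by rewrite ![_ == h]eq_sym n1 n2 ![_ == opp E h]eq_sym m2 m3.
split.
- move=> p cp; apply: (@transfer_closed_path R E (E -> R) G G' id (pending_flip_map h G)
    (pending_shift h (G h) (G (G h))) (other_edge h)) => //.
  + by move=> Z x kx; apply: pending_flip_map_shift kx.
  + move=> x u y kx au ky pp; have [H _] := pending_passages cG D kx.
    have [u' [_ p' H']] := H u y au ky pp; exists u' => // Z; exact: H'.
  + by apply: out cp.
- move=> p' cp'.
  have [|||p cp e] := @transfer_closed_path R E (E -> R) G' G (pending_flip_map h G) id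
    (fun y Z => - pending_shift h (G h) (G (G h)) y Z) (other_edge h) _ _ p' cp'.
  + by move=> Z x kx; rewrite (pending_flip_map_shift _ _ kx) /=; ring.
  + move=> x u y kx au ky pp; have [_ H] := pending_passages cG D kx.
    have [u' [pg _ H']] := H u y au ky pp; exists u' => // Z.
    rewrite -(H' Z (pending_flip_map h G Z)) //= !mulmxA opprK shift_mxKN mul1mx -!mulmxA.
    by rewrite shift_mxKN mulmx1.
  + by apply: out cp'; rewrite ?f1 ?f2.
  + by exists p => // Z; rewrite e.
Qed.

End PendingPassages.

(** * Poisson isomorphisms induced by flips *)
Section Algebra.
Context {R : realType} {E : finType}.
Implicit Types (G : fatgraph E) (f g : (E -> R) -> R).

Lemma geodesic_algebra_min G (A : set ((E -> R) -> R)) :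
  poisson_subalgebra G A ->
  (forall p, closed_path G p -> A (geodesic_function G p)) ->
  forall f, geodesic_algebra G f -> A f.
Proof. by move=> HA Hp f; apply; split=> // _ [p /Hp ? <-]. Qed.

Lemma geodesic_algebra_gen G p : closed_path G p ->
  geodesic_algebra G (geodesic_function G p : (E -> R) -> R).
Proof. by move=> cp A [_]; apply; exists p. Qed.

Lemma geodesic_algebra_poisson G : poisson_subalgebra G (geodesic_algebra (R := R) G).
Proof.
split.
- by move=> c A [[H _ _ _] _]; apply: H.
- by move=> f1 f2 h1 h2 A HA; case: (HA) => -[_ H _ _] _; apply: H; [apply: h1|apply: h2].
- by move=> f1 f2 h1 h2 A HA; case: (HA) => -[_ _ H _] _; apply: H; [apply: h1|apply: h2].
- by move=> f1 f2 h1 h2 A HA; case: (HA) => -[_ _ _ H] _; apply: H; [apply: h1|apply: h2].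
Qed.

Lemma exp_poly_geodesic G p : exp_poly (geodesic_function G p : (E -> R) -> R).
Proof.
case: p => [|x s]; first exact: (exp_poly_cst (\tr (1%:M : 'M[R]_2))).
suff entry : forall v y i j, exp_poly (fun Z : E -> R => walk_mx G Z y v i j).
  rewrite (_ : geodesic_function G (x :: s) =
    (fun Z => \sum_i walk_mx G Z x (rcons s x) i i)); first by apply: exp_poly_sum.
  by apply/funext => Z; rewrite geodesic_functionE.
elim=> [|k v IH] y i j /=; first exact: (exp_poly_cst ((1%:M : 'M[R]_2) i j)).
have X a b : exp_poly (fun Z : E -> R => X_mx (Z y.1) a b).
  have e1 : exp_poly (fun Z : E -> R => - expR (Z y.1 / 2)).
    rewrite (_ : (fun _ => _) = cst (-1) \* (fun Z : E -> R => expR (2^-1 * Z y.1))).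
      by apply: exp_polyM; [exact: exp_poly_cst | exact: exp_poly_exp].
    by apply/funext => Z /=; rewrite mulN1r mulrC.
  have e2 : exp_poly (fun Z : E -> R => expR (- Z y.1 / 2)).
    rewrite (_ : (fun _ => _) = (fun Z : E -> R => expR (- 2^-1 * Z y.1))).
      exact: exp_poly_exp.
    by apply/funext => Z /=; rewrite !mulNr mulrC.
  rewrite (_ : (fun _ => _) = (fun Z : E -> R => if a == 0 then (if b == 0 then 0 else - expR (Z y.1 / 2))
      else (if b == 0 then expR (- Z y.1 / 2) else 0))); last by apply/funext => Z; rewrite /X_mx mxE.
  by case: (a == 0); case: (b == 0) => //; exact: exp_poly_cst.
rewrite (_ : (fun _ => _) = (fun Z => \sum_a walk_mx G Z k v i a *
    \sum_b turn_mx G y k a b * X_mx (Z y.1) b j)); last first.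
  by apply/funext => Z; rewrite mxE; apply: eq_bigr => a _; rewrite mxE.
apply: exp_poly_sum => a; apply: (exp_polyM (IH _ _ _)); apply: exp_poly_sum => b.
exact: (exp_polyM (exp_poly_cst _) (X _ _)).
Qed.

Lemma exp_poly_algebra G f : geodesic_algebra G f -> exp_poly f.
Proof.
apply: geodesic_algebra_min; last by move=> p _; apply: exp_poly_geodesic.
split.
- exact: exp_poly_cst.
- exact: exp_polyD.
- exact: exp_polyM.
- exact: exp_poly_bracket.
Qed.

End Algebra.

Section Pullback.
Context {R : realType} {E1 E2 : finType}.
Variables (G1 : fatgraph E1) (G2 : fatgraph E2) (psi : (E1 -> R) -> (E2 -> R)).

(** The functions whose composite lies in the algebra of G1, and the composites of
    functions of the algebra of G2, form Poisson subalgebras; both contain the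
    generators.  Surjectivity of psi makes composition injective. *)
Lemma poisson_pullback :
  (forall W, exists Z, psi Z = W) ->
  (forall p, closed_path G1 p -> exists2 p', closed_path G2 p' &
    forall Z, geodesic_function G2 p' (psi Z) = geodesic_function G1 p Z) ->
  (forall p', closed_path G2 p' -> exists2 p, closed_path G1 p &
    forall Z, geodesic_function G2 p' (psi Z) = geodesic_function G1 p Z) ->
  (forall f g Z, exp_poly f -> exp_poly g ->
    bracket G1 (f \o psi) (g \o psi) Z = bracket G2 f g (psi Z)) ->
  poisson_isomorphism G2 G1 (fun f => f \o psi).
Proof.
move=> sur gen1 gen2 br.
have br' f g : exp_poly f -> exp_poly g ->
    bracket G1 (f \o psi) (g \o psi) = bracket G2 f g \o psi.
  by move=> hf hg; apply/funext => Z; apply: br.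
have [c1 a1 m1 b1] := geodesic_algebra_poisson (R := R) G1.
have [c2 a2 m2 b2] := geodesic_algebra_poisson (R := R) G2.
split=> //; last first.
  by move=> f1 f2 /exp_poly_algebra h1 /exp_poly_algebra h2; rewrite br'.
split.
- move=> f hf; suff [] : exp_poly f /\ geodesic_algebra G1 (f \o psi) by [].
  apply: (geodesic_algebra_min (A := fun f => exp_poly f /\ geodesic_algebra G1 (f \o psi)) _ _ hf).
    split=> [c|f1 f2 [p1 q1] [p2 q2]|f1 f2 [p1 q1] [p2 q2]|f1 f2 [p1 q1] [p2 q2]].
    + by split; [exact: exp_poly_cst | exact: c1].
    + by split; [exact: exp_polyD | exact: a1 q1 q2].
    + by split; [exact: exp_polyM | exact: m1 q1 q2].
    + by split; [exact: exp_poly_bracket | rewrite -br' //; exact: b1].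
  move=> p' /gen2 [p cp e]; split; first exact: exp_poly_geodesic.
  rewrite (_ : _ \o _ = geodesic_function G1 p); first exact: geodesic_algebra_gen.
  by apply/funext.
- move=> f g _ _ /= e; apply/funext => W; have [Z <-] := sur W.
  exact: (congr1 (fun k => k Z) e).
- apply: geodesic_algebra_min.
    split=> [c|f1 f2 [g1 q1 <-] [g2 q2 <-]|f1 f2 [g1 q1 <-] [g2 q2 <-]|f1 f2 [g1 q1 <-] [g2 q2 <-]].
    + by exists (cst c) => //; exact: c2.
    + by exists (g1 \+ g2) => //; exact: a2.
    + by exists (g1 \* g2) => //; exact: m2.
    + exists (bracket G2 g1 g2); first exact: b2.
      by rewrite br' //; [apply: exp_poly_algebra q1 | apply: exp_poly_algebra q2].
  move=> p /gen1 [p' cp e]; exists (geodesic_function G2 p'); first exact: geodesic_algebra_gen.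
  by apply/funext => Z; rewrite /= e.
Qed.

End Pullback.

Section Isomorphisms.
Context {R : realType}.

Lemma poisson_isomorphism_id (E : finType) (G : fatgraph E) :
  poisson_isomorphism G G (fun f : (E -> R) -> R => f \o id).
Proof.
apply: poisson_pullback => //; first by move=> W; exists W.
  by move=> p cp; exists p.
by move=> p cp; exists p.
Qed.

Lemma poisson_isomorphism_comp (E1 E2 E3 : finType) (G1 : fatgraph E1) (G2 : fatgraph E2)
    (G3 : fatgraph E3) (psi : (E1 -> R) -> (E2 -> R)) (chi : (E2 -> R) -> (E3 -> R)) :
  poisson_isomorphism G2 G1 (fun f => f \o psi) ->
  poisson_isomorphism G3 G2 (fun f => f \o chi) ->
  poisson_isomorphism G3 G1 (fun f => f \o (chi \o psi)).
Proof.
move=> [[h1 i1 s1] c1 a1 m1 b1] [[h2 i2 s2] c2 a2 m2 b2]; split=> //.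
- split.
  + by move=> f /h2 /h1.
  + move=> f g; rewrite !inE => hf hg e.
    apply: (i2 _ _ (mem_set hf) (mem_set hg)).
    by apply: (i1 _ _ (mem_set (h2 _ hf)) (mem_set (h2 _ hg))).
  + by move=> f /s1 [g /s2 [k hk <-] <-]; exists k.
- move=> f1 f2 q1 q2.
  rewrite -[RHS](b1 _ _ (h2 _ q1) (h2 _ q2)).
  by have := b2 _ _ q1 q2 => /= <-.
Qed.

Lemma inner_flip_poisson (E : finType) (G G' : fatgraph E) h : cubic G -> inner_flip h G G' ->
  poisson_isomorphism G' G (fun f : (E -> R) -> R => f \o inner_flip_map h G).
Proof.
move=> cG fl; have [g1 g2] := inner_flip_paths (R := R) cG fl.
apply: poisson_pullback => //; last first.
  by move=> f g Z hf hg; apply: inner_flip_bracket.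
move=> W; pose w := W h.1.
exists (fun e => if e == h.1 then - w else
  W e - phi (- w) *+ (e == (G (G h)).1) + phi w *+ (e == (G h).1)
  - phi (- w) *+ (e == (G (G (opp E h))).1) + phi w *+ (e == (G (opp E h)).1)).
apply/funext => e; rewrite /inner_flip_map eqxx; case: eqP => [->|_]; first by rewrite opprK.
by rewrite opprK; ring.
Qed.

Lemma pending_flip_poisson (E : finType) (G G' : fatgraph E) h : cubic G -> pending_flip h G G' ->
  poisson_isomorphism G' G (fun f : (E -> R) -> R => f \o pending_flip_map h G).
Proof.
move=> cG fl; have [g1 g2] := pending_flip_paths (R := R) cG fl.
apply: poisson_pullback => //; last first.
  by move=> f g Z hf hg; apply: pending_flip_bracket.
move=> W; pose w := W h.1.
exists (fun e => if e == h.1 then - w else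
  W e + phi (2 * w) *+ (e == (G h).1) - phi (- (2 * w)) *+ (e == (G (G h)).1)).
apply/funext => e; rewrite /pending_flip_map eqxx; case: eqP => [->|_]; first by rewrite opprK.
by rewrite mulrN opprK; ring.
Qed.

Lemma flips_poisson (E : finType) (G G' : fatgraph E) psi : cubic G -> flips G G' psi ->
  cubic G' /\ poisson_isomorphism G' G (fun f : (E -> R) -> R => f \o psi).
Proof.
move=> cG; elim=> {G' psi} [|G1 G2 psi h _ [c1 IH] fl|G1 G2 psi h _ [c1 IH] fl].
- by split=> //; apply: poisson_isomorphism_id.
- split; first exact: inner_data_cubic (inner_flip_data c1 fl).
  exact: poisson_isomorphism_comp IH (inner_flip_poisson c1 fl).
- split; first exact: pending_data_cubic (pending_flip_data c1 fl).
  exact: poisson_isomorphism_comp IH (pending_flip_poisson c1 fl).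
Qed.

Section Relabel.
Context {E1 E2 : finType}.
Variables (G1 : fatgraph E1) (G2 : fatgraph E2) (theta : halfedge E2 -> halfedge E1).
Hypotheses (iso : fatgraph_iso G1 G2 theta) (c1 : cubic G1).

Let inj : injective theta. Proof. by case: iso => /bij_inj. Qed.
Let theta_opp h : theta (opp E2 h) = opp E1 (theta h). Proof. by case: iso. Qed.
Let theta_G h : theta (G2 h) = G1 (theta h). Proof. by case: iso. Qed.

Lemma iso_cubic : cubic G2.
Proof. by move=> h; apply: inj; rewrite !theta_G c1. Qed.

Lemma relabelE (Z : E1 -> R) h : relabel theta Z h.1 = Z (theta h).1.
Proof.
case: h => e [] //; rewrite /relabel /=.
have -> : (e, true) = opp E2 (e, false) by rewrite oppE.
by rewrite theta_opp opp_fst.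
Qed.

Lemma theta_edge h k : ((theta h).1 == (theta k).1) = (h.1 == k.1).
Proof. by rewrite !same_edge -theta_opp !(inj_eq inj). Qed.

Lemma theta_left h : theta (left_turn G2 h) = left_turn G1 (theta h).
Proof. by rewrite !left_turnE ?theta_G ?theta_opp //; exact: iso_cubic. Qed.

Lemma theta_step h k : path_step G1 (theta h) (theta k) = path_step G2 h k.
Proof.
by rewrite /path_step -theta_left !right_turnE -theta_opp -theta_G !(inj_eq inj).
Qed.

Lemma walk_mx_relabel (Z : E1 -> R) x s :
  walk_mx G1 Z (theta x) (map theta s) = walk_mx G2 (relabel theta Z) x s.
Proof.
elim: s x => //= y s IH x; rewrite IH relabelE; congr (_ *m (_ *m _)).
by rewrite /turn_mx /pending_end -theta_opp -theta_G -theta_left !(inj_eq inj).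
Qed.

Lemma geodesic_relabel (Z : E1 -> R) p :
  geodesic_function G1 (map theta p) Z = geodesic_function G2 p (relabel theta Z).
Proof.
case: p => [|x s] //; rewrite map_cons !geodesic_functionE -map_rcons.
by rewrite walk_mx_relabel.
Qed.

Lemma closed_path_relabel p : closed_path G1 (map theta p) <-> closed_path G2 p.
Proof.
case: p => [|x s] //; rewrite /closed_path /= -map_rcons path_map.
by rewrite (eq_path (e' := path_step G2)) // => h k; apply: theta_step.
Qed.

Lemma relabel_bracket f g (Z : E1 -> R) : exp_poly f -> exp_poly g ->
  bracket G1 (f \o relabel theta) (g \o relabel theta) Z = bracket G2 f g (relabel theta Z).
Proof.
have pd k dk h : gradient k dk ->
    pderiv (theta h).1 (k \o relabel theta) Z = dk h.1 (relabel theta Z).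
  move=> H; rewrite /pderiv derive1E.
  have DJ e' : is_derive (Z (theta h).1) 1
      (fun t : R => relabel theta [eta Z with (theta h).1 |-> t] e') ((e' == h.1)%:R : R).
    have := is_derive_line Z (theta h).1 (theta (e', false)).1.
    by rewrite theta_edge.
  have DD := gradient_chain DJ H.
  by rewrite (@derive_val _ _ _ _ _ _ _ DD) line_id sum_delta.
move=> [df Hf] [dg Hg]; rewrite !bracketE //; last exact: iso_cubic.
rewrite /wedge_sum (reindex theta) /=; last by case: iso => b _ _; exact: onW_bij.
apply: eq_bigr => h _; rewrite -theta_G.
by rewrite !(pd _ _ _ Hf) !(pd _ _ _ Hg) !(pderiv_gradient _ _ Hf) !(pderiv_gradient _ _ Hg).
Qed.

Lemma relabel_poisson :
  poisson_isomorphism G2 G1 (fun f : (E2 -> R) -> R => f \o relabel theta).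
Proof.
have [theta' K1 K2] : bijective theta by case: iso.
apply: poisson_pullback.
- move=> W; exists (fun e => W (theta' (e, false)).1); apply/funext => e.
  rewrite /relabel; congr W.
  have [] : ((theta (e, false)).1, false) = theta (e, false) \/
            ((theta (e, false)).1, false) = theta (opp E2 (e, false)).
  + by rewrite theta_opp oppE; case: (theta _) => e' []; [right|left].
  + by move=> ->; rewrite K1.
  + by move=> ->; rewrite K1 opp_fst.
- move=> p; have -> : p = map theta (map theta' p).
    by rewrite -map_comp map_id_in // => x _ /=; rewrite K2.
  move=> /closed_path_relabel cp; exists (map theta' p) => // Z.
  by rewrite geodesic_relabel.
- move=> p /closed_path_relabel cp; exists (map theta p) => // Z.
  by rewrite geodesic_relabel.
- by move=> f g Z hf hg; apply: relabel_bracket.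
Qed.

End Relabel.

Lemma flip_chain_poisson (E1 E2 : finType) (G1 : fatgraph E1) (G2 : fatgraph E2) psi :
  cubic G1 -> flip_chain G1 G2 psi ->
  poisson_isomorphism G2 G1 (fun f : (E2 -> R) -> R => f \o psi).
Proof.
move=> c1 [G [psi0 [theta [fl iso ->]]]]; have [c p] := flips_poisson c1 fl.
exact: poisson_isomorphism_comp p (relabel_poisson iso c).
Qed.

Lemma flip_path_flips (E : finType) (G G' : fatgraph E) : flip_path G G' ->
  exists psi : (E -> R) -> (E -> R), flips G G' psi.
Proof.
elim=> [|G1 G2 _ [psi fl] [] [h s]]; first by exists id; apply: flips_nil.
- by eexists; apply: flips_inner fl s.
- by eexists; apply: flips_pending fl s.
Qed.

End Isomorphisms.

(** * Numbers attached to a spine *)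
Section Counting.
Local Close Scope ring_scope.
Context {E : finType}.
Variables (G : fatgraph E) (g s : nat) (d : 'I_s -> nat).
Hypothesis sp : spine g d G.

Lemma spine_cubic : cubic G.
Proof. by case: sp => H _ _ _; apply: cubic_of_porbit. Qed.

Lemma spine_faces : #|porbits (left_turn G)| = s.
Proof.
by case: sp => _ _ _ [b [ib <- _]]; rewrite card_imset // card_ord.
Qed.

Lemma spine_ends : #|pending_ends G| = (\sum_(i < s) d i)%N.
Proof.
case: sp => _ _ _ [b [ib eb cb]].
rewrite -sum1_card (partition_big (porbit (left_turn G)) (mem (porbits (left_turn G)))) /=; last first.
  by move=> h _; apply: imset_f.
rewrite -eb big_imset /=; last by move=> i j _ _; apply: ib.
apply: eq_bigr => i _; rewrite -cb -sum1_card; apply: eq_bigl => h.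
rewrite !inE andbC; congr (_ && _).
have : b i \in porbits (left_turn G) by rewrite -eb imset_f.
by case/imsetP => x _ ->; rewrite eq_porbit_mem.
Qed.

(** Both sides count the half-edges with weight 3 at one-valent vertices and 1 at
    three-valent ones. *)
Lemma spine_vertices : (3 * #|porbits G| = #|{: halfedge E}| + 2 * #|pending_ends G|)%N.
Proof.
have cG := spine_cubic; case: sp => H _ _ _.
transitivity (\sum_(h : halfedge E) (1 + 2 * (G h == h)))%N; last first.
  rewrite big_split /= sum1_card -big_distrr /=; congr (_ + 2 * _)%N.
  by rewrite -sum1_card [RHS]big_mkcond /=; apply: eq_bigr => h _; rewrite inE; case: (_ == _).
rewrite (partition_big (porbit G) (mem (porbits G))) /=; last by move=> h _; apply: imset_f.
rewrite mulnC -sum_nat_const; apply: eq_bigr => v /imsetP [x _ ->].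
have cl h : (porbit G h == porbit G x) = (h \in porbit G x) by rewrite eq_porbit_mem.
rewrite (eq_bigl _ _ cl); have [xf|xn] := eqVneq (G x) x.
  rewrite (eq_bigl (pred1 x)); first by rewrite big_pred1_eq xf eqxx.
  by move=> h; rewrite porbit_cubic // !inE !xf !orbb.
rewrite (eq_bigl (mem [:: x; G x; G (G x)])) => [|h]; last by rewrite porbit_cubic.
rewrite -big_uniq /=; last exact: cubic_uniq.
by rewrite !big_cons big_nil !(inj_eq perm_inj) (negbTE xn).
Qed.

(** Euler's formula, with the vertices eliminated. *)
Lemma spine_edges : (#|E| + 6 = 2 * (\sum_(i < s) d i) + 3 * s + 6 * g)%N.
Proof.
have := spine_vertices; rewrite spine_ends card_prod card_bool; case: sp => _ _ + _; lia.
Qed.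

(** If every half-edge were a pending end, the number of marked points would be twice
    the number of edges, and Euler's formula would contradict the hypothesis. *)
Lemma spine_nontrivial : (2 < 2 * g + s + ((\sum_(i < s) d i) + 1)./2)%N ->
  exists h, G h != h.
Proof.
move=> hyp; apply/existsP; apply: contraLR hyp => /existsPn n.
have e : #|pending_ends G| = (2 * #|E|)%N.
  rewrite mulnC -card_bool -card_prod; apply: eq_card => h; rewrite !inE.
  by have := n h; rewrite negbK.
have := spine_edges; rewrite -spine_ends e => k.
have -> : ((2 * #|E| + 1)./2 = #|E|)%N by rewrite addn1 mul2n; exact: uphalf_double.
lia.
Qed.

End Counting.

Theorem theorem2 (R : realType) (g s m : nat) (d1 d2 : 'I_s -> nat)
    (hs : (1 <= s)%N)
    (hd1 : (\sum_(i < s) d1 i = m)%N) (hd2 : (\sum_(i < s) d2 i = m)%N)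
    (hyp : (2 < 2 * g + s + (m + 1)./2)%N)
    (E1 E2 : finType) (G1 : fatgraph E1) (G2 : fatgraph E2)
    (hG1 : spine g d1 G1) (hG2 : spine g d2 G2) :
  exists psi : (E1 -> R) -> (E2 -> R),
    flip_chain G1 G2 psi /\
    poisson_isomorphism G2 G1 (fun f : (E2 -> R) -> R => f \o psi).
Proof.
have [|h1 n1] := spine_nontrivial hG1; first by rewrite hd1.
have [|h2 n2] := spine_nontrivial hG2; first by rewrite hd2.
have c1 := spine_cubic hG1; have c2 := spine_cubic hG2.
have [_ cn1 _ _] := hG1; have [_ cn2 _ _] := hG2.
have [|||G [theta [p iso]]] := flip_connected c1 c2 cn1 cn2 n1 n2.
- by have := spine_edges hG1; have := spine_edges hG2; rewrite hd1 hd2; lia.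
- by rewrite (spine_ends hG1) (spine_ends hG2) hd1 hd2.
- by rewrite (spine_faces hG1) (spine_faces hG2).
have [psi fl] := flip_path_flips (R := R) p.
have ch : flip_chain G1 G2 (relabel theta \o psi) by exists G, psi, theta.
by exists (relabel theta \o psi); split=> //; apply: flip_chain_poisson ch.
Qed.
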